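(* Let $\Delta$ be a $(d-1)$-sphere, let $u$ be the largest integer such that $\Delta \in S(d-u, d-1)$, and set $\tilde{u}:=\min\{u, \lfloor(d-1)/2\rfloor\}$. Then the sequence $(g_0(\Delta),g_1(\Delta), \dots, g_{\tilde{u}}(\Delta))$ is a level sequence. In particular, writing $g_i=g_i(\Delta)$: (1) For all $i, j \geq 1$ with $i+j\leq \tilde{u}$, one has $g_i\leq g_j\, g_{i+j}$. (2) Both $(1,g_1,\dots, g_{\lfloor d/2\rfloor})$ and (when $\tilde u\ge 1$) $(1, g_{\tilde{u}-1}, g_{\tilde u-2},\dots, g_{1}, 1)$ are $M$-sequences.
   Context: All simplicial complexes are finite. A missing face of a simplicial complex is a set of vertices that is not a face but all of whose proper subsets are faces; its dimension is its cardinality minus $1$. The link of a face $\tau$ is $\mathrm{lk}(\tau)=\{\sigma\in\Delta:\sigma\cup\tau\in\Delta,\ \sigma\cap\tau=\emptyset\}$. A $(d-1)$-sphere means a $\mathbb{Z}/2\mathbb{Z}$-homology sphere: a pure $(d-1)$-dimensional simplicial complex such that for every face $\sigma$ (including $\emptyset$), $\mathrm{lk}(\sigma)$ has the $\mathbb{Z}/2\mathbb{Z}$-homology of a $(d-1-|\sigma|)$-dimensional sphere. $S(j,d-1)$ denotes the set of $(d-1)$-spheres all of whose missing faces have dimension at most $j$. $f_i$ is the number of $i$-faces ($f_{-1}=1$); $\sum_{i=0}^d f_{i-1}(t-1)^{d-i}=\sum_{i=0}^d h_i t^{d-i}$ defines the $h$-numbers; $g_0=1$, $g_j=h_j-h_{j-1}$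 for $1\le j\le\lceil d/2\rceil$. Level sequences: let $R=\mathbb{R}[x_1,\dots,x_n]$ (standard grading), $\mathbf m=(x_1,\dots,x_n)$, and let $N=\mathbb{R}\oplus N_1\oplus\cdots\oplus N_s$ ($N_s\ne0$) be an Artinian graded quotient ring of $R$. Its socle is $\{y\in N:\mathbf m y=0\}$, a graded vector space containing $N_s$. $N$ is level (of socle degree $s$) if its socle is concentrated in degree $s$, i.e. equals $N_s$. A level sequence is a sequence of the form $(1,\dim_{\mathbb R}N_1,\dots,\dim_{\mathbb R}N_s)$ for an Artinian level ring $N$. $M$-sequences: for positive integers $n,i$ there is a unique expression $n=\binom{n_i}{i}+\binom{n_{i-1}}{i-1}+\cdots+\binom{n_j}{j}$ with $n_i>n_{i-1}>\cdots>n_j\ge j\ge1$; put $n^{\langle i\rangle}=\binom{n_i+1}{i+1}+\cdots+\binom{n_j+1}{j+1}$ and $0^{\langle i\rangle}=0$. A sequence $(a_0,\dots,a_m)$ of nonnegative integers is an $M$-sequence if $a_0=1$ and $a_{i+1}\le a_i^{\langle i\rangle}$ for $1\le i\le m-1$. *)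

(* Defs.v *)
From HB Require Import structures.
From mathcomp Require Import all_boot all_order all_algebra all_field.
From mathcomp Require Import reals.
From mathcomp Require Import mpoly.

Set Implicit Arguments.
Unset Strict Implicit.
Unset Printing Implicit Defensive.

Import Order.TTheory GRing.Theory Num.Theory.
Local Open Scope ring_scope.

Section Complexes.
Variable V : finType.
Implicit Types (D : {set {set V}}) (s t F : {set V}).

(* The vertices are the v with [set v] \in D; elements of V that are not
   vertices are allowed and play no role. The empty face is always present. *)
Definition simplicial_complex D : Prop :=
  set0 \in D /\ (forall s t, s \in D -> t \subset s -> t \in D).

Definition vertices D : {set V} := [set v | [set v] \in D].

Definition missing_face D F : Prop :=
  [/\ F \subset vertices D, F \notin D & forall s, s \proper F -> s \in D].

Definition link D t : {set {set V}} :=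
  [set s in D | (s :|: t \in D) && (s :&: t == set0)].

(* Every facet has cardinality d, i.e. dimension d - 1. *)
Definition pure_dim D (d : nat) : Prop :=
  forall F, maxset (fun s => s \in D) F -> #|F| = d.

(* Z/2-valued functions on all subsets of V; chains of D are the subspaces
   [chains D k] below. *)
Local Notation chain := {ffun {set V} -> ('F_2)^o}.

Definition bdry_fun (c : chain) : chain :=
  [ffun t : {set V} => \sum_(s : {set V} | (t \subset s) && (#|s| == #|t|.+1)) c s].

Fact bdry_is_linear : linear bdry_fun.
Proof.
move=> a c1 c2; apply/ffunP=> t; rewrite !ffunE scaler_sumr -big_split /=.
by apply: eq_bigr => s _; rewrite !ffunE.
Qed.

HB.instance Definition _ :=
  GRing.isLinear.Build 'F_2 chain chain *:%R bdry_fun bdry_is_linear.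

Definition bdry : 'End(chain) := linfun bdry_fun.

Definition elem_chain s : chain := [ffun t : {set V} => (t == s)%:R].

(* Chains spanned by the faces of cardinality k (dimension k - 1); the value
   k = 0 gives the augmentation, so that the homology below is reduced. *)
Definition chains D (k : nat) : {vspace chain} :=
  <<[seq elem_chain s | s <- enum D & #|s| == k]>>%VS.

Definition cycles D k : {vspace chain} := (chains D k :&: lker bdry)%VS.
Definition boundaries D k : {vspace chain} := (bdry @: chains D k.+1)%VS.

(* Dimension over Z/2 of the reduced homology of D in degree k - 1. *)
Definition rbetti D k : nat := (\dim (cycles D k) - \dim (boundaries D k))%N.

(* D has the Z/2-homology of a sphere of dimension k - 1; the (-1)-sphere is
   the complex {set0}. *)
Definition sphere_homology D (k : nat) : Prop :=
  forall i : nat, rbetti D i = (i == k) :> nat.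

(* [sphere d D]: D is a (d-1)-sphere. *)
Definition sphere (d : nat) D : Prop :=
  [/\ simplicial_complex D, pure_dim D d &
      forall s, s \in D -> sphere_homology (link D s) (d - #|s|)].

(* [inS j d D]: D belongs to S(j, d-1). *)
Definition inS (j : int) (d : nat) D : Prop :=
  sphere d D /\ (forall F, missing_face D F -> #|F|%:Z - 1 <= j).

(* Such a u exists only if d >= 1 (the (-1)-sphere has no missing face), and
   then u >= 0, because a missing face of a (d-1)-sphere has dimension <= d. *)
Definition largest_u (d : nat) D (u : int) : Prop :=
  inS (d%:Z - u) d D /\ (forall v : int, inS (d%:Z - v) d D -> v <= u).

(* Number of faces of cardinality k, i.e. f_(k-1). *)
Definition nfaces D (k : nat) : nat := #|[set s in D | #|s| == k]|.

Definition hpoly (d : nat) D : {poly int} :=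
  \sum_(i < d.+1) (nfaces D i)%:R *: ('X - 1) ^+ (d - i).

(* Meaningful for i <= d. *)
Definition hnum d D (i : nat) : int := (hpoly d D)`_(d - i).

Definition gnum d D (j : nat) : int :=
  if j is j'.+1 then hnum d D j - hnum d D j' else 1.

End Complexes.

(* The integer min(u, floor((d-1)/2)), read as a natural number; it is
   nonnegative whenever [largest_u d D u] holds. *)
Definition utilde (d : nat) (u : int) : nat :=
  `|Num.min u ((d%:Z - 1) %/ 2)%Z|%N.

Section Level.
Variables (R : realType) (n : nat) (N : falgType R).
Variable phi : {lrmorphism {mpoly R[n]} -> N}.

(* N is, through phi, the quotient of R[x_1..x_n] by the homogeneous ideal
   ker phi, with graded pieces Ngr k and last nonzero degree s. It is Artinian
   because an falgType is finite dimensional, and Ngr 0 is the line spanned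
   by 1. *)
Definition graded_quotient (Ngr : nat -> {vspace N}) (s : nat) : Prop :=
  [/\ forall y : N, exists p, phi p = y,
      forall k (y : N), y \in Ngr k <-> exists2 p, p \is k.-homog & phi p = y,
      directv (\sum_(k < s.+1) Ngr k) /\ (\sum_(k < s.+1) Ngr k)%VS = fullv,
      Ngr s != 0%VS &
      forall k, (s < k)%N -> Ngr k = 0%VS].

Definition in_socle (y : N) : Prop := forall i : 'I_n, phi 'X_i * y = 0.

Definition level (Ngr : nat -> {vspace N}) (s : nat) : Prop :=
  forall y : N, in_socle y <-> y \in Ngr s.

End Level.

Definition level_sequence (R : realType) (a : seq int) : Prop :=
  exists (n : nat) (N : falgType R) (phi : {lrmorphism {mpoly R[n]} -> N})
         (Ngr : nat -> {vspace N}) (s : nat),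
    [/\ graded_quotient phi Ngr s, level phi Ngr s &
        a = 1 :: [seq (\dim (Ngr k))%:Z | k <- iota 1 s]].

(* For m, i >= 1: the i-th Macaulay representation of m. The list
   c = [:: n_i; n_(i-1); ...; n_j] has its k-th entry (from 0) equal to
   n_(i-k), so that j = i + 1 - size c. *)
Definition macaulay_rep (i m : nat) (c : seq nat) : Prop :=
  [/\ (0 < size c <= i)%N, sorted gtn c, (i.+1 - size c <= last 0 c)%N &
      m = \sum_(k < size c) 'C(nth 0 c k, i - k)]%N.

(* p = m^<i> *)
Definition pseudo_power (i m p : nat) : Prop :=
  (m = 0 /\ p = 0)%N \/
  (exists2 c, macaulay_rep i m c &
     p = \sum_(k < size c) 'C((nth 0 c k).+1, (i - k).+1))%N.

Definition M_sequence (a : seq int) : Prop :=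
  [/\ (0 < size a)%N, all (fun x => 0 <= x) a, a`_0 = 1 &
      forall i, (1 <= i)%N -> (i.+1 < size a)%N ->
        exists2 p, pseudo_power i `|(a`_i)%R|%N p & a`_i.+1 <= p%:Z].

(* Submission.v *)
(** Over K = Frac F_2[a, p], the Stanley-Reisner ring of the sphere modulo d
    linear forms with indeterminate coefficients a is a Poincare duality
    algebra; Lee's formula writes its degree map as a sum over the facets of
    rational functions of a and of the prescribed values p of the forms.
    Differentiating this formula in characteristic 2 turns degrees of squares
    into derivatives of degrees of monomials, which makes the ring anisotropic
    in degrees below d/2. Hence multiplication by one more
    generic form is injective there, and the quotient by it has Hilbert
    function g. If missing faces have at most d + 1 - u vertices, the same
    differential identities show that no nonzero class of degree less than u of
    the quotient is killed by all the variables.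
    Ranks of matrices over Z[a] only drop under specialization, and a
    polynomial that is nonzero over K has a nonzero real value; since the
    Hilbert function of the quotient cannot go below the generic one, real
    forms realize g over the reals by a level ring.
    The product inequality embeds degree i into maps from degree j to degree
    i + j, and both M-sequence conditions come from Macaulay's bound, proved for
    submodules of free modules and their duals by compression of order ideals. *)
Require Import Defs.
From HB Require Import structures.
From mathcomp Require Import all_boot all_order all_algebra all_field.
From mathcomp Require Import reals.
From mathcomp Require Import mpoly.
From mathcomp Require Import zify ring lra.
Set Implicit Arguments.
Unset Strict Implicit.
Unset Printing Implicit Defensive.
Import Order.TTheory GRing.Theory Num.Theory.
Local Open Scope ring_scope.

(** * Linear algebra preliminaries *)

(** The forms theta_0, ..., theta_(d-1) are given indeterminate values p_k instead of 0 because on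
    each facet they then have exactly one common point. The degree map becomes a finite weighted sum
    of evaluations at these points, the pairing of two polynomials is diagonal in the basis of
    facets, and duality is an orthogonality count for a filtration of the functions on the facets.
    The p_k also supply a second family of derivatives: up to a square factor, on each facet term,
    deriving along a_(k,v) amounts to multiplying by x_v and deriving along p_k. Characteristic 2 is
    used three times over: squares are constants of every derivation, sums of squares are squares,
    and permanents are determinants. The last form theta_d does not enter the degree map, so
    deriving along one of its coefficients isolates one variable. *)

Lemma scale_ffunE (L : pzRingType) (I : finType) (E : lmodType L) t (h : {ffun I -> E}) i :
  (t *: h) i = t *: h i.
Proof. by rewrite ffunE. Qed.

Section CoordinateSpaces.
Variables (T : finType) (L : fieldType).
Implicit Types (t : T) (X : seq T) (c : {ffun T -> L^o}).

Definition delta t : {ffun T -> L^o} := [ffun t' => (t' == t)%:R].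

Lemma sum_delta c : c = \sum_t c t *: delta t.
Proof.
apply/ffunP => t; rewrite sum_ffunE (bigD1 t) //= !ffunE eqxx.
rewrite big1 => [|s /negPf hs]; first by rewrite addr0 /GRing.scale /= mulr1.
by rewrite !ffunE eq_sym hs scaler0.
Qed.

Lemma span_deltaP X c :
  reflect (forall t, c t != 0 -> t \in X) (c \in <<map delta X>>%VS).
Proof.
apply: (iffP idP) => [|hc].
  move=> /(@coord_span _ _ _ (in_tuple _)) -> s; apply: contraR => hs.
  rewrite sum_ffunE big1 // => i _; rewrite !ffunE.
  have : (map delta X)`_i \in map delta X by apply: mem_nth.
  move=> /mapP[t tX ->]; rewrite ffunE; case: eqP => [st|]; last by rewrite scaler0.
  by rewrite st tX in hs.
rewrite [c]sum_delta; apply: memv_suml => s _; have [-> | nz] := eqVneq (c s) 0.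
  by rewrite scale0r mem0v.
by apply/memvZ/memv_span/map_f/hc.
Qed.

Lemma dim_span_delta X : uniq X -> \dim <<map delta X>> = size X.
Proof.
move=> uX; rewrite -(size_map delta); apply/eqP; rewrite -/(free _).
suff: free (map_tuple delta (in_tuple X)) by [].
apply/freeP => u hu i.
have := congr1 (fun c : {ffun T -> L^o} => c (tnth (in_tuple X) i)) hu.
have nthE (j : 'I_(size X)) : (map_tuple delta (in_tuple X))`_j = delta (tnth (in_tuple X) j).
  by rewrite -tnth_nth tnth_map.
rewrite /= sum_ffunE ffunE (bigD1 i) //= nthE big1 ?addr0.
  by rewrite !ffunE eqxx /GRing.scale /= mulr1.
move=> j ji; rewrite nthE !ffunE; suff /negPf-> : tnth (in_tuple X) i != tnth (in_tuple X) j.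
  by rewrite scaler0.
have x0 := tnth (in_tuple X) i.
rewrite !(tnth_nth x0) /= nth_uniq // eq_sym; exact: ji.
Qed.

End CoordinateSpaces.

Section Dimension.
Variables (L : fieldType) (U W : vectType L).

(** Rank-nullity for the map X -> W/Z induced by [f], stated without the quotient. The Hilbert
    function steps below, which adjoin one form to an ideal, are instances of it. *)
Lemma dim_add_img (f : 'Hom(U, W)) (X : {vspace U}) (Z : {vspace W}) :
  (\dim (Z + f @: X) + \dim (X :&: f @^-1: Z) = \dim Z + \dim X)%N.
Proof.
have E : (f @: (X :&: f @^-1: Z) = Z :&: f @: X)%VS.
  apply/vspaceP => w; apply/memv_imgP/memv_capP.
    move=> [x /memv_capP[xX]]; rewrite -memv_preim => fx ->.
    by split=> //; apply: memv_img.
  move=> [wZ /memv_imgP[x xX wE]]; exists x => //.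
  by rewrite memv_cap xX -memv_preim -wE.
have h1 := limg_ker_dim f X.
have h2 := limg_ker_dim f (X :&: f @^-1: Z).
have h3 := dimv_sum_cap Z (f @: X).
have E2 : ((X :&: f @^-1: Z) :&: lker f = X :&: lker f)%VS.
  rewrite -capvA; congr (_ :&: _)%VS; apply/capv_idPr/subvP => x.
  by rewrite memv_ker -memv_preim => /eqP->; rewrite mem0v.
by rewrite E2 E in h2; lia.
Qed.

End Dimension.

(** * Regular sequences *)

Section RegularSequences.
Variables (P : comNzRingType) (theta : nat -> P).

Definition submodule (X : lmodType P) (B : X -> Prop) :=
  B 0 /\ forall p x y, B x -> B y -> B (p *: x + y).

(** Weak regularity of theta_0, ..., theta_(k-1) on the quotient A/B, without forming it: theta_j is
    injective modulo B and the earlier forms. The coefficients must lie in [A] too, since the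
    multiples of the forms are taken inside A. *)
Definition regular (X : lmodType P) (A B : X -> Prop) (k : nat) :=
  forall j, (j < k)%N -> forall y (z : nat -> X), A y -> (forall i, A (z i)) ->
    B (theta j *: y - \sum_(i < j) theta i *: z i) ->
  exists2 u : nat -> X, (forall i, A (u i)) &
    B (y - \sum_(i < j) theta i *: u i).

Lemma submoduleD (X : lmodType P) (B : X -> Prop) x y :
  submodule B -> B x -> B y -> B (x + y).
Proof. by move=> [_ hB] hx hy; have := hB 1 _ _ hx hy; rewrite scale1r. Qed.

Lemma submoduleZ (X : lmodType P) (B : X -> Prop) p x :
  submodule B -> B x -> B (p *: x).
Proof. by move=> [h0 hB] hx; have := hB p _ _ hx h0; rewrite addr0. Qed.

Lemma submoduleB (X : lmodType P) (B : X -> Prop) x y :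
  submodule B -> B x -> B y -> B (x - y).
Proof.
move=> hB hx hy; apply: (submoduleD hB hx).
by rewrite -scaleN1r; apply: submoduleZ.
Qed.

Lemma submodule_sum (X : lmodType P) (B : X -> Prop) (I : Type) (r : seq I)
    (Q : pred I) (F : I -> X) :
  submodule B -> (forall i, Q i -> B (F i)) -> B (\sum_(i <- r | Q i) F i).
Proof.
move=> hB hF; apply: (big_ind B) => //; first by case: hB.
by move=> x y; apply: submoduleD.
Qed.

Lemma alternating_sum0 (X : lmodType P) (w : nat -> nat -> X) k :
  (forall i, w i i = 0) -> (forall i j, w i j = - w j i) ->
  \sum_(i < k) theta i *: (\sum_(l < k) theta l *: w l i) = 0.
Proof.
move=> wii wij; elim: k => [|k IH]; first by rewrite big_ord0.
rewrite big_ord_recr /= big_ord_recr /= wii scaler0 addr0.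
under eq_bigr do rewrite big_ord_recr /= scalerDr.
rewrite big_split /= IH add0r scaler_sumr -big_split big1 //= => i _.
by rewrite (wij k i) !scalerN !scalerA mulrC addNr.
Qed.

(** Vanishing of the first Koszul homology. Regularity rewrites the last coefficient [z k] through
    the earlier forms with coefficients [u]; then z_i + theta_k u_i is a syzygy of one form fewer,
    and its matrix [w] is bordered by u and -u. *)
Lemma koszul_syzygy (X : lmodType P) (B : X -> Prop) k :
  submodule B -> regular (fun=> True) B k ->
  forall z : nat -> X, B (\sum_(i < k) theta i *: z i) ->
  exists w : nat -> nat -> X,
    [/\ forall i, w i i = 0, forall i j, w i j = - w j i &
        forall j, (j < k)%N -> B (z j - \sum_(i < k) theta i *: w i j)].
Proof.
move=> hB; elim: k => [|k IH] hreg z hz.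
  by exists (fun _ _ => 0); split => // *; rewrite oppr0.
have [||u _ hu] := hreg k (ltnSn k) (z k) (fun i => - z i) I => //.
  move: hz; rewrite big_ord_recr /= addrC => hz.
  by under eq_bigr do rewrite scalerN; rewrite sumrN opprK.
have hreg' : regular (fun=> True) B k by move=> j hj; apply/hreg/ltnW.
have [|w [wii wij hw]] := IH hreg' (fun i => z i + theta k *: u i).
  have -> : \sum_(i < k) theta i *: (z i + theta k *: u i) =
      \sum_(i < k.+1) theta i *: z i -
      theta k *: (z k - \sum_(i < k) theta i *: u i).
    rewrite big_ord_recr /= scalerBr opprB addrA addrAC addrK addrC scaler_sumr.
    rewrite addrC -big_split /=; apply: eq_bigr => i _.
    by rewrite scalerDr !scalerA mulrC.
  by apply: submoduleB => //; apply: submoduleZ.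
exists (fun i j => if (i < k)%N then if (j < k)%N then w i j else
                     if j == k then u i else 0
                   else if (i == k) && (j < k)%N then - u j else 0).
split.
- by move=> i; case: ltnP => // _; rewrite andbF.
- move=> i j; case: (ltnP i k) => hi; case: (ltnP j k) => hj //=.
  + by rewrite andbT; case: eqP; rewrite ?opprK ?oppr0.
  + by rewrite andbT; case: eqP; rewrite ?oppr0.
  + by rewrite !andbF oppr0.
move=> j; rewrite ltnS leq_eqVlt big_ord_recr /= ltnn eqxx /=.
case/orP => [/eqP -> | hj].
  rewrite ltnn scaler0 addr0 eqxx.
  by under eq_bigr do rewrite ltn_ord.
rewrite hj; under eq_bigr do rewrite ltn_ord.
rewrite scalerN opprD opprK addrA addrAC.
by apply: (hw _ hj).
Qed.

(* For [U <= U' <= X], the depth lemma for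
   [0 -> U'/U -> X/U -> X/U' -> 0]. *)
Lemma regular_sub (X : lmodType P) (U U' : X -> Prop) k :
  submodule U -> submodule U' -> (forall x, U x -> U' x) ->
  regular (fun=> True) U k -> regular (fun=> True) U' k.-1 ->
  regular U' U k.
Proof.
move=> hU hU' sUU' reg1 reg2 j hj y z hy hz hyz.
have [u _ hu] := reg1 j hj y z I (fun=> I) hyz.
(* Since y lies in U', the coefficients u are a syzygy modulo U'. Subtracting their Koszul part
   brings them into U' without changing the sum. *)
have [||w [wii wij hw]] := @koszul_syzygy X U' j hU' _ u.
- by move=> l hl; apply: reg2; lia.
- rewrite -[X in U' X](subKr y); apply: submoduleB => //; exact: sUU'.
exists (fun i => if (i < j)%N then u i - \sum_(l < j) theta l *: w l i else 0).
  move=> i; case: ifP => // hi; first exact: hw.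
  by case: hU'.
under eq_bigr do rewrite ltn_ord scalerBr.
by rewrite big_split /= sumrN alternating_sum0 // subr0.
Qed.

(** The conditions on [f] make it an isomorphism from X/C onto A/B. *)
Lemma regular_transfer (X Y : lmodType P) (f : {linear X -> Y})
    (A B : Y -> Prop) (C : X -> Prop) k :
  submodule B ->
  (forall x, A (f x)) -> (forall y, A y -> exists x, B (y - f x)) ->
  (forall x, C x <-> B (f x)) ->
  regular A B k -> regular (fun=> True) C k.
Proof.
move=> hB hA hsurj hC hreg j hj y z _ _ /hC.
rewrite linearB linearZ /= linear_sum /=.
under eq_bigr do rewrite linearZ /=.
move=> /(hreg j hj (f y) (fun i => f (z i)) (hA _) (fun i => hA _)) [u hu hyu].
have hx (i : 'I_j) : exists x, B (u i - f x) by exact: hsurj.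
have [x hx'] := fin_all_exists hx.
exists (fun i => if insub i is Some i' then x i' else 0) => //.
apply/hC; rewrite linearB linear_sum /=.
have -> : f y - \sum_(i < j) f (theta i *: (if insub (i : nat) is Some i' then x i' else 0)) =
   (f y - \sum_(i < j) theta i *: u i) + \sum_(i < j) theta i *: (u i - f (x i)).
  rewrite -addrA; congr (_ + _).
  rewrite -sumrN -[X in X + _]sumrN -big_split /=; apply: eq_bigr => i _.
  by rewrite insubT // => hi; rewrite linearZ /= scalerBr addrA addNr add0r; congr (- (_ *: f (x _))); apply: val_inj.
apply: submoduleD => //; apply: submodule_sum => // i _.
exact: submoduleZ.
Qed.

End RegularSequences.

(** * Stanley-Reisner rings of spheres *)

Lemma mpoly_gen_ind n (R : comNzRingType) (Q : {mpoly R[n]} -> Prop) :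
  (forall c, Q c%:MP) -> (forall i, Q 'X_i) ->
  (forall p q, Q p -> Q q -> Q (p + q)) ->
  (forall p q, Q p -> Q q -> Q (p * q)) -> forall p, Q p.
Proof.
move=> QC QX QD QM p; rewrite (mpolyE p).
apply: (big_ind Q) => [|x y|]; [by rewrite -mpolyC0|exact: QD|].
move=> m _; rewrite -mul_mpolyC; apply: (QM) => //; rewrite mpolyXE_id.
apply: (big_ind Q) => [|x y|]; [by rewrite -mpolyC1|exact: QM|].
move=> i _; have: forall e, Q ('X_i ^+ e); last exact.
by elim=> [|e IH]; rewrite ?expr0 -?mpolyC1 // exprS; apply: QM.
Qed.

Section StanleyReisner.
Variables (V : finType) (L : fieldType).
Local Notation poly := {mpoly L[#|V|]}.
Implicit Types (S : {set {set V}}) (F : {set V}) (p q : poly).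

Definition mvar (v : V) : 'X_{1..#|V|} := U_(enum_rank v)%MM.

Definition msup (m : 'X_{1..#|V|}) : {set V} := [set v | m (enum_rank v) != 0%N].

Definition lform (c : V -> L) : poly := \sum_v c v *: 'X_[mvar v].

(* Polynomials without monomials supported on a member of S; for a complex S
   this is its Stanley-Reisner ideal. *)
Definition sr_ideal S p := forall m, msup m \in S -> p@_m = 0.

Definition down_closed S := forall s t : {set V}, s \in S -> t \subset s -> t \in S.

Lemma msupD m1 m2 : msup (m1 + m2)%MM = msup m1 :|: msup m2.
Proof. by apply/setP=> v; rewrite !inE mnmDE addn_eq0 negb_and. Qed.

Lemma msup_mvar v : msup (mvar v) = [set v].
Proof.
apply/setP=> w; rewrite !inE /mvar mnm1E eqb0 negbK eq_sym.
by rewrite (inj_eq enum_rank_inj).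
Qed.

Lemma msup0 : msup 0%MM = set0.
Proof. by apply/setP=> w; rewrite !inE mnm0E. Qed.

Lemma mvar_le v m : (mvar v <= m)%MM = (v \in msup m).
Proof. by rewrite lep1mP inE. Qed.

Lemma sr_ideal_submodule S :
  down_closed S -> submodule (sr_ideal S : {mpoly L[#|V|]}^o -> Prop).
Proof.
move=> dS; split=> [m _|p x y hx hy m hm]; first by rewrite mcoeff0.
rewrite mcoeffD hy // addr0 mcoeffM big1 // => -[m1 m2] /= /eqP mE.
rewrite (hx m2) ?mulr0 //; apply: dS hm _.
have -> : msup m = msup (m1 + m2)%MM by rewrite -mE.
by rewrite msupD subsetUr.
Qed.

Lemma down_closed_powerset F : down_closed (powerset F).
Proof. by move=> s t; rewrite !powersetE => /[swap]; apply: subset_trans. Qed.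

Lemma sr_ideal_mvar S v : down_closed S -> [set v] \notin S ->
  sr_ideal S ('X_[mvar v] : poly).
Proof.
move=> dS hv m hm; rewrite mcoeffX; case: eqP => // mE.
by rewrite -mE msup_mvar (negPf hv) in hm.
Qed.

End StanleyReisner.

Section FaceRing.
Variables (V : finType) (L : fieldType) (a : nat -> V -> L) (F : {set V}).
Local Notation poly := {mpoly L[#|V|]}.
Local Notation k := #|F|.

(* The first |F| linear forms restrict to a basis of the linear forms on F. *)
Definition independent_on (b : V -> nat -> L) :=
  (forall v w, v \in F -> w \in F ->
     \sum_(j < k) b v j * a j w = (v == w)%:R) /\
  (forall l i, (l < k)%N -> (i < k)%N ->
     \sum_(v in F) a l v * b v i = (l == i)%:R).

Variable b : V -> nat -> L.
Hypothesis hb : independent_on b.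
Let theta j : poly := lform (a j).
(** Change of coordinates on the polynomial ring of F: ['X_l] stands for theta_l. [tau j] also kills
    the variables outside F and the first j forms; [sigma] substitutes the forms back. *)
Let tau j : poly -> {mpoly L[k]} :=
  mmap (@mpolyC k L) (fun i => if enum_val i \in F then
    \sum_(l < k | (j <= l)%N) b (enum_val i) l *: 'X_l else 0).
Let sigma : {mpoly L[k]} -> poly :=
  mmap (@mpolyC #|V| L) (fun l : 'I_k => theta l).

Let in_ideal j (y : poly) :=
  exists u : nat -> poly, sr_ideal (powerset F) (y - \sum_(i < j) theta i * u i).

Let in_idealD j x y : in_ideal j x -> in_ideal j y -> in_ideal j (x + y).
Proof.
move=> [u hu] [w hw]; exists (fun i => u i + w i) => m hm.
under eq_bigr do rewrite mulrDr.
by rewrite big_split opprD addrACA mcoeffD hu // hw // addr0.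
Qed.

Let in_idealM j p y : in_ideal j y -> in_ideal j (p * y).
Proof.
move=> [u hu]; exists (fun i => p * u i) => m hm.
have := submoduleZ p (sr_ideal_submodule L (@down_closed_powerset V F)) hu.
move=> /(_ m hm); rewrite /GRing.scale /= mulrBr mulr_sumr.
by under eq_bigr do rewrite mulrCA.
Qed.

Let tau_theta j l : (l < k)%N ->
  tau j (theta l) = if insub l is Some l' then if (j <= l)%N then 'X_l' else 0 else 0.
Proof.
move=> hl; rewrite insubT /theta /lform.
rewrite /tau raddf_sum /=.
under eq_bigr do rewrite mmapZ mmapX mmap1U enum_rankK mul_mpolyC.
rewrite (bigID (mem F)) /= [X in _ + X]big1 ?addr0; last first.
  by move=> v /negPf ->; rewrite scaler0.
under eq_bigr => v hv do rewrite hv scaler_sumr.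
rewrite exchange_big /=.
under eq_bigr => i _ do [under eq_bigr do rewrite scalerA; rewrite -scaler_suml hb.2 //].
case: leqP => hjl; last first.
  rewrite big1 // => i hi; have /negPf -> : l != i; last by rewrite scale0r.
  by apply: contraTneq hi => <-; rewrite -ltnNge.
rewrite (bigD1 (Ordinal hl)) //= eqxx scale1r big1 ?addr0 // => i /andP[_].
by rewrite -val_eqE /= eq_sym => /negPf ->; rewrite scale0r.
Qed.

Let sigma_tau j y : (j <= k)%N -> in_ideal j (y - sigma (tau j y)).
Proof.
move=> hj; elim/mpoly_gen_ind: y => [c|i|p q hp hq|p q hp hq].
- by exists (fun=> 0); rewrite /tau /sigma !mmapC subrr => m _;
    rewrite big1 ?subr0 ?mcoeff0 // => *; rewrite mulr0.
- rewrite /tau mmapX mmap1U; case: ifP => hi; last first.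
    rewrite /sigma raddf0 subr0; exists (fun=> 0).
    rewrite big1 ?subr0 => [|l _]; last by rewrite mulr0.
    rewrite -[i]enum_valK; apply: sr_ideal_mvar; first exact: down_closed_powerset.
    by rewrite powersetE sub1set hi.
  rewrite /sigma [X in _ - X]raddf_sum /=.
  under eq_bigr do rewrite mmapZ mmapX mmap1U.
  exists (fun l => (b (enum_val i) l)%:MP).
  have -> : \sum_(l < j) theta l * (b (enum_val i) l)%:MP =
     \sum_(l < k | ~~ (j <= l)%N) (b (enum_val i) l)%:MP_[#|V|] * theta l.
    rewrite (big_ord_widen _ (fun l => theta l * (b (enum_val i) l)%:MP) hj).
    by apply: eq_big => [l|l _]; rewrite ?ltnNge // mulrC.
  rewrite -addrA -opprD.
  rewrite -(bigID (fun l : 'I_k => (j <= l)%N) predT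
     (fun l : 'I_k => (b (enum_val i) l)%:MP_[#|V|] * theta l)) /=.
  under eq_bigr do rewrite mul_mpolyC /theta /lform scaler_sumr.
  rewrite exchange_big /=.
  rewrite (bigID (mem F)) /= opprD addrA.
  under eq_bigr => v hv.
    under eq_bigr do rewrite scalerA.
    rewrite -scaler_suml hb.1 //; over.
  rewrite (bigD1 (enum_val i)) //= eqxx scale1r.
  rewrite big1 ?addr0 => [|v /andP[_]]; last first.
    by rewrite eq_sym => /negPf ->; rewrite scale0r.
  rewrite /mvar enum_valK subrr sub0r => m hm.
  rewrite mcoeffN raddf_sum /= big1 ?oppr0 // => v hv.
  rewrite raddf_sum big1 //= => l _.
  rewrite !mcoeffZ [X in _ * (_ * X)](_ : _ = 0) ?mulr0 //.
  apply: (@sr_ideal_mvar V L (powerset F) v _ _ m hm) => //; first exact: down_closed_powerset.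
  by rewrite powersetE sub1set.
- have -> : p + q - sigma (tau j (p + q)) =
      (p - sigma (tau j p)) + (q - sigma (tau j q)).
    by rewrite addrACA -opprD /sigma /tau; congr (_ - _); rewrite !mmapD.
  exact: (in_idealD hp hq).
- have -> : sigma (tau j (p * q)) = sigma (tau j p) * sigma (tau j q).
    by rewrite /tau /sigma !rmorphM.
  move: (sigma _) hp (sigma _) hq => s1 hp s2 hq.
  have -> : p * q - s1 * s2 = q * (p - s1) + s1 * (q - s2).
    by rewrite !mulrBr [q * p]mulrC [q * s1]mulrC addrA subrK.
  exact: (in_idealD (in_idealM q hp) (in_idealM s1 hq)).
Qed.

(** On the face F the forms are coordinates. [tau j] turns a relation theta_j y = 0 modulo the
    earlier forms into a product of a variable and [tau j y] that vanishes in a domain, and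
    [sigma_tau] translates tau j y = 0 back. *)
Lemma regular_face :
  regular (X := {mpoly L[#|V|]}^o) theta (fun=> True) (sr_ideal (powerset F)) k.
Proof.
have tau_sr j p : sr_ideal (powerset F) p -> tau j p = 0.
  move=> hp; rewrite /tau /mmap big_seq big1 // => m hm.
  rewrite /mmap1; have : msup m \notin powerset F.
    by apply: contraL hm => /hp hm; rewrite -mcoeff_eq0 hm.
  rewrite powersetE => /subsetPn[v]; rewrite inE => hv hvF.
  by rewrite (bigD1 (enum_rank v)) //= enum_rankK (negPf hvF) expr0n (negPf hv) mul0r mulr0.
move=> j hj y z _ _ /(tau_sr j).
have tauB : {morph tau j : x y / x - y} by exact: raddfB.
have tauM : {morph tau j : x y / x * y} by exact: rmorphM.
have tau_sum (I : finType) (G : I -> poly) : tau j (\sum_i G i) = \sum_i tau j (G i).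
  by rewrite /tau raddf_sum.
rewrite tauB {1}/GRing.scale /= tauM tau_theta // tau_sum big1 => [|i _]; last first.
  rewrite /GRing.scale /= tauM tau_theta; last by apply: ltn_trans hj.
  by rewrite leqNgt ltn_ord /=; case: insub => *; rewrite mul0r.
rewrite leqnn subr0 insubT => /eqP.
rewrite mulf_eq0 => /orP[|/eqP ty0].
  by rewrite -msize_poly_eq0 msizeX.
have [u hu] := sigma_tau y (ltnW hj).
exists u => //; move: hu; rewrite ty0 /sigma mmap0 subr0.
exact.
Qed.

End FaceRing.

Lemma sum_enum_rank (R : nmodType) (T : finType) (G : 'I_#|T| -> R) :
  \sum_j G j = \sum_t G (enum_rank t).
Proof. by rewrite (reindex enum_rank) //; apply/onW_bij/enum_rank_bij. Qed.

(** Kernels of matrices commute with field extension, so exactness in the middle of a complex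
    survives. The homology of the sphere is known over F_2, while the forms live over a function
    field. *)
Lemma exact_field_extension (F K : fieldType) (f : {rmorphism F -> K})
    (T U W : finType) (a : W -> T -> F) (b : T -> U -> F) :
  (forall c : T -> F, (forall w, \sum_t a w t * c t = 0) ->
     exists c' : U -> F, forall t, c t = \sum_u b t u * c' u) ->
  forall c : T -> K, (forall w, \sum_t f (a w t) * c t = 0) ->
     exists c' : U -> K, forall t, c t = \sum_u f (b t u) * c' u.
Proof.
move=> exF c hc.
pose A : 'M[F]_(#|T|, #|W|) := \matrix_(i, j) a (enum_val j) (enum_val i).
pose B : 'M[F]_(#|U|, #|T|) := \matrix_(i, j) b (enum_val j) (enum_val i).
have sAB : (kermx A <= B)%MS.
  apply/row_subP => i; set r := row i _.
  have rA : r *m A = 0 by rewrite -row_mul mulmx_ker row0.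
  have [|c' hc'] := exF (fun t => r 0 (enum_rank t)).
    move=> w; have := congr1 (fun M : 'rV_ _ => M 0 (enum_rank w)) rA.
    rewrite !mxE sum_enum_rank => E; rewrite -[RHS]E.
    by apply: eq_bigr => t _; rewrite [A _ _]mxE !enum_rankK mulrC.
  apply/submxP; exists (\row_j c' (enum_val j)); apply/rowP => t.
  have := hc' (enum_val t); rewrite enum_valK => ->; rewrite [RHS]mxE.
  rewrite [RHS]sum_enum_rank.
  by apply: eq_bigr => u _; rewrite !mxE enum_rankK mulrC.
have : ((\row_t c (enum_val t)) <= map_mx f (kermx A))%MS.
  rewrite map_kermx; apply/sub_kermxP; apply/rowP => w.
  rewrite !mxE -[RHS](hc (enum_val w)) [LHS]sum_enum_rank.
  by apply: eq_bigr => t _; rewrite !mxE enum_rankK mulrC.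
move=> /submx_trans /(_ (_ : (_ <= map_mx f B)%MS)).
rewrite map_submx => /(_ sAB) /submxP[D hD].
exists (fun u => D 0 (enum_rank u)) => t.
have := congr1 (fun M : 'rV_ _ => M 0 (enum_rank t)) hD.
rewrite !mxE enum_rankK => ->; rewrite [LHS]sum_enum_rank.
by apply: eq_bigr => u _; rewrite !mxE !enum_rankK mulrC.
Qed.

(** * Simplicial chains and reduced homology over F_2 *)

Section Boundary.
Variable V : finType.
Implicit Types (r s t F G : {set V}).

Lemma card_between t r : t \subset r -> #|r| = #|t|.+2 ->
  #|[set s : {set V} | [&& t \subset s, s \subset r & #|s| == #|t|.+1]]| = 2.
Proof.
move=> tr cr.
have -> : [set s : {set V} | [&& t \subset s, s \subset r & #|s| == #|t|.+1]] =
    [set x |: t | x in r :\: t].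
  apply/setP => s; rewrite !inE; apply/and3P/imsetP.
    move=> [ts sr /eqP cs].
    have : #|s :\: t| = 1%N by rewrite cardsD (setIidPr ts) cs subSnn.
    move=> /eqP/cards1P[x hx]; exists x.
      have : x \in s :\: t by rewrite hx set11.
      by rewrite !inE => /andP[-> /(subsetP sr)].
    by rewrite -hx setUC -[LHS](setID s t) (setIidPr ts).
  move=> [x]; rewrite !inE => /andP[xt xr] ->.
  by rewrite subsetUr subUset sub1set xr tr cardsU1 xt add1n eqxx.
rewrite card_in_imset ?cardsD ?(setIidPr tr) ?cr; first by lia.
move=> x y; rewrite !inE => /andP[xt xr] /andP[yt yr] E.
have : x \in y |: t by rewrite -E setU11.
by rewrite in_setU1 (negPf xt) orbF => /eqP.
Qed.

Lemma double_boundary (M : zmodType) (h : {set V} -> M) t :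
  (forall x : M, x + x = 0) ->
  \sum_(s : {set V} | (t \subset s) && (#|s| == #|t|.+1))
    \sum_(r : {set V} | (s \subset r) && (#|r| == #|s|.+1)) h r = 0.
Proof.
move=> M2; rewrite (exchange_big_dep (fun r => (t \subset r) && (#|r| == #|t|.+2))) /=.
  rewrite big1 // => r /andP[tr /eqP cr].
  rewrite sumr_const -(@eq_card _ (mem [set s : {set V} |
     [&& t \subset s, s \subset r & #|s| == #|t|.+1]])).
    by rewrite card_between // mulr2n.
  move=> s; rewrite !inE; apply/and3P/idP => [[ts sr /eqP cs]|].
    by rewrite unfold_in ts cs eqxx sr cr eqxx.
  by rewrite unfold_in => /andP[/andP[-> ->] /andP[-> _]].
move=> s r /andP[ts /eqP cs] /andP[sr /eqP cr].
by rewrite (subset_trans ts sr) cr cs eqxx.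
Qed.

Implicit Type D : {set {set V}}.

Lemma chainsP D k (c : {ffun {set V} -> ('F_2)^o}) :
  reflect (forall s, c s != 0 -> (s \in D) && (#|s| == k)) (c \in chains D k).
Proof.
apply: (iffP (span_deltaP [seq s : {set V} <- enum D | #|s| == k] c)) => h s /h;
  by rewrite mem_filter mem_enum andbC.
Qed.

Lemma dim_chains D k : \dim (chains D k) = #|[set s in D | #|s| == k]|.
Proof.
have uX : uniq [seq s : {set V} <- enum D | #|s| == k] by rewrite filter_uniq ?enum_uniq.
rewrite [LHS](dim_span_delta _ uX) cardE.
by apply/perm_size/uniq_perm; rewrite ?enum_uniq // => s;
  rewrite mem_enum mem_filter inE mem_enum andbC.
Qed.

Lemma bdryE c (t : {set V}) :
  bdry V c t = \sum_(s : {set V} | (t \subset s) && (#|s| == #|t|.+1)) c s.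
Proof. by rewrite /bdry lfunE ffunE. Qed.

Lemma bdry_bdry (c : {ffun {set V} -> ('F_2)^o}) : bdry V (bdry V c) = 0.
Proof.
apply/ffunP => t; rewrite bdryE ffunE; under eq_bigr do rewrite bdryE.
apply: double_boundary => x; case: x => -[|[|//]] i; exact: val_inj.
Qed.

Lemma boundary_in_cycles D k :
  down_closed D -> (boundaries D k <= cycles D k)%VS.
Proof.
move=> dD; apply/subvP => _ /memv_imgP[c /chainsP hc ->].
rewrite memv_cap memv_ker bdry_bdry eqxx andbT; apply/chainsP => s.
rewrite bdryE => hs.
have /existsP[r /andP[/andP[sr cr]] nz] :
    [exists r : {set V}, ((s \subset r) && (#|r| == #|s|.+1)) && (c r != 0)].
  apply: contraNT hs => /existsPn hs; apply/eqP; apply: big1 => r hr.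
  by have := hs r; rewrite hr /= negbK => /eqP.
have /andP[rD /eqP ck] := hc r nz.
by rewrite (dD _ _ rD sr) /= -eqSS -ck eq_sym.
Qed.

Lemma cycle_is_boundary D k c : down_closed D -> rbetti D k = 0%N ->
  c \in cycles D k -> exists2 c', c' \in chains D k.+1 & c = bdry V c'.
Proof.
move=> dD /eqP hb hc.
have : cycles D k == boundaries D k.
  by rewrite eq_sym eqEdim boundary_in_cycles.
move=> /eqP E; move: hc; rewrite E => /memv_imgP[c' h1 h2].
by exists c'.
Qed.

End Boundary.

(** * Local exactness of a sphere along its links *)

Section SphereFaces.
Variables (V : finType) (D : {set {set V}}) (d : nat).
Hypothesis hD : sphere d D.
Implicit Types (r s t F G : {set V}).

Lemma sphere_down_closed : down_closed D.
Proof. by case: hD => -[]. Qed.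

Lemma sphere_facet s : s \in D -> exists2 F, F \in D & (s \subset F) && (#|F| == d).
Proof.
move=> sD; have [F hF sF] := maxset_exists (P := fun s => s \in D) sD.
have [_ pure _] := hD; exists F; first by case/maxsetP: hF.
by rewrite sF (pure _ hF) eqxx.
Qed.

Lemma sphere_card s : s \in D -> (#|s| <= d)%N.
Proof. by case/sphere_facet=> F _ /andP[/subset_leq_card h /eqP <-]. Qed.

Lemma link_down_closed t : down_closed (link D t).
Proof.
move=> s r; rewrite !inE => /and3P[sD stD /eqP st0] rs.
rewrite (sphere_down_closed sD rs) (sphere_down_closed stD (setSU t rs)) /=.
by rewrite -subset0 -st0 setSI.
Qed.

Section Faces.
Variable M : nmodType.

Definition face_sum k (c : {set V} -> M) G : M :=
  \sum_(F in D | (G \subset F) && (#|F| == k)) c F.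

(** Deleting s is a bijection from the faces containing s onto the link of s; it turns these sums
    into boundaries in the link. *)
Lemma face_sum_link s k (c : {set V} -> M) t : s \in D -> t :&: s = set0 ->
  face_sum k c (t :|: s) =
  \sum_(r in link D s | (t \subset r) && (#|r| + #|s| == k)%N) c (r :|: s).
Proof.
move=> sD ts0; rewrite /face_sum (reindex_onto (fun r => r :|: s) (fun F => F :\: s)).
  apply: eq_bigl => r; rewrite !inE.
  have [rs0|rs0] := boolP (r :&: s == set0); last first.
    rewrite !andbF; apply/negP => /andP[_ /eqP E]; case/negP: rs0.
    by rewrite -E; apply/eqP/setP => x; rewrite !inE; case: (x \in s); rewrite ?andbF.
  rewrite andbT.
  have -> : (r :|: s) :\: s == r.
    by rewrite setDUl setDv setU0; apply/eqP/setDidPl; rewrite -setI_eq0.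
  have [rD|] := boolP (r :|: s \in D); last by rewrite !andbF.
  rewrite (sphere_down_closed rD (subsetUl _ _)) /= andbT.
  have -> : #|r :|: s| = (#|r| + #|s|)%N by rewrite cardsU (eqP rs0) cards0 subn0.
  congr (_ && _); apply/idP/idP => [h|h]; last exact: setSU.
  apply/subsetP => x xt; have := subsetP h x; rewrite inE xt => /(_ isT).
  rewrite inE => /orP[//|xs]; have : x \in t :&: s by rewrite inE xt.
  by rewrite ts0 inE.
by move=> F /and3P[_ /subUsetP[_ sF] _]; rewrite setUC -{1}(setIidPr sF) setID.
Qed.
End Faces.

Lemma link_rbetti s k : s \in D -> rbetti (link D s) k = (k == d - #|s|)%N :> nat.
Proof. by case: hD => _ _ h sD; apply: h. Qed.

Lemma face_setD s k F : s \in D -> (#|s| <= k)%N ->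
  F \in D -> s \subset F -> #|F| = k ->
  [/\ F :\: s \in link D s, #|F :\: s| = (k - #|s|)%N &
      (F :\: s) :|: s = F].
Proof.
move=> sD sk FD sF cF.
have FE : (F :\: s) :|: s = F by rewrite setUC -{1}(setIidPr sF) setID.
split=> //; last by rewrite cardsD (setIidPr sF) cF.
rewrite inE FE FD (sphere_down_closed FD (subsetDl _ _)) /=.
by apply/eqP/setP => x; rewrite !inE; case: (x \in s); rewrite ?andbF.
Qed.

Definition local_chain s k (c : {set V} -> 'F_2) : {ffun {set V} -> ('F_2)^o} :=
  [ffun r : {set V} => if (r \in link D s) && (#|r| + #|s| == k)%N then c (r :|: s) else 0].

Lemma local_cycle s k c : s \in D -> (#|s| <= k)%N ->
  (forall G, G \in D -> s \subset G -> #|G|.+1 = k -> face_sum k c G = 0) ->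
  local_chain s k c \in cycles (link D s) (k - #|s|).
Proof.
move=> sD sk hc; rewrite memv_cap; apply/andP; split.
  apply/chainsP => r; rewrite ffunE; case: ifP => [/andP[-> /eqP <-]|]; last by rewrite eqxx.
  by rewrite addnK eqxx.
rewrite memv_ker; apply/eqP/ffunP => t; rewrite bdryE [RHS]ffunE.
have [/andP[tL /eqP ct]|] := boolP ((t \in link D s) && ((#|t| + #|s|).+1 == k)).
  have := tL; rewrite !inE => /and3P[tD tsD /eqP ts0].
  have := hc (t :|: s) tsD (subsetUr _ _).
  rewrite cardsU ts0 cards0 subn0 face_sum_link // => /(_ ct) E.
  rewrite -[RHS]E [RHS]big_mkcond [LHS]big_mkcond /=; apply: eq_bigr => r _.
  rewrite ffunE -ct -addSn eqn_add2r.
  by case: (r \in _); case: (t \subset r); case: (_ == _).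
move=> ht; apply: big1 => r /andP[tr /eqP cr]; rewrite ffunE; case: ifP => // /andP[rL /eqP ck].
case/negP: ht; rewrite (link_down_closed rL tr) /=.
by rewrite -ck cr addSn.
Qed.

(** Below its top degree the link of s has no homology, so the cycle [local_chain] is a boundary. *)
Lemma exact_faces_F2 s k (c : {set V} -> 'F_2) : s \in D -> (k < d)%N ->
  (forall G, G \in D -> s \subset G -> #|G|.+1 = k -> face_sum k c G = 0) ->
  exists c' : {set V} -> 'F_2, forall F, F \in D -> s \subset F -> #|F| = k ->
    c F = face_sum k.+1 c' F.
Proof.
move=> sD kd hc; have [sk|ks] := leqP #|s| k; last first.
  exists (fun=> 0) => F _ /subset_leq_card sF cF; lia.
have [|||u /chainsP hu E] := @cycle_is_boundary V (link D s) (k - #|s|) (local_chain s k c).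
- exact: link_down_closed.
- by rewrite link_rbetti //; case: eqP => //; lia.
- exact: local_cycle.
exists (fun F => u (F :\: s)) => F FD sF cF.
have [FL cFs FE] := face_setD sD sk FD sF cF.
have := congr1 (fun c : {ffun {set V} -> ('F_2)^o} => c (F :\: s)) E.
rewrite ffunE FL cFs subnK // eqxx FE bdryE /= => ->.
rewrite -[F in RHS]FE face_sum_link //; last first.
  by have := FL; rewrite !inE => /and3P[_ _ /eqP].
rewrite [RHS]big_mkcond [LHS]big_mkcond /=; apply: eq_bigr => r _.
have [/andP[rL /eqP cr]|] := boolP ((r \in link D s) && (#|r| == (k - #|s|).+1)).
  rewrite rL cFs cr eqxx addSn subnK // eqxx !andbT /=.
  case: ifP => // _; congr (u _); have := rL; rewrite inE => /and3P[_ _ /eqP rs0].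
  by rewrite setDUl setDv setU0; apply/esym/setDidPl; rewrite -setI_eq0 rs0.
move=> hr; have -> : u r = 0.
  by apply: contraNeq hr => /hu.
rewrite if_same; case: ifP => // /andP[rL /andP[_ /eqP cr]].
by case/negP: hr; rewrite rL /=; apply/eqP; lia.
Qed.

(** The link of a ridge is a 0-sphere. With degrees counted by cardinality, its 0-cycles are a line
    consisting of boundaries and its 1-cycles are a line, so rank-nullity gives dimension 2 for the
    chains spanned by its vertices. *)
Lemma card_ridge G : G \in D -> #|G|.+1 = d ->
  #|[set F in D | (G \subset F) && (#|F| == d)]| = 2.
Proof.
move=> GD cG; set L := link D G.
have dL := @link_down_closed G.
have d1 : (d - #|G| = 1)%N by lia.
have c0 : \dim (cycles L 0) = 1%N.
  have -> : cycles L 0 = chains L 0.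
    apply/eqP; rewrite eqEsubv capvSl /=; apply/subvP => c /chainsP hc.
    rewrite memv_cap memv_ker; apply/andP; split; first exact/chainsP.
    apply/eqP/ffunP => t; rewrite bdryE [RHS]ffunE; apply: big1 => r /andP[_ /eqP cr].
    by apply/eqP; apply: contraTT isT => /hc /andP[_]; rewrite cr.
  rewrite dim_chains; apply/eqP/cards1P; exists set0; apply/setP => r.
  rewrite !inE cards_eq0; case: (r =P set0) => [->|_]; last by rewrite andbF.
  rewrite set0U set0I GD eqxx !andbT.
  exact: (sphere_down_closed GD (sub0set _)).
have b0 : (0 < \dim (boundaries L 0))%N.
  by have := link_rbetti 0 GD; rewrite /rbetti c0 d1 /= => /eqP; rewrite subn_eq0.
have b0' : \dim (boundaries L 0) = 1%N.
  have := dimvS (boundary_in_cycles 0 dL); rewrite -/L c0 => h.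
  by apply/eqP; rewrite eqn_leq b0 h.
have c2 : boundaries L 1 = 0%VS.
  suff E : chains L 2 = 0%VS by rewrite /boundaries E limg0.
  apply/eqP; rewrite -dimv_eq0 dim_chains cards_eq0 -subset0; apply/subsetP => r.
  rewrite !inE => /andP[/and3P[_ rG /eqP rG0] /eqP cr].
  by have := sphere_card rG; rewrite cardsU rG0 cards0 cr; lia.
have := link_rbetti 1 GD; rewrite /rbetti c2 dimv0 subn0 d1 eqxx /= => c1.
have := limg_ker_dim (bdry V) (chains L 1).
rewrite -/(cycles L 1) -/(boundaries L 0) c1 b0' dim_chains => E.
rewrite -[RHS]/(1 + 1)%N [RHS]E.
rewrite -(@card_in_imset _ _ (fun F => F :\: G)).
  apply: eq_card => r; rewrite !inE; apply/imsetP/idP => [[F]|].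
    rewrite inE => /and3P[FD GF /eqP cF] ->.
    have [|FL cFs _] := @face_setD G d F GD _ FD GF cF; first by lia.
    by move: FL; rewrite inE cFs d1 => ->.
  move=> /andP[/and3P[rD rGD /eqP rG0] /eqP cr].
  exists (r :|: G).
    by rewrite inE rGD subsetUr cardsU rG0 cards0 cr -cG subn0 add1n eqxx.
  by rewrite setDUl setDv setU0; apply/esym/setDidPl; rewrite -setI_eq0 rG0.
move=> F1 F2; rewrite !inE => /and3P[_ G1 _] /and3P[_ G2 _] EF.
by rewrite -(setID F1 G) -(setID F2 G) EF (setIidPr G1) (setIidPr G2).
Qed.

(** The top homology of the link of s is a line, and it contains the sum of all facets, which is a
    cycle because every ridge lies in two of them. *)
Lemma exact_facets_F2 s (c : {set V} -> 'F_2) : s \in D ->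
  (forall G, G \in D -> s \subset G -> #|G|.+1 = d -> face_sum d c G = 0) ->
  exists x : 'F_2, forall F, F \in D -> s \subset F -> #|F| = d -> c F = x.
Proof.
move=> sD hc; have sd := sphere_card sD.
set L := link D s; set one : {set V} -> 'F_2 := fun=> 1.
have hone : local_chain s d one \in cycles L (d - #|s|).
  apply: local_cycle => // G GD _ cG.
  rewrite /face_sum sumr_const -(@eq_card _ (mem [set F in D | (G \subset F) && (#|F| == d)])).
    by rewrite card_ridge //; apply: val_inj.
  by move=> F; rewrite !inE.
have c2 : boundaries L (d - #|s|) = 0%VS.
  suff E : chains L (d - #|s|).+1 = 0%VS by rewrite /boundaries E limg0.
  apply/eqP; rewrite -dimv_eq0 dim_chains cards_eq0 -subset0; apply/subsetP => r.
  rewrite !inE => /andP[/and3P[_ rG /eqP rG0] /eqP cr].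
  by have := sphere_card rG; rewrite cardsU rG0 cards0 cr; lia.
have := link_rbetti (d - #|s|) sD; rewrite /rbetti c2 dimv0 subn0 eqxx /= => c1.
have [F0 F0D /andP[sF0 /eqP cF0]] := sphere_facet sD.
have val_chain c0 F : F \in D -> s \subset F -> #|F| = d ->
    local_chain s d c0 (F :\: s) = c0 F.
  move=> FD sF cF; have [FL cFs FE] := face_setD sD sd FD sF cF.
  by rewrite ffunE FL cFs subnK // eqxx FE.
have E : (<[local_chain s d one]> = cycles L (d - #|s|))%VS.
  apply/eqP; rewrite eqEdim -memvE hone c1 dim_vline.
  suff -> : local_chain s d one != 0 by [].
  apply/eqP => E0; have := val_chain one F0 F0D sF0 cF0.
  by rewrite E0 ffunE => /eqP.
have := local_cycle sD sd hc; rewrite -/L -E => /vlineP[x hx].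
exists x => F FD sF cF.
by rewrite -(val_chain c F FD sF cF) hx ffunE val_chain // /GRing.scale /= mulr1.
Qed.

Variables (K : fieldType) (f : {rmorphism 'F_2 -> K}).

Let relevant s k F := [&& F \in D, s \subset F & #|F| == k].

(** The linear system fed to [exact_field_extension]: rows [(false, G)] are the cycle conditions at
    the faces G containing s with k - 1 vertices, rows [(true, G)] make c vanish off the relevant
    faces. *)
Let eqns s k (w : bool * {set V}) F : 'F_2 :=
  if w.1 then ((F == w.2) && ~~ relevant s k F)%:R else
  [&& w.2 \in D, s \subset w.2, #|w.2|.+1 == k, F \in D, w.2 \subset F & #|F| == k]%:R.

Let eqns_local (K0 : fieldType) (f0 : {rmorphism 'F_2 -> K0}) s k (c : {set V} -> K0) :
  (forall G, G \in D -> s \subset G -> #|G|.+1 = k -> face_sum k c G = 0) ->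
  forall w, \sum_F f0 (eqns s k w F) * (if relevant s k F then c F else 0) = 0.
Proof.
move=> hc [[] G] /=; rewrite /eqns /=.
  apply: big1 => F _; case: ifP => _; last by rewrite mulr0.
  by rewrite andbF rmorph0 mul0r.
have [/and3P[GD sG /eqP cG]|hG] := boolP [&& G \in D, s \subset G & #|G|.+1 == k].
  rewrite -[RHS](hc G GD sG cG) /face_sum [RHS]big_mkcond /=; apply: eq_bigr => F _.
  rewrite GD sG cG eqxx /= /relevant.
  case FD : (F \in D); rewrite /= ?rmorph0 ?mul0r //.
  case GF : (G \subset F); rewrite /= ?rmorph0 ?mul0r //.
  rewrite (subset_trans sG GF).
  by case: eqP; rewrite ?rmorph1 ?mul1r // rmorph0 mul0r.
apply: big1 => F _; rewrite (_ : [&& _, _, _ & _] = false) ?rmorph0 ?mul0r //.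
by apply: contraNF hG => /and4P[-> -> ->].
Qed.

Let eqns_local_inv s k (c : {set V} -> 'F_2) :
  (forall w, \sum_F eqns s k w F * c F = 0) ->
  (forall G, G \in D -> s \subset G -> #|G|.+1 = k -> face_sum k c G = 0) /\
  (forall F, ~~ relevant s k F -> c F = 0).
Proof.
move=> h; split=> [G GD sG cG|F hF].
  rewrite -[RHS](h (false, G)) /eqns /= GD sG cG eqxx /= /face_sum [LHS]big_mkcond /=.
  by apply: eq_bigr => F _; case: ifP; rewrite ?mul1r ?mul0r.
have := h (true, F); rewrite /eqns /= (bigD1 F) //= eqxx hF mul1r big1 ?addr0 //.
by move=> G /negPf ->; rewrite mul0r.
Qed.

Lemma exact_faces s k (c : {set V} -> K) : s \in D -> (k < d)%N ->
  (forall G, G \in D -> s \subset G -> #|G|.+1 = k -> face_sum k c G = 0) ->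
  exists c' : {set V} -> K, forall F, F \in D -> s \subset F -> #|F| = k ->
    c F = face_sum k.+1 c' F.
Proof.
move=> sD kd hc.
pose b F F' : 'F_2 := (relevant s k F && [&& F' \in D, F \subset F' & #|F'| == k.+1])%:R.
have [|c' hc'] := exact_field_extension (f := f) (a := eqns s k) (b := b) _ (eqns_local f hc).
  move=> c0 /eqns_local_inv[h1 h2]; have [c' hc'] := exact_faces_F2 sD kd h1.
  exists c' => F; rewrite /b; have [hF|hF] := boolP (relevant s k F); last first.
    by rewrite h2 // big1 // => F' _; rewrite mul0r.
  have /and3P[FD sF /eqP cF] := hF; rewrite hc' // /face_sum big_mkcond /=.
  by apply: eq_bigr => F' _; case: ifP; rewrite ?mul1r ?mul0r.
exists c' => F FD sF cF; have := hc' F.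
rewrite /b /relevant FD sF cF eqxx /= => ->; rewrite /face_sum [RHS]big_mkcond /=.
by apply: eq_bigr => F' _; case: ifP; rewrite ?rmorph1 ?mul1r ?rmorph0 ?mul0r.
Qed.

Lemma exact_facets s (c : {set V} -> K) : s \in D ->
  (forall G, G \in D -> s \subset G -> #|G|.+1 = d -> face_sum d c G = 0) ->
  exists x : K, forall F, F \in D -> s \subset F -> #|F| = d -> c F = x.
Proof.
move=> sD hc.
pose b F (_ : unit) : 'F_2 := (relevant s d F)%:R.
have [|c' hc'] := exact_field_extension (f := f) (a := eqns s d) (b := b) _ (eqns_local f hc).
  move=> c0 /eqns_local_inv[h1 h2]; have [x hx] := exact_facets_F2 sD h1.
  exists (fun=> x) => F; rewrite /b (big_pred1 tt) => [|[]//].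
  have [hF|hF] := boolP (relevant s d F); last by rewrite h2 // mul0r.
  by have /and3P[FD sF /eqP cF] := hF; rewrite hx // mul1r.
exists (c' tt) => F FD sF cF; have := hc' F.
rewrite (big_pred1 tt) => [|[]//].
by rewrite /b /relevant FD sF cF eqxx rmorph1 mul1r.
Qed.

End SphereFaces.

(** * Cohen-Macaulayness of the Stanley-Reisner ring *)

Section CohenMacaulay.
Variables (V : finType) (D : {set {set V}}) (d : nat).
Hypothesis hD : sphere d D.
Variables (K : fieldType) (f : {rmorphism 'F_2 -> K}) (a : nat -> V -> K).
Hypothesis generic : forall F, F \in D -> exists b, independent_on a F b.
Local Notation poly := {mpoly K[#|V|]}.
Local Notation theta := (fun j => lform (a j)).
Local Notation fam := {ffun {set V} -> poly^o}.
Implicit Types (F G s : {set V}) (k : nat).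

(** Modulo [zeroU k] a family is an element of the direct sum of the rings K[F] over the faces F
    with k vertices, and [cycleU k] is the kernel of the restriction map to the faces with k - 1
    vertices. These sums form a complex starting with the Stanley-Reisner ring; in each multidegree
    m its exactness is the local exactness at the support of m. *)
Let zeroU k (x : fam) := forall F, F \in D -> #|F| = k -> sr_ideal (powerset F) (x F).

Let bd (x : fam) : fam :=
  [ffun G : {set V} => \sum_(F in D | (G \subset F) && (#|F| == #|G|.+1)) x F].

Let bd_linear : linear bd.
Proof.
move=> p x y; apply/ffunP => G; rewrite !ffunE scaler_sumr -big_split /=.
by apply: eq_bigr => F _; rewrite !ffunE.
Qed.

HB.instance Definition _ := GRing.isLinear.Build poly fam fam *:%R bd bd_linear.

Let cycleU k (x : fam) := forall G, G \in D -> #|G|.+1 = k -> sr_ideal (powerset G) (bd x G).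

Let srP F : submodule (sr_ideal (powerset F) : poly^o -> Prop).
Proof. exact/sr_ideal_submodule/down_closed_powerset. Qed.

Let zeroU_sub k : submodule (zeroU k).
Proof.
split=> [F _ _|p x y hx hy F FD cF]; first by rewrite ffunE; case: (srP F).
by rewrite !ffunE; apply: (srP F).2; [apply: hx|apply: hy].
Qed.

Let cycleU_sub k : submodule (cycleU k).
Proof.
split=> [F _ _|p x y hx hy F FD cF]; first by rewrite linear0 ffunE; case: (srP F).
have -> : bd (p *: x + y) F = p *: bd x F + bd y F.
  by rewrite bd_linear; move: (bd x) (bd y) => u w; rewrite !ffunE.
by apply: (srP F).2; [apply: hx|apply: hy].
Qed.

Let zero_cycle k x : zeroU k x -> cycleU k x.
Proof.
move=> hx G GD cG; rewrite ffunE; apply: submodule_sum => [|F /and3P[FD GF /eqP cF]].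
  exact: srP.
have h := hx F FD (etrans cF cG).
move=> m hm; apply: h; move: hm; rewrite !powersetE => /subset_trans; exact.
Qed.

Let K2 (x : K) : x + x = 0.
Proof.
have : f (1 + 1) = 0 by rewrite (_ : 1 + 1 = 0 :> 'F_2) ?rmorph0 //; apply: val_inj.
by rewrite rmorphD rmorph1 => h; rewrite -[x]mulr1 -mulrDr h mulr0.
Qed.

Let P2 (p : poly) : p + p = 0.
Proof. by apply/mpolyP => m; rewrite mcoeffD K2 mcoeff0. Qed.

Let bd_cycle k x : cycleU k (bd x).
Proof.
move=> G GD cG; suff -> : bd (bd x) G = 0 by case: (srP G).
rewrite ffunE; under eq_bigr do rewrite ffunE.
rewrite -[RHS](@double_boundary V poly (fun r => if r \in D then x r else 0) G P2).
rewrite [RHS](bigID (fun s => s \in D)) /= [X in _ + X]big1 ?addr0; last first.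
  move=> s /andP[_ sD]; apply: big1 => r /andP[sr _]; case: ifP => // rD.
  by rewrite (sphere_down_closed hD rD sr) in sD.
apply: eq_big => [s|s _]; first by rewrite andbC.
by rewrite -[RHS]big_mkcondr /=; apply: eq_bigl => F; rewrite andbC.
Qed.

(** Exactness is solved one monomial at a time; the degree bound [B] keeps the assembled families
    polynomial. *)
Let coef_choice (Q : 'X_{1..#|V|} -> ({set V} -> K) -> Prop) B :
  (forall m, (mdeg m < B)%N -> exists c, Q m c) ->
  exists x : fam, (forall m, (mdeg m < B)%N -> exists2 c, Q m c & forall F, (x F)@_m = c F) /\
    forall m, (B <= mdeg m)%N -> forall F, (x F)@_m = 0.
Proof.
move=> hQ; have hQ' (m : 'X_{1..#|V| < B}) : exists c, Q m c by apply: hQ; apply: bmdeg.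
have [c hc] := fin_all_exists hQ'.
pose E F (m : 'X_{1..#|V|}) := if insub m is Some m' then c m' F else 0.
exists [ffun F : {set V} => \sum_(m : 'X_{1..#|V| < B}) E F m *: 'X_[m] : poly^o].
split=> m hm.
  exists (c (BMultinom hm)); first exact: (hc (BMultinom hm)).
  by move=> F; rewrite ffunE mcoeff_mpoly // /E insubT.
move=> F; rewrite ffunE raddf_sum /= big1 // => m' _.
rewrite mcoeffZ mcoeffX; case: eqP => [mE|_]; last by rewrite mulr0.
by have := bmdeg m'; rewrite mE ltnNge hm.
Qed.

Let coef_bound (y : fam) : exists B, forall F m, (B <= mdeg m)%N -> (y F)@_m = 0.
Proof.
exists (\max_F msize (y F)) => F m hm.
apply: memN_msupp_eq0; apply: msize_mdeg_ge; apply: leq_trans hm.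
exact: (leq_bigmax F).
Qed.

Let cycle_lift k y : (k < d)%N -> cycleU k y -> exists x, zeroU k (y - bd x).
Proof.
move=> kd hy; have [B hB] := coef_bound y.
have [m _|x [hx1 hx2]] := @coef_choice (fun m c => msup m \in D ->
    forall F, F \in D -> msup m \subset F -> #|F| = k -> (y F)@_m = face_sum D k.+1 c F) B.
  have [mD|mD] := boolP (msup m \in D); last by exists (fun=> 0).
  have [|c' hc'] := @exact_faces V D d hD K f (msup m) k (fun F => (y F)@_m) mD kd.
    move=> G GD mG cG; have := hy G GD cG m.
    rewrite powersetE mG ffunE raddf_sum => /(_ isT) E; rewrite -[RHS]E.
    by rewrite /face_sum cG.
  by exists c' => _.
exists x => F FD cF m; rewrite powersetE => mF; rewrite !ffunE mcoeffB raddf_sum /=.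
have mD := sphere_down_closed hD FD mF.
have [hm|hm] := ltnP (mdeg m) B.
  have [c hc cE] := hx1 m hm; rewrite (hc mD F FD mF cF) /face_sum -cF.
  by under [X in _ - X]eq_bigr do rewrite cE; rewrite subrr.
by rewrite hB // big1 ?subr0 // => G _; rewrite hx2.
Qed.

Let facet_lift y : cycleU d y ->
  exists q : poly^o, zeroU d (y - [ffun=> q]).
Proof.
move=> hy; have [B hB] := coef_bound y.
have [m _|x [hx1 hx2]] := @coef_choice (fun m c => exists c0, (forall F, c F = c0) /\
    (msup m \in D -> forall F, F \in D -> msup m \subset F -> #|F| = d -> (y F)@_m = c0)) B.
  have [mD|mD] := boolP (msup m \in D); last first.
    by exists (fun=> 0), 0; split=> // hm; rewrite hm in mD.
  have [|c0 hc] := @exact_facets V D d hD K f (msup m) (fun F => (y F)@_m) mD.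
    move=> G GD mG cG; have := hy G GD cG m.
    rewrite powersetE mG ffunE raddf_sum => /(_ isT) E; rewrite -[RHS]E.
    by rewrite /face_sum cG.
  by exists (fun=> c0), c0.
exists (x set0) => F FD cF m; rewrite powersetE => mF; rewrite !ffunE mcoeffB.
have mD := sphere_down_closed hD FD mF.
have [hm|hm] := ltnP (mdeg m) B.
  by have [c [c0 [h1 h2]] cE] := hx1 m hm; rewrite (h2 mD F FD mF cF) cE h1 subrr.
by rewrite hB // hx2 // subr0.
Qed.

Let regular_zero k : regular theta (fun=> True) (zeroU k) k.
Proof.
move=> j hj y z _ _ hyz.
have hu F : exists u : nat -> poly^o, F \in D -> #|F| = k ->
    sr_ideal (powerset F) (y F - \sum_(i < j) theta i *: u i).
  have [/andP[FD /eqP cF]|hF] := boolP ((F \in D) && (#|F| == k)); last first.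
    by exists (fun=> 0) => FD cF; rewrite FD cF eqxx in hF.
  have [b hb] := generic FD.
  have := regular_face hb; rewrite cF => /(_ j hj (y F) (fun i => z i F) I (fun=> I)).
  case=> [|u _ hu]; last by exists u.
  have := hyz F FD cF; rewrite !ffunE sum_ffunE.
  by under eq_bigr do rewrite ffunE.
have [u hu'] := fin_all_exists hu.
exists (fun i => [ffun F => u F i]) => // F FD cF.
rewrite !ffunE sum_ffunE; under eq_bigr do rewrite !ffunE.
exact: hu'.
Qed.

(** In 0 -> cycles_(k+1) -> sum of the K[F] with |F| = k + 1 -> cycles_k -> 0 the middle term is
    regular of length k + 1 and the right one of length k, so the kernel is regular of length k +
    1. *)
Let regular_cycle k : (k <= d)%N -> regular theta (cycleU k) (zeroU k) k.
Proof.
elim: k => [|k IH] hk; first by move=> j.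
apply: regular_sub => //; first exact: zero_cycle.
rewrite /=; apply: (regular_transfer (f := bd) (A := cycleU k) (B := zeroU k)) => //.
- by move=> y; apply: cycle_lift.
- move=> x; split=> h G GD cG; first by apply: h; rewrite ?cG.
  by apply: h => //; apply/eqP; rewrite -eqSS cG.
exact/IH/ltnW.
Qed.

Let cst (p : poly^o) : fam := [ffun=> p].

Let cst_linear : linear cst.
Proof. by move=> p x y; apply/ffunP => G; rewrite !ffunE. Qed.

HB.instance Definition _ := GRing.isLinear.Build poly poly^o fam *:%R cst cst_linear.

(** Constant families identify the Stanley-Reisner ring with [cycleU d] modulo [zeroU d]: they are
    cycles because a ridge lies in two facets, and exactness at the facets says that there are no
    others. *)
Theorem stanley_reisner_regular :
  regular (X := poly^o) theta (fun=> True) (sr_ideal D) d.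
Proof.
apply: (regular_transfer (f := cst) (A := cycleU d) (B := zeroU d)).
- exact: zeroU_sub.
- move=> x G GD cG; suff -> : bd (cst x) G = 0 by case: (srP G).
  rewrite ffunE; under eq_bigr do rewrite ffunE.
  rewrite sumr_const -(@eq_card _ (mem [set F in D | (G \subset F) && (#|F| == d)])).
    by rewrite (card_ridge hD) // mulr2n; apply: P2.
  by move=> F; rewrite !inE -cG.
- by move=> y; apply: facet_lift.
- move=> x; split=> h; last first.
    move=> m mD; have [F FD /andP[mF /eqP cF]] := sphere_facet hD mD.
    by have := h F FD cF m; rewrite powersetE ffunE => /(_ mF).
  move=> F FD cF m; rewrite powersetE ffunE => mF; apply: h.
  exact: (sphere_down_closed hD FD mF).
exact: regular_cycle.
Qed.

End CohenMacaulay.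

(** * Hilbert functions *)

Lemma mcoeffXM n (R : comNzRingType) (k m : 'X_{1..n}) (q : {mpoly R[n]}) :
  ('X_[k] * q)@_m = if (k <= m)%MM then q@_(m - k) else 0.
Proof.
rewrite mulrC; case: ifPn => km; first by rewrite -{1}(submK km) addmC mcoeffMX.
apply: memN_msupp_eq0; apply: contra km.
by rewrite (perm_mem (msuppMX _ _)) => /mapP[m' _ ->]; rewrite lem_addr.
Qed.

Section LinearForms.
Variables (V : finType) (L : fieldType).
Implicit Types (c : V -> L) (p : {mpoly L[#|V|]}).

Lemma lform_homog c : (lform c : {mpoly L[#|V|]}) \is 1.-homog.
Proof.
by apply: rpred_sum => v _; apply: rpredZ; rewrite dhomogX /= /mvar mdeg1.
Qed.

Lemma lform_homogM c i p : p \is i.-homog -> lform c * p \is i.+1.-homog.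
Proof. by move=> hp; rewrite -add1n; apply: dhomogM => //; apply: lform_homog. Qed.

Lemma mcoeff_pihomog i p m : (pihomog mdeg i p)@_m = if mdeg m == i then p@_m else 0.
Proof.
case: ifP => mi; last first.
  by rewrite (dhomog_nemf_coeff (pihomogP mdeg i p)) //= mi.
rewrite [in RHS](mpolyE p) [LHS](_ : _ = (pihomog mdeg i p)@_m) //.
rewrite pihomogE !raddf_sum /= [RHS](bigID (fun m' : 'X_{1..#|V|} => mdeg m' == i)) /=.
rewrite [X in _ + X]big1 ?addr0 // => m' hm'; rewrite mcoeffZ mcoeffX.
by case: eqP => [mE|]; rewrite ?mulr0 //; rewrite mE mi in hm'.
Qed.

Lemma mcoeff_lformM c p m :
  (lform c * p)@_m = \sum_v c v * (if (mvar v <= m)%MM then p@_(m - mvar v) else 0).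
Proof.
rewrite /lform mulr_suml raddf_sum; apply: eq_bigr => v _.
by rewrite -scalerAl /= mcoeffZ mcoeffXM.
Qed.

Lemma pihomog_lform c i p :
  pihomog mdeg i.+1 (lform c * p) = lform c * pihomog mdeg i p.
Proof.
apply/mpolyP => m; rewrite mcoeff_pihomog !mcoeff_lformM.
have [/eqP mi|mi] := boolP (mdeg m == i.+1).
  apply: eq_bigr => v _; case: ifP => // vm; rewrite mcoeff_pihomog.
  by rewrite -eqSS -mi -[in X in _ == X](submK vm) mdegD mdeg1 addn1 eqxx.
rewrite big1 // => v _; case: ifP => [vm|_]; last by rewrite mulr0.
rewrite mcoeff_pihomog ifN ?mulr0 //; apply: contra mi => /eqP <-.
by rewrite -[in X in X == _](submK vm) mdegD mdeg1 addn1.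
Qed.

Lemma pihomog0_lform c p : pihomog mdeg 0 (lform c * p) = 0.
Proof.
apply/mpolyP => m; rewrite mcoeff_pihomog mcoeff0 mcoeff_lformM.
case: ifP => //; rewrite mdeg_eq0 => /eqP->; apply: big1 => v _.
by rewrite mvar_le msup0 inE mulr0.
Qed.

End LinearForms.

Section HilbertFunction.
Variables (V : finType) (L : fieldType) (D : {set {set V}}) (a : nat -> V -> L).
Variable B : nat.
Hypothesis dD : down_closed D.
Local Notation poly := {mpoly L[#|V|]}.
Local Notation mon := 'X_{1..#|V| < B}.
Local Notation Y := {ffun mon -> L^o}.
Local Notation theta := (fun j => lform (a j)).
Implicit Types (p q y : poly) (i k : nat).

(** Coordinates modulo the Stanley-Reisner ideal in the basis of face monomials. Cutting off at
    degree [B] makes the space finite dimensional and loses nothing in degrees below B. *)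
Definition coefs (p : poly) : Y :=
  [ffun m : mon => if msup m \in D then p@_m else 0].

Definition of_coefs (c : Y) : poly := \sum_(m : mon) c m *: 'X_[m].

Fact coefs_is_linear : linear coefs.
Proof.
move=> e p q; apply/ffunP => m; rewrite !ffunE mcoeffD mcoeffZ.
by case: ifP => // _; rewrite scaler0 addr0.
Qed.
HB.instance Definition _ := GRing.isLinear.Build L poly Y *:%R coefs coefs_is_linear.

Fact of_coefs_is_linear : linear of_coefs.
Proof.
move=> e p q; rewrite /of_coefs scaler_sumr -big_split; apply: eq_bigr => m _ /=.
by rewrite !ffunE scalerDl scalerA.
Qed.
HB.instance Definition _ := GRing.isLinear.Build L Y poly *:%R of_coefs of_coefs_is_linear.

Definition face_monomials i : seq mon :=
  [seq m : mon <- enum {: mon} | (msup m \in D) && (mdeg m == i)].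

Definition sr_space i : {vspace Y} := <<map (@delta mon L) (face_monomials i)>>%VS.

Definition ideal_gens k i : seq Y :=
  [seq coefs (lform (a j) * 'X_[val m]) | j <- iota 0 k,
     m <- [seq m : mon <- enum {: mon} | (mdeg m).+1 == i]].

Definition ideal_space k i : {vspace Y} := <<ideal_gens k i>>%VS.

Definition in_ideal k p :=
  exists u : nat -> poly, sr_ideal D (p - \sum_(j < k) lform (a j) * u j).

Definition hilb k i : nat := (\dim (sr_space i) - \dim (ideal_space k i))%N.

Lemma coefs_mvar_expansion y : (forall m, (B <= mdeg m)%N -> y@_m = 0) ->
  y = \sum_(m : mon) y@_m *: 'X_[m].
Proof.
move=> hy; apply/mpolyP => m; have [mB|mB] := ltnP (mdeg m) B.
  by rewrite (mcoeff_mpoly (fun m => y@_m)).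
rewrite hy // raddf_sum /= big1 // => m' _; rewrite mcoeffZ mcoeffX.
by case: eqP => [mE|]; rewrite ?mulr0 //; have := bmdeg m'; rewrite mE ltnNge mB.
Qed.

Lemma sr_spaceP i (c : Y) :
  reflect (forall m : mon, c m != 0 -> (msup m \in D) && (mdeg m == i)) (c \in sr_space i).
Proof.
by apply: (iffP (span_deltaP _ _)) => h m /h; rewrite mem_filter mem_enum andbT.
Qed.

Lemma dim_sr_space i : \dim (sr_space i) = size (face_monomials i).
Proof. by rewrite dim_span_delta // filter_uniq ?enum_uniq. Qed.

Lemma coefs_sr_space i p : p \is i.-homog -> coefs p \in sr_space i.
Proof.
move=> hp; apply/sr_spaceP => m; rewrite ffunE; case: ifP => [_|_]; last by rewrite eqxx.
by rewrite mcoeff_eq0 negbK => hm; have /= -> := dhomog_mf hp hm; rewrite eqxx.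
Qed.

Lemma of_coefs_homog i (c : Y) : c \in sr_space i -> of_coefs c \is i.-homog.
Proof.
move=> /sr_spaceP hc; apply: rpred_sum => m _.
have [->|nz] := eqVneq (c m) 0; first by rewrite scale0r rpred0.
by apply: rpredZ; rewrite dhomogX; case/andP: (hc _ nz).
Qed.

Lemma of_coefsK i (c : Y) : c \in sr_space i -> coefs (of_coefs c) = c.
Proof.
move=> /sr_spaceP hc; apply/ffunP => m; rewrite ffunE.
have E : (of_coefs c)@_m = c m.
  rewrite raddf_sum /= (bigD1 m) //= mcoeffZ mcoeffX eqxx mulr1 big1 ?addr0 // => m' hm.
  by rewrite mcoeffZ mcoeffX (negPf (hm : (m' != m :> 'X_{1..#|V|}))) mulr0.
by rewrite E; have [/eqP->|/hc/andP[->]] := boolP (c m == 0); rewrite ?if_same.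
Qed.

Lemma sr_ideal_coefs i p : (i < B)%N -> p \is i.-homog ->
  coefs p = 0 <-> sr_ideal D p.
Proof.
move=> iB hp; split=> [h m mD|h]; last first.
  by apply/ffunP => m; rewrite !ffunE; case: ifP => // /h.
have [/eqP mi|mi] := boolP (mdeg m == i); last exact: (dhomog_nemf_coeff hp mi).
have mB : (mdeg m < B)%N by rewrite mi.
by have := congr1 (fun c : Y => c (BMultinom mB)) h; rewrite !ffunE /= mD.
Qed.

Lemma in_idealD k p q : in_ideal k p -> in_ideal k q -> in_ideal k (p + q).
Proof.
move=> [u hu] [w hw]; exists (fun j => u j + w j) => m hm.
under eq_bigr do rewrite mulrDr.
by rewrite big_split opprD addrACA mcoeffD hu // hw // addr0.
Qed.

Lemma in_idealM k p q : in_ideal k q -> in_ideal k (p * q).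
Proof.
move=> [u hu]; exists (fun i => p * u i) => m hm.
have := submoduleZ p (sr_ideal_submodule L dD) hu.
move=> /(_ m hm); rewrite /GRing.scale /= mulrBr mulr_sumr.
by under eq_bigr do rewrite mulrCA.
Qed.

Lemma in_idealZ k (c : L) q : in_ideal k q -> in_ideal k (c *: q).
Proof. by rewrite -mul_mpolyC; apply: in_idealM. Qed.

Lemma in_idealB k p q : in_ideal k p -> in_ideal k q -> in_ideal k (p - q).
Proof. by move=> hp hq; apply: in_idealD => //; rewrite -scaleN1r; apply: in_idealZ. Qed.

Lemma in_ideal_sr k p : sr_ideal D p -> in_ideal k p.
Proof. by move=> hp; exists (fun=> 0); rewrite big1 ?subr0 // => j _; rewrite mulr0. Qed.

Lemma in_ideal0 k : in_ideal k 0.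
Proof. by apply: in_ideal_sr => m _; rewrite mcoeff0. Qed.

Lemma in_ideal_gen k j : (j < k)%N -> in_ideal k (lform (a j)).
Proof.
move=> jk; exists (fun l => (l == j)%:R); rewrite (bigD1 (Ordinal jk)) //= eqxx mulr1.
rewrite big1 => [|l]; first by rewrite addr0 subrr => m _; rewrite mcoeff0.
by rewrite -val_eqE /= => /negPf ->; rewrite mulr0.
Qed.

Lemma in_ideal_sum k (I : Type) (r : seq I) (P : pred I) (G : I -> poly) :
  (forall x, P x -> in_ideal k (G x)) -> in_ideal k (\sum_(x <- r | P x) G x).
Proof.
move=> h; apply: (big_ind (in_ideal k)) => //; first exact: in_ideal0.
by move=> x y; apply: in_idealD.
Qed.

Lemma in_idealSP k p : in_ideal k.+1 p <-> exists w, in_ideal k (p - lform (a k) * w).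
Proof.
split=> [[u hu]|[w [u hu]]].
  exists (u k), u => m mD; rewrite -[RHS](hu m mD) big_ord_recr /=.
  by rewrite opprD addrA addrAC.
exists (fun j => if (j < k)%N then u j else w) => m mD.
rewrite -[RHS](hu m mD) big_ord_recr /= ltnn opprD addrA addrAC.
by congr ((_ - _)@__); apply: eq_bigr => j _; rewrite ltn_ord.
Qed.

Lemma coefs_lform_mem k i j u : (j < k)%N -> u \is i.-homog ->
  (i < B)%N -> coefs (lform (a j) * u) \in ideal_space k i.+1.
Proof.
move=> jk hu iB.
rewrite (@coefs_mvar_expansion u); last first.
  move=> m mB; apply: (dhomog_nemf_coeff hu) => /=.
  by apply: contraTneq mB => ->; rewrite -ltnNge.
rewrite mulr_sumr linear_sum /=; apply: memv_suml => m _.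
rewrite -scalerAr linearZ /=; have [->|nz] := eqVneq u@_m 0; first by rewrite scale0r mem0v.
apply/memvZ/memv_span; apply/allpairsP; exists (j, m); split=> //=.
  by rewrite mem_iota.
rewrite mem_filter mem_enum andbT.
by rewrite -mcoeff_msupp in nz; rewrite eqSS -(dhomog_mf hu nz).
Qed.

Lemma ideal_spaceP k i p : (i < B)%N -> p \is i.-homog ->
  coefs p \in ideal_space k i <-> in_ideal k p.
Proof.
move=> iB hp; split.
  suff gen (c : Y) : c \in ideal_space k i -> exists2 q, in_ideal k q & q \is i.-homog /\ coefs q = c.
    move=> /gen[q hq [qi cq]]; rewrite -[p](subrK q); apply: in_idealD => //.
    apply: in_ideal_sr; apply/(@sr_ideal_coefs i) => //; first exact: rpredB.
    by rewrite linearB /= cq subrr.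
  move=> /(@coord_span _ _ _ (in_tuple _)) ->.
  apply: (big_ind (fun c => exists2 q, in_ideal k q & q \is i.-homog /\ coefs q = c)).
  - by exists 0; [exact: in_ideal0 | rewrite rpred0 linear0].
  - move=> x y [q1 i1 [h1 e1]] [q2 i2 [h2 e2]]; exists (q1 + q2); first exact: in_idealD.
    by rewrite rpredD // linearD /= e1 e2.
  move=> l _; have : (ideal_gens k i)`_l \in ideal_gens k i by apply: mem_nth.
  move=> /allpairsP[[j m] /= [jk]].
  rewrite mem_filter => /andP[/eqP mi _] ->.
  move: (coord _ l c) => e; exists (e *: (lform (a j) * 'X_[m])).
    apply: in_idealZ; rewrite mulrC; apply/in_idealM/in_ideal_gen.
    by rewrite mem_iota in jk.
  rewrite linearZ; split=> //; apply: rpredZ; rewrite -mi -add1n.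
  by apply: dhomogM; rewrite ?lform_homog // dhomogX /=.
move=> [u hu].
(* Only the parts of degree i - 1 of the coefficients contribute to degree i, and none contributes
   to degree 0. *)
pose u' j := if i is i'.+1 then pihomog mdeg i' (u j) else 0.
have hP : p - \sum_(j < k) lform (a j) * u' j = pihomog mdeg i (p - \sum_(j < k) lform (a j) * u j).
  rewrite pihomogB pihomog_dE // [X in _ = _ - X]raddf_sum /=; congr (_ - _); apply: eq_bigr => j _.
  rewrite /u'; case: (i) => [|i']; first by rewrite mulr0 pihomog0_lform.
  by rewrite pihomog_lform.
have : coefs (p - \sum_(j < k) lform (a j) * u' j) = 0.
  rewrite hP; apply/(@sr_ideal_coefs i) => //; first exact: pihomogP.
  by move=> m mD; rewrite mcoeff_pihomog; case: ifP => // _; apply: hu.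
rewrite linearB /= => /eqP; rewrite subr_eq0 => /eqP ->.
rewrite linear_sum; apply: memv_suml => j _; rewrite /u'.
case: (i) iB => [|i'] iB; first by rewrite mulr0 linear0 mem0v.
by apply: coefs_lform_mem => //; [exact: pihomogP | exact: ltnW].
Qed.

End HilbertFunction.

Section HilbertRecursion.
Variables (V : finType) (L : fieldType) (D : {set {set V}}) (a : nat -> V -> L).
Variable B : nat.
Hypothesis dD : down_closed D.
Local Notation poly := {mpoly L[#|V|]}.
Local Notation mon := 'X_{1..#|V| < B}.
Local Notation Y := {ffun mon -> L^o}.
Local Notation hilb := (hilb D a B).
Local Notation ideal_space := (ideal_space D a B).
Local Notation sr_space := (sr_space L D B).
Local Notation coefs := (coefs D B).

Definition mul_lform k (c : Y) : Y := coefs (lform (a k) * of_coefs c).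

Fact mul_lform_is_linear k : linear (mul_lform k).
Proof. by move=> e c c'; rewrite /mul_lform linearP mulrDr -scalerAr linearP. Qed.
HB.instance Definition _ k := GRing.isLinear.Build L Y Y *:%R (mul_lform k) (mul_lform_is_linear k).

Lemma of_coefs_coefs i (y : poly) : (i < B)%N -> y \is i.-homog ->
  sr_ideal D (of_coefs (coefs y) - y).
Proof.
move=> iB hy; have h := coefs_sr_space D B hy.
apply/(@sr_ideal_coefs V L D B i) => //.
  by apply: rpredB => //; apply: of_coefs_homog h.
by rewrite linearB /= (of_coefsK h) subrr.
Qed.

Lemma mul_lform_coefs k i (y : poly) : (i.+1 < B)%N -> y \is i.-homog ->
  mul_lform k (coefs y) = coefs (lform (a k) * y).
Proof.
move=> iB hy; apply/eqP; rewrite -subr_eq0 /mul_lform -linearB -mulrBr; apply/eqP.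
have h := of_coefs_coefs (ltnW iB) hy.
apply/(@sr_ideal_coefs V L D B i.+1) => //; last first.
  exact: (submoduleZ _ (sr_ideal_submodule L dD) h).
rewrite -add1n; apply: dhomogM; first exact: lform_homog.
by apply: rpredB => //; apply: (of_coefs_homog (D := D)); apply: coefs_sr_space.
Qed.

Lemma ideal_space_sub k i : (ideal_space k i <= sr_space i)%VS.
Proof.
apply/span_subvP => _ /allpairsP[[j m] /= [_ +] ->].
rewrite mem_filter => /andP[/eqP <- _]; apply: coefs_sr_space.
by rewrite -add1n; apply: dhomogM; rewrite ?lform_homog // dhomogX /=.
Qed.

Lemma ideal_spaceS k i : (i.+1 < B)%N ->
  ideal_space k.+1 i.+1 = (ideal_space k i.+1 + linfun (mul_lform k) @: sr_space i)%VS.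
Proof.
move=> iB; apply/eqP; rewrite eqEsubv; apply/andP; split.
  apply/span_subvP => _ /allpairsP[[j m] /= [jk hm] ->].
  have hX : ('X_[val m] : poly) \is i.-homog.
    by move: hm; rewrite mem_filter eqSS dhomogX => /andP[].
  have {}jk : j \in iota 0 k.+1 by exact: jk.
  rewrite mem_iota leq0n add0n ltnS leq_eqVlt in jk; case/orP: jk => [/eqP->|jk].
    apply: (subvP (addvSr _ _)); rewrite -(mul_lform_coefs k iB hX) -lfunE.
    exact/memv_img/coefs_sr_space.
  apply: (subvP (addvSl _ _)); apply: coefs_lform_mem => //; exact: ltnW.
rewrite subv_add; apply/andP; split.
  apply/sub_span => c /allpairsP[[j m] /= [jk hm] ->]; apply/allpairsP.
  exists (j, m); split => //; move: jk; rewrite !mem_iota !add0n; exact: leqW.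
apply/subvP => _ /memv_imgP[c hc ->]; rewrite lfunE /=.
by apply: coefs_lform_mem => //; [exact: of_coefs_homog hc | exact: ltnW].
Qed.

Let preim_sub k i : (i.+1 < B)%N ->
  (ideal_space k i <= sr_space i :&: linfun (mul_lform k) @^-1: ideal_space k i.+1)%VS.
Proof.
move=> iB; apply/subvP => c hc; have hc' := subvP (ideal_space_sub k i) _ hc.
rewrite memv_cap hc' -memv_preim lfunE /=.
have hom := of_coefs_homog hc'.
apply/ideal_spaceP => //; first by rewrite -add1n; apply: dhomogM; rewrite ?lform_homog.
apply: in_idealM => //; apply/(ideal_spaceP a dD k (ltnW iB) hom).
by rewrite (of_coefsK hc').
Qed.

(** True for arbitrary forms, because multiplication by theta_k maps the ideal into itself. It will
    bound the Hilbert function of special real forms from below. *)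
Lemma hilb_step k i : (i.+1 < B)%N -> (hilb k i.+1 <= hilb k.+1 i.+1 + hilb k i)%N.
Proof.
move=> iB; have := dim_add_img (linfun (mul_lform k)) (sr_space i) (ideal_space k i.+1).
rewrite -ideal_spaceS // /hilb.
have := dimvS (preim_sub k iB).
have := dimvS (ideal_space_sub k i.+1); have := dimvS (ideal_space_sub k.+1 i.+1).
have := dimvS (ideal_space_sub k i).
move: (\dim (ideal_space k.+1 i.+1)) (\dim (ideal_space k i.+1)) (\dim (ideal_space k i))
  (\dim (sr_space i.+1)) (\dim (sr_space i)) (\dim (_ :&: _)) => *; lia.
Qed.

Lemma hilb_regular k i : (i.+1 < B)%N ->
  (forall y : poly, y \is i.-homog -> in_ideal D a k (lform (a k) * y) -> in_ideal D a k y) ->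
  hilb k i.+1 = (hilb k.+1 i.+1 + hilb k i)%N.
Proof.
move=> iB hreg; have := dim_add_img (linfun (mul_lform k)) (sr_space i) (ideal_space k i.+1).
rewrite -ideal_spaceS // /hilb.
have -> : (sr_space i :&: linfun (mul_lform k) @^-1: ideal_space k i.+1 = ideal_space k i)%VS.
  apply/eqP; rewrite eqEsubv preim_sub // andbT; apply/subvP => c.
  rewrite memv_cap -memv_preim lfunE /= => /andP[hc].
  have hom := of_coefs_homog hc.
  move=> /(ideal_spaceP a dD k iB) h.
  rewrite -(of_coefsK hc); apply/(ideal_spaceP a dD k (ltnW iB) hom); apply: hreg => //.
  by apply: h; rewrite -add1n; apply: dhomogM; rewrite ?lform_homog.
have := dimvS (ideal_space_sub k i.+1); have := dimvS (ideal_space_sub k.+1 i.+1).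
have := dimvS (ideal_space_sub k i).
move: (\dim (ideal_space k.+1 i.+1)) (\dim (ideal_space k i.+1)) (\dim (ideal_space k i))
  (\dim (sr_space i.+1)) (\dim (sr_space i)) => *; lia.
Qed.

Lemma hilb_deg0 k : hilb k 0 = hilb 0 0.
Proof.
rewrite /hilb; congr (_ - \dim _)%N.
have E j : ideal_space j 0 = 0%VS.
  rewrite /Submission.ideal_space (_ : ideal_gens D a B j 0 = [::]) ?span_nil //.
  rewrite /ideal_gens (_ : [seq m : mon <- _ | _] = [::]); last first.
    by apply/eqP; rewrite -(negbK (_ == _)) -has_filter; apply/hasP => -[].
  by elim: (iota 0 j) => //= *; rewrite cats0.
by rewrite !E.
Qed.

Lemma hilb0 i : hilb 0 i = size (face_monomials D B i).
Proof.
rewrite /hilb dim_sr_space /Submission.ideal_space /ideal_gens /=.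
by rewrite span_nil dimv0 subn0.
Qed.

End HilbertRecursion.

(* The number of monomials of degree i with support a given k-set. *)
Fixpoint num_comp (k i : nat) {struct i} : nat :=
  match k, i with
  | 0, _ => i == 0%N
  | _.+1, 0 => 0
  | k'.+1, i'.+1 => num_comp k'.+1 i' + num_comp k' i'
  end.

Section CountMonomials.
Variables (V : finType) (B : nat).
Local Notation mon := 'X_{1..#|V| < B}.

Definition monomials_on (F : {set V}) i : seq 'X_{1..#|V|} :=
  [seq val m | m <- enum [pred m : mon | (msup m == F) && (mdeg m == i)]].

Lemma mem_monomials_on F i m : (i < B)%N ->
  (m \in monomials_on F i) = (msup m == F) && (mdeg m == i).
Proof.
move=> iB; apply/mapP/idP => [[m']|/andP[/eqP mF /eqP mi]].
  by rewrite mem_enum inE => /andP[h1 h2] ->; rewrite h1 h2.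
have mB : (mdeg m < B)%N by rewrite mi.
by exists (BMultinom mB) => //; rewrite mem_enum inE /= mF mi !eqxx.
Qed.

Lemma uniq_monomials_on F i : uniq (monomials_on F i).
Proof. by rewrite map_inj_uniq ?enum_uniq //; apply: val_inj. Qed.

(** After division by x_v, for a fixed v in F, the support is either F or F without v; this is the
    recursion of [num_comp]. *)
Lemma size_monomials_on F i : (i < B)%N -> size (monomials_on F i) = num_comp #|F| i.
Proof.
elim: i F => [|i IH] F iB.
  have [->|nF] := eqVneq F set0.
    rewrite cards0 /=; rewrite -[RHS]/(size [:: 0%MM : 'X_{1..#|V|}]).
    apply/perm_size/uniq_perm; rewrite ?uniq_monomials_on // => m.
    rewrite mem_monomials_on // inE mdeg_eq0 andbC; case: eqP => //= ->.
    by rewrite msup0 eqxx.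
  have -> : num_comp #|F| 0 = 0%N by move: nF; rewrite -cards_eq0; case: #|F|.
  case E : (monomials_on F 0) => [|m s] //.
  have : m \in monomials_on F 0 by rewrite E mem_head.
  rewrite mem_monomials_on // mdeg_eq0 => /andP[/eqP mF /eqP m0].
  by case/eqP: nF; rewrite -mF m0 msup0.
have [->|/set0Pn[v vF]] := eqVneq F set0.
  rewrite cards0 /=; case E : (monomials_on set0 i.+1) => [|m s] //.
  have : m \in monomials_on set0 i.+1 by rewrite E mem_head.
  rewrite mem_monomials_on // => /andP[/eqP mF /eqP mi].
  have m0 : m = 0%MM.
    apply/mnmP => j; rewrite mnm0E; apply/eqP; have := in_set0 (enum_val j).
    by rewrite -mF inE enum_valK => /negbFE.
  by rewrite m0 mdeg0 in mi.
have iB' : (i < B)%N by exact: ltnW.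
rewrite (cardsD1 v) vF add1n /=.
have -> : (#|F :\ v|).+1 = #|F| by rewrite [RHS](cardsD1 v) vF.
rewrite -!IH // -size_cat -(size_map (mnm_add (mvar v))).
apply/perm_size/uniq_perm; rewrite ?uniq_monomials_on //.
  rewrite map_inj_uniq; last exact: addmI.
  rewrite cat_uniq !uniq_monomials_on andbT /=; apply/hasPn => m.
  rewrite !mem_monomials_on // => /andP[/eqP-> _]; apply/negP => /andP[/eqP E _].
  by move: vF; rewrite -E !inE eqxx.
move=> m; rewrite mem_monomials_on //; apply/idP/mapP => [/andP[/eqP mF /eqP mi]|[m' + ->]].
  have vm : (mvar v <= m)%MM by rewrite mvar_le mF.
  exists (m - mvar v)%MM; last by rewrite addmC submK.
  have mE : m = (mvar v + (m - mvar v))%MM by rewrite addmC submK.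
  have di : mdeg (m - mvar v) == i by rewrite -eqSS -mi [in X in _ == X]mE mdegD mdeg1 add1n.
  rewrite mem_cat !mem_monomials_on // di !andbT.
  move: mF; rewrite [in X in X -> _]mE msupD msup_mvar => <-.
  have [vs|vs] := boolP (v \in msup (m - mvar v)%MM).
    by rewrite (setUidPr _) ?eqxx // sub1set.
  by rewrite setU1K // eqxx orbT.
rewrite mem_cat !mem_monomials_on // mdegD mdeg1 add1n eqSS msupD msup_mvar.
case/orP => /andP[/eqP -> ->]; rewrite andbT; first by rewrite (setUidPr _) ?sub1set.
by rewrite setD1K.
Qed.

Lemma size_face_monomials (D : {set {set V}}) i : (i < B)%N ->
  size (face_monomials D B i) = \sum_(F in D) num_comp #|F| i.
Proof.
move=> iB; under eq_bigr do rewrite -size_monomials_on // size_map -cardE.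
rewrite /face_monomials.
have -> : size [seq m : mon <- enum {: mon} | (msup m \in D) && (mdeg m == i)] =
   #|[pred m : mon | (msup m \in D) && (mdeg m == i)]|.
  rewrite [RHS]cardE; apply/perm_size/uniq_perm => [||m].
  - exact/filter_uniq/enum_uniq.
  - exact: enum_uniq.
  by rewrite mem_filter !mem_enum andbT.
rewrite -[LHS]sum1_card (partition_big (fun m : mon => msup m) (mem D)) /=; last first.
  by move=> m /andP[].
apply: eq_bigr => F FD; rewrite -[RHS]sum1_card; apply: eq_bigl => m.
by rewrite !inE andbC; case: eqP => // ->; rewrite FD.
Qed.

End CountMonomials.

(** * The h-polynomial of a sphere *)

Lemma coef_mul_1subX (p : {poly int}) i :
  (p * (1 - 'X))`_i = p`_i - (if i is i'.+1 then p`_i' else 0).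
Proof. by rewrite mulrBr mulr1 coefB coefMX; case: i. Qed.

Lemma coef_1subX_rev e l : (l <= e)%N ->
  ((1 - 'X) ^+ e : {poly int})`_l = (('X - 1) ^+ e : {poly int})`_(e - l).
Proof.
have sz k : (size (('X - 1) ^+ k : {poly int}) = k.+1).
  by have := size_exp_XsubC k (1 : int); rewrite polyC1.
have sz' k : (size ((1 - 'X) ^+ k : {poly int}) = k.+1).
  rewrite -(sz k) -opprB exprNn -signr_odd.
  by case: (odd k); rewrite ?expr0 ?expr1 ?mul1r // mulN1r size_polyN.
elim: e l => [|e IH] l; first by rewrite leqn0 => /eqP->; rewrite !expr0.
rewrite !exprSr coef_mul_1subX mulrBr mulr1 coefB coefMX => le.
have [->|l0] := posnP l.
  by rewrite subn0 subr0 /= IH // subn0 [X in _ = _ - X]nth_default ?subr0 // sz.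
case: l l0 le => // l _; rewrite ltnS subSS => le.
rewrite (IH l le); have [->|lt] := eqVneq l e.
  by rewrite subnn /= [X in X - _]nth_default ?sz'.
have {lt}lt : (l < e)%N by rewrite ltn_neqAle lt le.
by rewrite (IH _ lt) -(subnSK lt).
Qed.

Section HNumbers.
Variables (V : finType) (D : {set {set V}}) (d : nat).
Hypothesis hD : sphere d D.

(** The h-polynomial in increasing powers, the sum of the h_i t^i; [hpoly] is its reversal in degree
    d. *)
Definition hilb_poly : {poly int} :=
  \sum_(F in D) 'X^#|F| * (1 - 'X) ^+ (d - #|F|).

(** Iterated backward differences, that is, the coefficients of (1-t)^j times the generating series
    (t/(1-t))^k of [num_comp k]. Each regular form divided out takes one difference. *)
Fixpoint diffs (j k i : nat) : int :=
  if j is j'.+1 then diffs j' k i - (if i is i'.+1 then diffs j' k i' else 0)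
  else num_comp k i.

Lemma diffs_low j k i :
  diffs j (j + k) i = if (j <= i)%N then num_comp k (i - j) : int else 0.
Proof.
elim: j k i => [|j IH] k i /=; first by rewrite subn0.
rewrite addSnnS IH; case: i => [|i]; first by rewrite subr0; case: j {IH}.
rewrite IH ltnS; have [le|lt] := leqP j i.
  by rewrite leqW // subSn //= subSS; lia.
by rewrite subr0; case: leqP => // le; rewrite (_ : i.+1 - j = 0)%N //; lia.
Qed.

Lemma diffsE e k i : diffs (k + e) k i = ('X^k * (1 - 'X) ^+ e)`_i.
Proof.
elim: e i => [|e IH] i.
  rewrite addn0 expr0 mulr1 coefXn -{2}[k]addn0 diffs_low.
  case: leqP => [le|lt]; last by rewrite (_ : i == k = false) //; apply/eqP; lia.
  by rewrite /num_comp; case: (i - k)%N (subn_eq0 i k) => [|m] /esym /= h; rewrite eqn_leq le andbT h.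
rewrite addnS /= exprSr mulrA coef_mul_1subX IH.
by case: i => // i; rewrite IH.
Qed.

Lemma diffs_hilb_poly B (H : nat -> nat -> int) :
  (forall i, (i < B)%N -> H 0 i = \sum_(F in D) (num_comp #|F| i)%:Z) ->
  (forall k, H k 0 = H 0 0) ->
  (forall k i, (k < d)%N -> (i.+1 < B)%N -> H k.+1 i.+1 = H k i.+1 - H k i) ->
  forall i, (i < B)%N -> H d i = hilb_poly`_i.
Proof.
move=> H0 Hk0 HS.
suff HE j i : (j <= d)%N -> (i < B)%N -> H j i = \sum_(F in D) diffs j #|F| i.
  move=> i iB; rewrite HE // /hilb_poly coef_sum; apply: eq_bigr => F FD.
  by rewrite -diffsE subnKC // (sphere_card hD).
elim: j i => [|j IH] i jd iB; first by rewrite H0.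
have jd' := ltnW jd.
case: i iB => [|i] iB; rewrite /= sumrB.
  by rewrite big1_eq subr0 -IH // !Hk0.
have iB' := ltnW iB.
by rewrite HS // !IH.
Qed.

Lemma hnum_hilb_poly i : (i <= d)%N -> hnum d D i = hilb_poly`_i.
Proof.
move=> id; rewrite /hnum.
have -> : hpoly d D = \sum_(F in D) ('X - 1) ^+ (d - #|F|).
  rewrite (partition_big (fun F : {set V} => inord #|F| : 'I_d.+1) predT) //=.
  apply: eq_bigr => j _; rewrite /nfaces -sum1_card natr_sum scaler_suml.
  apply: eq_big => F.
    rewrite inE; case FD: (F \in D) => //=.
    by rewrite -val_eqE /= inordK // ltnS (sphere_card hD).
  by rewrite inE => /andP[FD /eqP->]; rewrite scale1r.
rewrite !coef_sum; apply: eq_bigr => F FD; have Fd := sphere_card hD FD.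
rewrite coefXnM; case: ltnP => [lt|le].
  rewrite nth_default //.
  have := size_exp_XsubC (d - #|F|) (1 : int); rewrite polyC1 => ->; lia.
rewrite coef_1subX_rev; last by lia.
by congr (_`_ _); lia.
Qed.

Lemma size_hilb_poly : (size hilb_poly <= d.+1)%N.
Proof.
apply: (leq_trans (size_sum _ _ _)); apply/bigmax_leqP => F FD.
apply: (leq_trans (size_polyMleq _ _)); rewrite size_polyXn /=.
have -> : size ((1 - 'X) ^+ (d - #|F|) : {poly int}) = (d - #|F|).+1.
  rewrite -opprB exprNn -signr_odd.
  have := size_exp_XsubC (d - #|F|) (1 : int); rewrite polyC1.
  by case: (odd _); rewrite ?expr0 ?expr1 ?mul1r // mulN1r size_polyN.
by have := sphere_card hD FD; lia.
Qed.

Lemma hilb_poly_sum : \sum_(i < d.+1) hilb_poly`_i = #|[set F in D | #|F| == d]|%:Z.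
Proof.
have := horner_coef_wide 1 size_hilb_poly.
under eq_bigr do rewrite expr1n mulr1.
move=> <-; rewrite /hilb_poly horner_sum.
under eq_bigr => F FD do rewrite hornerM hornerXn expr1n mul1r horner_exp !hornerE subrr expr0n subn_eq0.
rewrite -sum1_card -[RHS]natz natr_sum [RHS]big_mkcond [LHS]big_mkcond /=.
apply: eq_bigr => F _; rewrite inE; case FD: (F \in D) => //=.
by rewrite eqn_leq (sphere_card hD) //=; case: leqP.
Qed.

(** Only facets and ridges contribute to the derivative at 1, and d f_(d-1) = 2 f_(d-2), since a
    facet contains d ridges and a ridge lies in two facets. From this averaged form of h_i = h_(d-i)
    the whole symmetry will be recovered. *)
Lemma hilb_poly_moment :
  \sum_(i < d.+1) hilb_poly`_i * i%:Z *+ 2 = (\sum_(i < d.+1) hilb_poly`_i) * d%:Z.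
Proof.
have E : \sum_(i < d.+1) hilb_poly`_i * i%:Z = hilb_poly^`().[1].
  have sz : (size (hilb_poly^`()) <= d)%N.
    apply/leq_sizeP => j dj; rewrite coef_deriv nth_default ?mul0rn //.
    exact: leq_trans size_hilb_poly _.
  rewrite (horner_coef_wide 1 sz) big_ord_recl /= mulr0 add0r.
  apply: eq_bigr => i _; rewrite expr1n mulr1 coef_deriv /bump /= add1n.
  by rewrite -mulr_natr natz.
rewrite sumrMnl E hilb_poly_sum.
have -> : hilb_poly^`().[1] = \sum_(F in D | #|F| == d) d%:Z -
   \sum_(G in D | #|G|.+1 == d) 1.
  rewrite /hilb_poly raddf_sum horner_sum /= 2!big_mkcondr -sumrB /=.
  apply: eq_bigr => F FD; have Fd := sphere_card hD FD.
  rewrite derivM derivXn deriv_exp derivB derivC derivX sub0r !hornerE.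
  rewrite !hornerMn !hornerE subrr !expr1n !expr0n.
  have [->|Fd'] := eqVneq #|F| d.
    by rewrite subnn [d.+1 == d]eqn_leq ltnn /= mulr0n mulr0 addr0 subr0 mulr1 natz.
  have d0 : (0 < d - #|F|)%N by rewrite subn_gt0 ltn_neqAle Fd' Fd.
  rewrite (_ : d - #|F| == 0 = false)%N /=; last by rewrite -leqn0 leqNgt d0.
  rewrite mulr0 add0r mul1r sub0r.
  rewrite (_ : _.-1 == 0 = (#|F|.+1 == d))%N; last by apply/eqP/eqP; lia.
  by case: eqP => [<-|_]; rewrite /= ?mulr0 ?mul0rn ?oppr0 // subSnn mulr1.
have dc : \sum_(F in D | #|F| == d) d%:Z = \sum_(G in D | #|G|.+1 == d) 2.
  have [d0|d0] := posnP d.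
    rewrite big1 => [|F _]; last by rewrite d0.
    by rewrite big1 // => G /andP[_]; rewrite d0.
  have E2 F : F \in D -> #|F| == d -> d%:Z = \sum_(G in D | (#|G|.+1 == d) && (G \subset F)) 1.
    move=> FD /eqP Fd; rewrite sumr_const natz; congr Posz.
    have := cards_draws F d.-1; rewrite Fd -{2}(prednK d0) binSn prednK // => E4.
    rewrite -[LHS]E4; apply: eq_card => G; rewrite [LHS]inE -eqSS prednK // andbC.
    rewrite [RHS]unfold_in.
    by case GF: (G \subset F); rewrite ?andbF // (sphere_down_closed hD FD GF) andbT.
  under eq_bigr => F /andP[FD Fd] do rewrite (E2 F FD Fd).
  rewrite (exchange_big_dep (fun G => (G \in D) && (#|G|.+1 == d))) /=; last first.
    by move=> F G _ /andP[-> /andP[-> _]].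
  apply: eq_bigr => G /andP[GD /eqP Gd]; rewrite sumr_const !natz.
  congr Posz; rewrite -[RHS](card_ridge hD GD Gd).
  apply: eq_card => F; rewrite [RHS]inE [LHS]unfold_in GD Gd eqxx /=.
  by rewrite -andbA; congr (_ && _); rewrite andbC.
have x2 : \sum_(G in D | #|G|.+1 == d) 2 = (\sum_(G in D | #|G|.+1 == d) 1) *+ 2 :> int.
  by rewrite -sumrMnl.
have E3 : \sum_(F in D | #|F| == d) d%:Z = #|[set F in D | #|F| == d]|%:Z * d%:Z.
  by rewrite sumr_const -mulr_natl natz; congr (_ %:Z * _); apply: eq_card => F; rewrite inE.
by rewrite -E3 dc x2 mulr2n addrK.
Qed.

End HNumbers.

(** * The degree map *)

Section DegreeMap.
Variables (V : finType) (D : {set {set V}}) (d : nat).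
Hypothesis hD : sphere d D.
Variables (K : fieldType) (a : nat -> V -> K) (p : nat -> K).
Hypothesis K2 : forall x : K, x + x = 0.
Local Notation poly := {mpoly K[#|V|]}.
Implicit Types (F G S : {set V}) (v w : V).

Definition is_facet F := (F \in D) && (#|F| == d).

(* [pt F] is the point of the coordinate subspace of F at which the linear
   forms take the prescribed values p; [dual F v] are the coefficients of the
   combination of the forms restricting to the coordinate x_v on F, and
   [vol F] is, up to the order of F, the determinant of the forms on F. *)
Record facet_data (pt : {set V} -> V -> K) (dual : {set V} -> V -> nat -> K)
    (vol : {set V} -> K) : Prop := {
  pt_neq0 : forall F v, is_facet F -> (pt F v != 0) = (v \in F);
  pt_form : forall F k, is_facet F -> (k < d)%N -> \sum_v a k v * pt F v = p k;
  dualP : forall F v w, is_facet F -> v \in F -> w \in F ->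
    \sum_(k < d) dual F v k * a k w = (v == w)%:R;
  dual_pt : forall F v, is_facet F -> v \in F -> \sum_(k < d) dual F v k * p k = pt F v;
  vol_neq0 : forall F, is_facet F -> vol F != 0;
  vol_ridge : forall G v w, v \notin G -> w \notin G ->
    is_facet (v |: G) -> is_facet (w |: G) ->
    vol (v |: G) * pt (v |: G) v = vol (w |: G) * pt (w |: G) w }.

Variables (pt : {set V} -> V -> K) (dual : {set V} -> V -> nat -> K).
Variable vol : {set V} -> K.
Hypothesis data : facet_data pt dual vol.

Definition ev F (q : poly) : K := q.@[fun i => pt F (enum_val i)].

(** Normalised so that the squarefree monomial of the facet F has degree 1 / vol F. *)
Definition weight F : K := (vol F * \prod_(v in F) pt F v)^-1.

(* Lee's formula for the degree map *)
Definition deg (q : poly) : K := \sum_(F | is_facet F) weight F * ev F q.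

Fact deg_is_linear : linear_for *%R deg.
Proof.
move=> c q r; rewrite /deg mulr_sumr -big_split; apply: eq_bigr => F _ /=.
by rewrite /ev mevalD mevalZ mulrDr mulrCA.
Qed.
HB.instance Definition _ := GRing.isLinear.Build K poly K *%R deg deg_is_linear.

Lemma evX F m : ev F 'X_[m] = \prod_v pt F v ^+ m (enum_rank v).
Proof.
rewrite /ev mevalX (reindex (@enum_rank V)) /=; last exact/onW_bij/enum_rank_bij.
by apply: eq_bigr => v _; rewrite enum_rankK.
Qed.

Lemma evM F q r : ev F (q * r) = ev F q * ev F r.
Proof. exact: mevalM. Qed.

Lemma ev_lform F c : ev F (lform c) = \sum_v c v * pt F v.
Proof.
rewrite /ev /lform raddf_sum /=; apply: eq_bigr => v _.
by rewrite mevalZ mevalXU enum_rankK.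
Qed.

Lemma ev_monomial_out F m : is_facet F -> ~~ (msup m \subset F) -> ev F 'X_[m] = 0.
Proof.
move=> hF /subsetPn[v]; rewrite inE => hv vF; rewrite evX (bigD1 v) //=.
have /eqP -> : pt F v == 0 by rewrite -[_ == _]negbK (pt_neq0 data) // (negPf vF).
by rewrite expr0n (negPf hv) mul0r.
Qed.

Lemma deg_lform k q : (k < d)%N -> deg (lform (a k) * q) = p k * deg q.
Proof.
move=> kd; rewrite /deg mulr_sumr; apply: eq_bigr => F hF.
by rewrite evM ev_lform (pt_form data) // mulrCA.
Qed.

Lemma deg_combination (c : nat -> K) q :
  deg (lform (fun v => \sum_(k < d) c k * a k v) * q) = (\sum_(k < d) c k * p k) * deg q.
Proof.
have -> : lform (fun v => \sum_(k < d) c k * a k v) = \sum_(k < d) c k *: lform (a k) :> poly.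
  rewrite /lform; under eq_bigr do rewrite scaler_suml.
  rewrite exchange_big /=; apply: eq_bigr => k _; rewrite scaler_sumr.
  by apply: eq_bigr => v _; rewrite scalerA.
rewrite !mulr_suml linear_sum /=; apply: eq_bigr => k _.
by rewrite -scalerAl linearZ /= deg_lform // mulrA.
Qed.

Lemma deg_nonface m : msup m \notin D -> deg 'X_[m] = 0.
Proof.
move=> mD; apply: big1 => F hF; rewrite ev_monomial_out ?mulr0 //.
by apply: contra mD => /(sphere_down_closed hD (andP hF).1).
Qed.

Lemma deg_sr q : sr_ideal D q -> deg q = 0.
Proof.
move=> hq; rewrite (mpolyE q) linear_sum big_seq big1 // => m hm.
rewrite linearZ /= deg_nonface ?mulr0 //; apply: contraL hm => /hq.
by rewrite -mcoeff_eq0 => ->.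
Qed.

Definition mset S : 'X_{1..#|V|} := (\sum_(v in S) mvar v)%MM.

Lemma mset_setU1 v S : v \notin S -> mset (v |: S) = (mvar v + mset S)%MM.
Proof. by move=> vS; rewrite /mset big_setU1. Qed.

Lemma evX_mset F S : ev F 'X_[mset S] = \prod_(v in S) pt F v.
Proof.
rewrite /ev -mprodXE rmorph_prod /=; apply: eq_bigr => v _.
by rewrite mevalXU enum_rankK.
Qed.

Lemma msup_mset S : msup (mset S) = S.
Proof.
apply/setP=> v; rewrite inE mnm_sumE.
have [vS|vS] := boolP (v \in S).
  by rewrite (bigD1 v) //= mnm1E eqxx.
rewrite big1 // => w wS; rewrite /mvar mnm1E; apply/eqP; rewrite eqb0.
by rewrite (inj_eq enum_rank_inj); apply: contraNneq vS => <-.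
Qed.

(* The coordinate x_v, v in F, as a combination of the forms modulo the
   variables outside F. *)
Let deg_dual F v q : is_facet F -> v \in F ->
  deg ('X_[mvar v] * q) = pt F v * deg q -
    \sum_(w | w \notin F) (\sum_(k < d) dual F v k * a k w) * deg ('X_[mvar w] * q).
Proof.
move=> hF vF; rewrite -(dual_pt data) // -deg_combination.
rewrite {1}/lform mulr_suml linear_sum /= (bigID (mem F)) /= (bigD1 v) //=.
rewrite (dualP data) // eqxx scale1r big1 => [|w /andP[wF wv]]; last first.
  by rewrite (dualP data) // eq_sym (negPf wv) scale0r mul0r linear0.
rewrite addr0; under [X in _ + X - _]eq_bigr do rewrite -scalerAl linearZ /=.
by rewrite addrK.
Qed.

Let facet_sup S : S \in D -> exists2 F, is_facet F & S \subset F.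
Proof. by move=> /(sphere_facet hD)[F FD /andP[SF cF]]; exists F; rewrite // /is_facet FD. Qed.

(** Descending induction on |S|. At a ridge the two facets contribute inverses of vol times a
    coordinate, equal by [vol_ridge], which cancel in characteristic 2. For smaller S, take w
    outside S in a facet containing S: [deg_dual] expresses pt F w times the degree of S through
    degrees of larger sets. *)
Let deg_mset S : S \in D -> (#|S| < d)%N -> deg 'X_[mset S] = 0.
Proof.
move: {2}(d - #|S|)%N (leqnn (d - #|S|)) => n; elim: n S => [|n IH] S hn SD Sd.
  by lia.
have [Sd1|Sd1] := eqVneq #|S|.+1 d.
  have := card_ridge hD SD Sd1 => /eqP/cards2P[F1 [F2 [F12 E]]].
  have term F : F \in [set F in D | (S \subset F) && (#|F| == d)] ->
      is_facet F /\ exists2 v, v \notin S & F = v |: S.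
    rewrite inE => /and3P[FD SF cF]; split; first by rewrite /is_facet FD.
    have : #|F :\: S| = 1%N by rewrite cardsD (setIidPr SF) (eqP cF); lia.
    move=> /eqP/cards1P[v hv]; exists v.
      have : v \in F :\: S by rewrite hv set11.
      by rewrite inE => /andP[].
    by rewrite -hv setUC -[LHS](setID F S) (setIidPr SF).
  have [h1 [v1 v1S E1]] : is_facet F1 /\ exists2 v, v \notin S & F1 = v |: S.
    by apply: term; rewrite E !inE eqxx.
  have [h2 [v2 v2S E2]] : is_facet F2 /\ exists2 v, v \notin S & F2 = v |: S.
    by apply: term; rewrite E !inE eqxx orbT.
  have val F v : v \notin S -> F = v |: S -> is_facet F ->
      weight F * ev F 'X_[mset S] = (vol F * pt F v)^-1.
    move=> vS FE hF; rewrite evX_mset /weight {2}FE big_setU1 //= mulrA invfM mulfVK //.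
    apply/prodf_neq0 => w wS; rewrite (pt_neq0 data) // FE; exact: setU1r.
  rewrite /deg (bigD1 F1) //= (bigD1 F2) /=; last by rewrite h2 eq_sym.
  rewrite (val F1 v1) // (val F2 v2) // big1 => [|F /andP[/andP[hF n1] n2]]; last first.
    rewrite ev_monomial_out ?mulr0 // msup_mset; apply/negP => SF.
    have : F \in [set F in D | (S \subset F) && (#|F| == d)].
      by case/andP: hF => FD cF; rewrite inE FD SF.
    by rewrite E !inE (negPf n1) (negPf n2).
  subst F1 F2; rewrite addr0 (vol_ridge data v1S v2S h1 h2).
  exact: K2.
have [F hF SF] := facet_sup SD.
have : (#|S| < #|F|)%N by case/andP: hF => _ /eqP->.
move=> _; have /properP[_ [w wF wS]] : S \proper F.
  rewrite properEcard SF /=; by case/andP: hF => _ /eqP->.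
have up v : v \notin S -> deg ('X_[mvar v] * 'X_[mset S]) = 0.
  move=> vS; rewrite -mpolyXD -mset_setU1 //.
  have [vSD|vSD] := boolP (v |: S \in D); last by rewrite deg_nonface // msup_mset.
  by apply: IH; rewrite // cardsU1 vS; lia.
have := deg_dual 'X_[mset S] hF wF; rewrite up // big1 ?subr0 => [|v vF]; last first.
  rewrite up ?mulr0 //; apply: contra vF; exact: (subsetP SF).
move/esym/eqP; rewrite mulf_eq0 => /orP[|/eqP//].
by rewrite -[_ == _]negbK (pt_neq0 data) // wF.
Qed.

Lemma mdeg_mset S : mdeg (mset S) = #|S|.
Proof. by rewrite /mset mdeg_sum /= -[RHS]sum1_card; apply: eq_bigr => v _; rewrite mdeg1. Qed.

Lemma mset_sqf (m : 'X_{1..#|V|}) : (forall v, m (enum_rank v) <= 1)%N -> m = mset (msup m).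
Proof.
move=> sqf; apply/mnmP => i; rewrite -[i]enum_valK; move: (enum_val i) => v.
have := msup_mset (msup m) => /setP/(_ v); rewrite 2!inE.
have le1 : (mset (msup m) (enum_rank v) <= 1)%N.
  rewrite /mset mnm_sumE; have [vS|vS] := boolP (v \in msup m).
    rewrite (bigD1 v) //= mnm1E eqxx big1 // => w /andP[_ wv].
    by rewrite /mvar mnm1E (inj_eq enum_rank_inj) (negPf wv).
  rewrite big1 // => w wS; rewrite /mvar mnm1E (inj_eq enum_rank_inj).
  by apply/eqP; rewrite eqb0; apply: contraNneq vS => <-.
have := sqf v; move: le1; case: (m _) => [|[|]] //; case: (mset _ _) => [|[|]] //.
Qed.

(** [deg_dual] trades a repeated variable for a monomial of lower degree and monomials of the same
    degree with larger support. Hence the two nested inductions, which end at squarefree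
    monomials. *)
Lemma deg_low (m : 'X_{1..#|V|}) : (mdeg m < d)%N -> deg 'X_[m] = 0.
Proof.
move: {2}(mdeg m).+1 (leqnn (mdeg m).+1) => e; elim: e m => // e IHe m me.
move: {2}(#|V| - #|msup m|).+1 (leqnn (#|V| - #|msup m|).+1) => n.
elim: n m me => // n IHn m me hn md.
have [mD|mD] := boolP (msup m \in D); last exact: deg_nonface.
have [/forallP sqf|] := boolP [forall v : V, m (enum_rank v) <= 1]%N.
  have mE := mset_sqf sqf; rewrite mE; apply: deg_mset => //.
  by rewrite -mdeg_mset -mE.
rewrite negb_forall => /existsP[v]; rewrite -ltnNge => mv.
have [F hF SF] := facet_sup mD.
have vS : v \in msup m by rewrite inE; case: (m _) mv.
have vm : (mvar v <= m)%MM by rewrite mvar_le.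
set m' := (m - mvar v)%MM.
have mE : m = (mvar v + m')%MM by rewrite addmC submK.
have dm : mdeg m = (mdeg m').+1 by rewrite mE mdegD mdeg1.
have sm : msup m' = msup m.
  rewrite [in RHS]mE msupD msup_mvar; apply/esym/setUidPr; rewrite sub1set inE /m' mnmBE mnm1E eqxx.
  by case: (m _) mv => // -[].
rewrite mE mpolyXD (deg_dual _ hF); last exact: (subsetP SF).
rewrite IHe ?mulr0 ?sub0r; [|by rewrite -ltnS -dm|by apply: ltn_trans md; rewrite dm].
rewrite big1 ?oppr0 // => w wF; rewrite -mpolyXD.
have wm : w \notin msup m by apply: contra wF; apply: (subsetP SF).
rewrite IHn ?mulr0 //.
- by rewrite mdegD mdeg1 add1n -dm.
- rewrite msupD msup_mvar sm cardsU1 wm; have := subset_leq_card (subsetT (w |: msup m)).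
  rewrite cardsT cardsU1 wm; lia.
- by rewrite mdegD mdeg1 add1n -dm.
Qed.

Lemma deg_homog_low i q : q \is i.-homog -> (i < d)%N -> deg q = 0.
Proof.
move=> hq id; rewrite (mpolyE q) linear_sum big_seq big1 // => m hm.
by rewrite linearZ /= deg_low ?mulr0 //; have /= -> := dhomog_mf hq hm.
Qed.

(** Under [deg] the form theta_j acts as the scalar p_j and not as 0. In degree d, however, it
    multiplies polynomials of degree d - 1, on which [deg] vanishes. *)
Lemma deg_in_ideal q : q \is d.-homog -> in_ideal D a d q -> deg q = 0.
Proof.
move=> hq [u hu].
have [d0|d0] := posnP d.
  by apply: deg_sr => m mD; rewrite -[RHS](hu m mD) big1 ?subr0 // => j _; have := ltn_ord j; lia.
have hqu : sr_ideal D (pihomog mdeg d (q - \sum_(j < d) lform (a j) * u j)).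
  by move=> m mD; rewrite mcoeff_pihomog; case: ifP => // _; apply: hu.
have := deg_sr hqu; rewrite pihomogB pihomog_dE // linearB /= => /eqP; rewrite subr_eq0 => /eqP->.
have -> : pihomog mdeg d (\sum_(j < d) lform (a j) * u j) =
    \sum_(j < d) lform (a j) * pihomog mdeg d.-1 (u j).
  rewrite (raddf_sum (pihomog mdeg d)); apply: eq_bigr => j _.
  by have := pihomog_lform (a j) d.-1 (u j); rewrite prednK.
rewrite linear_sum /= big1 // => j _; rewrite deg_lform //.
by rewrite (@deg_homog_low d.-1) ?mulr0 ?pihomogP // prednK.
Qed.

End DegreeMap.

(** * Poincare duality *)

Section Perp.
Variables (T : finType) (L : fieldType) (S : seq T) (wt : T -> L).
Hypothesis wt0 : forall t, t \in S -> wt t != 0.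
Local Notation Y := {ffun T -> L^o}.
Local Notation coordS := <<map (@delta T L) S>>%VS.

Let restrict (U : {vspace Y}) : 'M[L]_(\dim U, size S) :=
  \matrix_(i, j) (vbasis U)`_i (tnth (in_tuple S) j).

Let restrict_free (U : {vspace Y}) : (U <= coordS)%VS -> row_free (restrict U).
Proof.
move=> sU; apply: inj_row_free => v hv.
have : \sum_i v 0 i *: (vbasis U)`_i = 0.
  set c := \sum_i _; have cU : c \in U.
    by apply: rpred_sum => i _; apply/rpredZ/vbasis_mem/mem_nth; rewrite size_tuple.
  have /span_deltaP hc := subvP sU _ cU.
  apply/ffunP => t; rewrite [RHS]ffunE; apply/eqP/negPn/negP => /[dup] /hc tS.
  have := congr1 (fun M : 'rV_ _ => M 0 (Ordinal (etrans (index_mem t S) tS))) hv.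
  rewrite !mxE => E; case/negP; apply/eqP; rewrite -[RHS]E /c sum_ffunE.
  apply: eq_bigr => i _; rewrite !ffunE mxE (tnth_nth t) /=.
  by rewrite nth_index.
have /freeP := basis_free (vbasisP U) => /(_ (fun i => v 0 i)) h /h {}h.
by apply/rowP => i; rewrite h mxE.
Qed.

(** Bases of U and W give two matrices of full row rank whose product through an invertible diagonal
    matrix is 0. *)
Lemma perp_dim (U W : {vspace Y}) : (U <= coordS)%VS -> (W <= coordS)%VS ->
  (forall u w, u \in U -> w \in W -> \sum_(t <- S) wt t * (u t * w t) = 0) ->
  (\dim U + \dim W <= size S)%N.
Proof.
move=> sU sW perp.
pose dg : 'M[L]_(size S) := diag_mx (\row_j wt (tnth (in_tuple S) j)).
have dgu : dg \in unitmx.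
  rewrite unitmxE det_diag unitfE; apply/prodf_neq0 => j _; rewrite mxE.
  exact/wt0/mem_tnth.
have E : restrict U *m (dg *m (restrict W)^T) = 0.
  apply/matrixP => i j; rewrite mul_diag_mx !mxE.
  rewrite -[RHS](perp (vbasis U)`_i (vbasis W)`_j); last 2 first.
  - by apply/vbasis_mem/mem_nth; rewrite size_tuple.
  - by apply/vbasis_mem/mem_nth; rewrite size_tuple.
  rewrite (big_tnth _ _ S) /=; apply: eq_bigr => l _; rewrite !mxE.
  by rewrite mulrCA.
have := mulmx0_rank_max E; rewrite eqmxMfull ?mxrank_tr.
  have := restrict_free sU; have := restrict_free sW.
  by rewrite /row_free => /eqP-> /eqP->.
by rewrite row_full_unit.
Qed.

Lemma perp_mem (U W : {vspace Y}) c : (U <= coordS)%VS -> (W <= coordS)%VS ->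
  (forall u w, u \in U -> w \in W -> \sum_(t <- S) wt t * (u t * w t) = 0) ->
  (\dim U + \dim W = size S)%N ->
  c \in coordS -> (forall w, w \in W -> \sum_(t <- S) wt t * (c t * w t) = 0) -> c \in U.
Proof.
move=> sU sW perp dE cS hc.
have := @perp_dim (U + <[c]>)%VS W _ sW.
rewrite subv_add sU -memvE cS => /(_ isT) h.
have {}h : (\dim (U + <[c]>) + \dim W <= size S)%N.
  apply: h => _ w /memv_addP[u uU [_ /vlineP[k ->] ->]] wW.
  rewrite -[RHS](perp u w uU wW) -[RHS]addr0 -[in X in _ = _ + X](mulr0 k).
  rewrite -[in X in _ = _ + X](hc w wW) mulr_sumr -big_split /=.
  apply: eq_bigr => t _; rewrite !ffunE /GRing.scale /= mulrDl mulrDr; congr (_ + _).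
  by rewrite -mulrA mulrCA.
have : (U == U + <[c]>)%VS.
  by rewrite eqEdim addvSl /= -(leq_add2r (\dim W)) dE.
by move=> /eqP->; apply: (subvP (addvSr _ _)); apply: memv_line.
Qed.

End Perp.

Section SphereHilbert.
Variables (V : finType) (D : {set {set V}}) (d : nat).
Hypothesis hD : sphere d D.
Variables (K : fieldType) (f : {rmorphism 'F_2 -> K}) (a : nat -> V -> K).
Hypothesis generic : forall F, F \in D -> exists b, independent_on a F b.

Lemma lform_regular k (y : {mpoly K[#|V|]}) : (k < d)%N ->
  in_ideal D a k (lform (a k) * y) -> in_ideal D a k y.
Proof.
move=> kd [z hz].
have [|u _ hu] := stanley_reisner_regular hD f generic kd (y := y) (z := z) I (fun=> I).
  exact: hz.
by exists u.
Qed.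

Lemma hilb_sphere B i : (i < B)%N -> (hilb D a B d i)%:Z = (hilb_poly D d)`_i.
Proof.
have dD := sphere_down_closed hD.
apply: (diffs_hilb_poly hD (H := fun k i => (hilb D a B k i)%:Z)) => [j jB|k|k j kd jB].
- by rewrite hilb0 size_face_monomials // -natz natr_sum; apply: eq_bigr => F _; rewrite natz.
- by rewrite hilb_deg0.
rewrite (hilb_regular dD jB (k := k)) ?PoszD ?addrK // => y _.
exact: lform_regular.
Qed.

End SphereHilbert.

Section PoincareDuality.
Variables (V : finType) (D : {set {set V}}) (d : nat).
Hypothesis hD : sphere d D.
Variables (K : fieldType) (f : {rmorphism 'F_2 -> K}) (a : nat -> V -> K).
Hypothesis generic : forall F, F \in D -> exists b, independent_on a F b.
Variables (p : nat -> K) (pt : {set V} -> V -> K) (dual : {set V} -> V -> nat -> K).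
Variable vol : {set V} -> K.
Hypothesis data : facet_data D d a p pt dual vol.
Local Notation poly := {mpoly K[#|V|]}.
Local Notation B := d.+2.
Local Notation mon := 'X_{1..#|V| < B}.
Local Notation Y := {ffun mon -> K^o}.
Local Notation Z := {ffun {set V} -> K^o}.
Local Notation is_facet := (is_facet D d).
Local Notation deg := (deg D d pt vol).
Local Notation coefs := (coefs D B).
Local Notation sr_space := (sr_space K D B).
Local Notation ideal_space := (ideal_space D a B).
Local Notation hilb := (hilb D a B d).
Local Notation weight := (weight pt vol).
Local Notation ev := (ev pt).
Implicit Types (F G S : {set V}) (q y : poly) (i j : nat).

Let dD : down_closed D := sphere_down_closed hD.

Lemma char2_addrr (x : K) : x + x = 0.
Proof.
have : f (1 + 1) = 0 by rewrite (_ : 1 + 1 = 0 :> 'F_2) ?rmorph0 //; apply: val_inj.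
by rewrite rmorphD rmorph1 => h; rewrite -[x]mulr1 -mulrDr h mulr0.
Qed.

Let K2 := char2_addrr.

Lemma ev_sr F q : is_facet F -> sr_ideal D q -> ev F q = 0.
Proof.
move=> hF hq; rewrite (mpolyE q) /Submission.ev raddf_sum big_seq big1 // => m hm /=.
rewrite mevalZ -/(Submission.ev pt F _) (ev_monomial_out data hF) ?mulr0 //.
apply: contraL hm => /(dD (andP hF).1) /hq; by rewrite -mcoeff_eq0 => ->.
Qed.

Lemma deg_mul_nonface y m : msup m \notin D -> deg (y * 'X_[m]) = 0.
Proof.
move=> mD; apply: (deg_sr hD data) => m' mD'.
rewrite mulrC mcoeffXM; case: ifP => // mm'; case/negP: mD.
by apply: (dD mD'); rewrite -(submK mm') msupD subsetUr.
Qed.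

Definition facet_values (c : Y) : Z :=
  [ffun F : {set V} => if is_facet F then ev F (of_coefs c) else 0].

Fact facet_values_is_linear : linear facet_values.
Proof.
move=> e c c'; apply/ffunP => F; rewrite !ffunE linearP /=.
case: ifP => _; last by rewrite scaler0 addr0.
by rewrite /Submission.ev mevalD mevalZ.
Qed.
HB.instance Definition _ :=
  GRing.isLinear.Build K Y Z *:%R facet_values facet_values_is_linear.

Lemma facet_values_coefs i y F : (i < B)%N -> y \is i.-homog -> is_facet F ->
  facet_values (coefs y) F = ev F y.
Proof.
move=> iB hy hF; rewrite ffunE hF; apply/eqP; rewrite -subr_eq0.
rewrite /Submission.ev -mevalB -/(Submission.ev pt F _) (ev_sr hF) //.
exact: (of_coefs_coefs iB hy).
Qed.

(* Values on the facets of the polynomials of degree less than i. *)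
Fixpoint value_space i : {vspace Z} :=
  if i is i'.+1 then (value_space i' + linfun facet_values @: sr_space i')%VS else 0%VS.

Lemma value_space_mem i j y : (i < B)%N -> y \is i.-homog -> (i < j)%N ->
  facet_values (coefs y) \in value_space j.
Proof.
move=> iB hy; elim: j => // j IH; rewrite ltnS leq_eqVlt => /orP[/eqP ij|ij] /=.
  apply: (subvP (addvSr _ _)); rewrite -lfunE; apply: memv_img; rewrite -ij.
  exact: coefs_sr_space.
by apply: (subvP (addvSl _ _)); apply: IH.
Qed.

Lemma value_space_poly i u : u \in value_space i ->
  exists2 q, (msize q <= i)%N & forall F, is_facet F -> u F = ev F q.
Proof.
elim: i u => [|i IH] u /=.
  rewrite memv0 => /eqP->; exists 0; first by rewrite msize0.
  by move=> F hF; rewrite ffunE /Submission.ev meval0.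
move=> /memv_addP[u1 /IH[q1 s1 e1] [_ /memv_imgP[c hc ->] ->]].
exists (q1 + of_coefs c).
  apply: (leq_trans (msizeD_le _ _)); rewrite geq_max leqW //=.
  have hom := of_coefs_homog hc; rewrite msizeE; apply/bigmax_leqP_seq => m hm _.
  by have /= -> := dhomog_mf hom hm.
by move=> F hF; rewrite ffunE e1 // lfunE /= ffunE hF /Submission.ev mevalD.
Qed.

Lemma value_space_supp i : (value_space i <= <<map (@delta _ K) (enum is_facet)>>)%VS.
Proof.
elim: i => [|i IH] /=; first exact: sub0v.
rewrite subv_add IH; apply/subvP => _ /memv_imgP[c _ ->]; rewrite lfunE /=.
by apply/span_deltaP => F; rewrite ffunE mem_enum; case: ifP; rewrite ?eqxx.
Qed.

(** On every facet theta_j takes the value p_j, so a multiple of it in degree i has the values of a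
    polynomial of degree i - 1. Each step of the filtration therefore adds at most [hilb i]
    dimensions. *)
Let preim_sub i : (i < B)%N ->
  (ideal_space d i <= sr_space i :&: linfun facet_values @^-1: value_space i)%VS.
Proof.
move=> iB; rewrite subv_cap ideal_space_sub /=; apply/span_subvP.
move=> z /allpairsP[[j m] /= [jd hm] ->] {z}.
have {}jd : (j < d)%N by rewrite mem_iota in jd.
have mi : (mdeg m).+1 = i by move: hm; rewrite mem_filter => /andP[/eqP].
rewrite -memv_preim lfunE /=.
have hX : ('X_[val m] : poly) \is (mdeg m).-homog by rewrite dhomogX.
have hlX : lform (a j) * 'X_[val m] \is i.-homog.
  by rewrite -mi; apply: lform_homogM.
have mB : (mdeg m < B)%N by exact: bmdeg.
have -> : facet_values (coefs (lform (a j) * 'X_[val m])) = p j *: facet_values (coefs 'X_[val m]).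
  apply/ffunP => F; rewrite [RHS]ffunE; have [hF|hF] := boolP (is_facet F); last first.
    by rewrite !ffunE (negPf hF) scaler0.
  rewrite (facet_values_coefs iB hlX hF) (facet_values_coefs mB hX hF) evM ev_lform.
  by rewrite (pt_form data).
by apply: rpredZ; apply: (value_space_mem mB hX); rewrite mi.
Qed.

Let value_space_step i : (i < B)%N -> (\dim (value_space i.+1) <= \dim (value_space i) + hilb i)%N.
Proof.
move=> iB; have := dim_add_img (linfun facet_values) (sr_space i) (value_space i).
have := dimvS (preim_sub iB); have := dimvS (ideal_space_sub D a B d i).
rewrite /Submission.hilb /=.
move: (\dim (ideal_space _ _)) (\dim (sr_space _)) (\dim (_ + _)) (\dim (_ :&: _)).
by move: (\dim (value_space i)) => *; lia.
Qed.

Let nfacets := size (enum is_facet).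

(** The squarefree monomial of a facet vanishes at the points of all other facets, so polynomials of
    degree d already separate the facets. *)
Let full_value_space : (nfacets <= \dim (value_space d.+1))%N.
Proof.
rewrite /nfacets -(dim_span_delta K (enum_uniq is_facet)); apply: dimvS.
apply/span_subvP => z /mapP[F hF ->] {z}.
have {}hF : is_facet F by rewrite mem_enum in hF.
have hX : ('X_[mset F] : poly) \is d.-homog.
  by rewrite dhomogX /= mdeg_mset; case/andP: hF.
have nz : ev F 'X_[mset F] != 0.
  by rewrite evX_mset; apply/prodf_neq0 => v vF; rewrite (pt_neq0 data).
have dB : (d < B)%N by [].
suff -> : delta K F = (ev F 'X_[mset F])^-1 *: facet_values (coefs 'X_[mset F]).
  by apply: rpredZ; apply: (value_space_mem dB hX).
apply/ffunP => G; rewrite ffunE [RHS]ffunE.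
have [->|GF] := eqVneq G F.
  by rewrite (facet_values_coefs dB hX hF) /GRing.scale /= mulVf.
have [hG|hG] := boolP (is_facet G); last by rewrite ffunE (negPf hG) scaler0.
rewrite (facet_values_coefs dB hX hG) (ev_monomial_out data hG) ?scaler0 //.
rewrite msup_mset; apply: contra GF => FG; rewrite eq_sym eqEcard FG.
by case/andP: hF => _ /eqP->; case/andP: hG => _ /eqP->; rewrite leqnn.
Qed.

Lemma hilb_sum : (\sum_(0 <= j < d.+1) hilb j = nfacets)%N.
Proof.
apply/eqP; rewrite -eqz_nat big_mkord -natz natr_sum.
have -> : nfacets = #|[set F in D | #|F| == d]|.
  by rewrite /nfacets -cardE; apply: eq_card => F; rewrite !inE.
rewrite -(hilb_poly_sum hD); apply/eqP/eq_bigr => j _.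
by rewrite natz; apply: (hilb_sphere hD f generic); apply: ltnW (ltn_ord j).
Qed.

Let value_space_up i j : (i <= j)%N -> (j <= B)%N ->
  (\dim (value_space j) <= \dim (value_space i) + \sum_(i <= l < j) hilb l)%N.
Proof.
elim: j => [|j IH] ij jB.
  by move: ij; rewrite leqn0 => /eqP->; rewrite big_geq ?addn0.
move: ij; rewrite leq_eqVlt => /orP[/eqP->|ij]; first by rewrite big_geq ?addn0.
rewrite big_nat_recr //= addnA; apply: (leq_trans (value_space_step jB)).
by rewrite leq_add2r; apply: IH => //; apply: ltnW.
Qed.

(** The upper bounds for the steps add up to the number of facets, and this total is attained; hence
    every bound is attained. *)
Lemma dim_value_space i : (i <= d.+1)%N -> \dim (value_space i) = (\sum_(0 <= j < i) hilb j)%N.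
Proof.
move=> id; apply/eqP; rewrite eqn_leq; apply/andP; split.
  by have := @value_space_up 0 i (leq0n i) (leqW id); rewrite dimv0.
have := leq_trans full_value_space (value_space_up id (leqnSn _)).
rewrite -hilb_sum (@big_cat_nat _ _ _ i 0 d.+1) //=.
by rewrite leq_add2r.
Qed.

Lemma value_space_inj i y : (i <= d)%N -> y \is i.-homog ->
  facet_values (coefs y) \in value_space i -> in_ideal D a d y.
Proof.
move=> id hy hv; have iB : (i < B)%N by rewrite ltnS ltnW.
have E := dim_add_img (linfun facet_values) (sr_space i) (value_space i).
have s1 := dim_value_space (leqW id); have s2 := dim_value_space (id : i < d.+1)%N.
rewrite big_nat_recr //= -s1 in s2; rewrite s2 in E.
have h1 := dimvS (ideal_space_sub D a B d i).
have : (ideal_space d i == sr_space i :&: linfun facet_values @^-1: value_space i)%VS.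
  rewrite eqEdim preim_sub //=; move: E h1; rewrite /Submission.hilb.
  move: (\dim (ideal_space _ _)) (\dim (sr_space _)) (\dim (value_space _)) (\dim (_ :&: _)).
  by move=> *; lia.
move=> /eqP E'; apply/(ideal_spaceP a dD d iB hy).
by rewrite E' memv_cap coefs_sr_space //= -memv_preim lfunE.
Qed.

Lemma deg_values q q' u w : (forall F, is_facet F -> u F = ev F q) ->
  (forall F, is_facet F -> w F = ev F q') ->
  \sum_(F <- enum is_facet) weight F * (u F * w F) = deg (q * q').
Proof.
move=> hu hw; rewrite big_enum_cond /=; apply: eq_big => F; first by rewrite andbT.
by rewrite andbT => hF; rewrite hu // hw // evM.
Qed.

Lemma value_space_perp i j u w : (i + j <= d.+1)%N ->
  u \in value_space i -> w \in value_space j ->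
  \sum_(F <- enum is_facet) weight F * (u F * w F) = 0.
Proof.
move=> ij /value_space_poly[q sq eq] /value_space_poly[q' sq' eq'].
rewrite (deg_values eq eq') (mpolyE q) mulr_suml linear_sum big_seq big1 // => m hm.
rewrite (mpolyE q') mulr_sumr linear_sum big_seq big1 // => m' hm' /=.
rewrite -scalerAl -scalerAr !linearZ /= -mpolyXD (deg_low hD K2 data) ?mulr0 //.
have := leq_trans (msize_mdeg_lt hm) sq; have := leq_trans (msize_mdeg_lt hm') sq'.
by rewrite mdegD; move: (mdeg m) (mdeg m') => *; lia.
Qed.

Let weight_neq0 F : F \in enum is_facet -> weight F != 0.
Proof.
rewrite mem_enum => hF; rewrite invr_eq0 mulf_neq0 ?(vol_neq0 data) //.
by apply/prodf_neq0 => v vF; rewrite (pt_neq0 data).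
Qed.

Lemma hilb_moment : (2 * \sum_(0 <= j < d.+1) j * hilb j = d * nfacets)%N.
Proof.
apply/eqP; rewrite -eqz_nat -hilb_sum !PoszM.
have := hilb_poly_moment hD; rewrite sumrMnl mulrC -mulr_natl natz => E.
have E' : \sum_(i < d.+1) (hilb_poly D d)`_i = (\sum_(0 <= j < d.+1) hilb j)%N%:Z.
  rewrite big_mkord -natz natr_sum; apply: eq_bigr => i _.
  by rewrite natz (hilb_sphere hD f generic) //; apply: ltnW (ltn_ord i).
have E2 : \sum_(i < d.+1) (hilb_poly D d)`_i * i%:Z = (\sum_(0 <= j < d.+1) j * hilb j)%N%:Z.
  rewrite big_mkord -natz natr_sum; apply: eq_bigr => i _.
  by rewrite natz PoszM mulrC (hilb_sphere hD f generic) //; apply: ltnW (ltn_ord i).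
by rewrite -E' -E2 E.
Qed.

(** Orthogonality gives one inequality for each i. By [hilb_moment] their sum over all i is an
    equality, so each of them is. *)
Lemma dim_value_spaceC i : (i <= d.+1)%N ->
  (\dim (value_space i) + \dim (value_space (d.+1 - i)) = nfacets)%N.
Proof.
move=> id.
have le (l : 'I_d.+2) : (\dim (value_space l) + \dim (value_space (d.+1 - l)) <= nfacets
    ?= iff (\dim (value_space l) + \dim (value_space (d.+1 - l)) == nfacets))%N.
  split=> //.
  apply: (@perp_dim _ _ _ _ weight_neq0 (value_space l)
    (value_space (d.+1 - l)) (value_space_supp _) (value_space_supp _)).
  by move=> u w; apply: value_space_perp; have := ltn_ord l; lia.
have := leqif_sum (fun l (_ : predT l) => le l); case=> _.
rewrite sum_nat_const card_ord big_split /=.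
have -> : (\sum_(l < d.+2) \dim (value_space (d.+1 - l)) = \sum_(l < d.+2) \dim (value_space l))%N.
  by rewrite (reindex_inj rev_ord_inj) /=; apply: eq_bigr => l _; congr (\dim (value_space _)); have := ltn_ord l; lia.
have -> : (\sum_(l < d.+2) \dim (value_space l) = \sum_(0 <= j < d.+1) (d.+1 - j) * hilb j)%N.
  rewrite [RHS]big_mkord.
  transitivity (\sum_(l < d.+2) \sum_(j < d.+1 | (j < l)%N) hilb j)%N.
    apply: eq_bigr => l _; have ld : (l <= d.+1)%N by rewrite -ltnS.
    by rewrite (dim_value_space ld) big_mkord (big_ord_widen d.+1 (fun j => hilb j)).
  rewrite (exchange_big_dep predT) //=; apply: eq_bigr => j _.
  rewrite sum_nat_const; congr (_ * _)%N; rewrite -sum1_card.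
  rewrite -(big_mkord (fun l => (j < l)%N) (fun=> 1%N)) (@big_cat_nat _ _ _ j.+1) //=; last first.
    by rewrite ltnS; apply: ltnW.
  rewrite big_nat_cond big_pred0 ?add0n; last by move=> l /=; rewrite ltnS; case: leqP; rewrite ?andbF.
  rewrite big_nat_cond (eq_bigl (fun l => (j < l < d.+2)%N && true)) => [|l]; last first.
    by rewrite andbT; case: (j < l)%N => //; rewrite ?andbT ?andbF.
  by rewrite -big_nat_cond sum_nat_const_nat muln1.
have := hilb_moment; have := hilb_sum.
have -> : (\sum_(0 <= j < d.+1) (d.+1 - j) * hilb j =
   d.+1 * (\sum_(0 <= j < d.+1) hilb j) - \sum_(0 <= j < d.+1) j * hilb j)%N.
  rewrite big_distrr /= !big_mkord -sumnB => [|j _].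
    by apply: eq_bigr => j _; rewrite mulnBl.
  by rewrite leq_mul2r ltnW ?orbT.
move: (\sum_(0 <= j < d.+1) hilb j)%N (\sum_(0 <= j < d.+1) j * hilb j)%N => s1 s2 -> s2E.
have -> : ((d.+1 * nfacets - s2) + (d.+1 * nfacets - s2) == d.+2 * nfacets)%N.
  by apply/eqP; nia.
by move=> /esym/forallP/(_ (Ordinal (id : i < d.+2)%N)) /eqP.
Qed.

Lemma hilb_sym i : (i <= d)%N -> hilb i = hilb (d - i).
Proof.
move=> id; have := dim_value_spaceC (leqW id); have := dim_value_spaceC (id : i < d.+1)%N.
rewrite subSS [(d.+1 - i)%N]subSn // !dim_value_space ?ltnS ?leq_subr //; last first.
- by lia.
- by lia.
rewrite !big_nat_recr //=; move: (bigop.body _ _ _) (bigop.body _ _ _) (hilb i) (hilb _) => *; lia.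
Qed.

(** Such a y is orthogonal to all polynomials of degree at most d - i, so its values lie in the
    orthogonal of [value_space (d.+1 - i)], which by dimension is [value_space i]. By
    [value_space_inj], having the values of a polynomial of lower degree forces y into the ideal. *)
Theorem poincare_duality i y : (i <= d)%N -> y \is i.-homog ->
  (forall m, mdeg m = (d - i)%N -> deg (y * 'X_[m]) = 0) -> in_ideal D a d y.
Proof.
move=> id hy h; apply: (value_space_inj id hy).
have iB : (i < B)%N by rewrite ltnS ltnW.
apply: (@perp_mem _ _ _ _ weight_neq0 _ (value_space (d.+1 - i))).
- exact: value_space_supp.
- exact: value_space_supp.
- by move=> u w; apply: value_space_perp; rewrite subnKC // leqW.
- by rewrite dim_value_spaceC // leqW.
- exact: (subvP (value_space_supp i.+1) _ (value_space_mem iB hy (ltnSn i))).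
move=> w /value_space_poly[q sq eq].
rewrite (deg_values (fun F => facet_values_coefs iB hy) eq).
rewrite (mpolyE q) mulr_sumr linear_sum big_seq big1 // => m hm.
rewrite -scalerAr linearZ /=; have mi : (mdeg m <= d - i)%N.
  by have := leq_trans (msize_mdeg_lt hm) sq; rewrite subSn.
move: mi; rewrite leq_eqVlt => /orP[/eqP/h ->|mi]; first by rewrite mulr0.
rewrite (deg_homog_low hD K2 data (i := (i + mdeg m)%N)) ?mulr0 //; last by lia.
by apply: dhomogM => //; rewrite dhomogX.
Qed.

(** * Functionals represented by the degree map *)

Section Functional.
Variables (e : nat) (mu : 'X_{1..#|V|} -> K).
Hypothesis mu_nonface : forall m, mdeg m = e -> msup m \notin D -> mu m = 0.
Hypothesis mu_form : forall k m, (k < d)%N -> (mdeg m).+1 = e ->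
  \sum_v a k v * mu (mvar v + m)%MM = 0.

Let functional (w : Y) : K^o := \sum_(m <- face_monomials D B e) mu m * w m.

Fact functional_is_linear : linear functional.
Proof.
move=> c w w'; rewrite /functional scaler_sumr -big_split; apply: eq_bigr => m _ /=.
by rewrite !ffunE /GRing.scale /= mulrDr mulrCA.
Qed.
HB.instance Definition _ := GRing.isLinear.Build K Y K^o *:%R functional functional_is_linear.

Lemma functional_ideal w : (e < B)%N -> w \in ideal_space d e ->
  \sum_(m <- face_monomials D B e) mu m * w m = 0.
Proof.
move=> eB hw; suff sub : (ideal_space d e <= lker (linfun functional))%VS.
  by have := subvP sub _ hw; rewrite memv_ker lfunE /= => /eqP.
apply/span_subvP => z /allpairsP[[j m] /= [jd hm] ->] {z}.
have {}jd : (j < d)%N by rewrite mem_iota in jd.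
have me : (mdeg m).+1 = e by move: hm; rewrite mem_filter => /andP[/eqP].
rewrite memv_ker lfunE /=; apply/eqP; rewrite -[RHS](mu_form jd me) /functional.
transitivity (\sum_(m' : mon | (msup m' \in D) && (mdeg m' == e))
    mu m' * (lform (a j) * 'X_[val m])@_m').
  rewrite /face_monomials big_filter big_enum_cond /=; apply: eq_bigr => m' /andP[mD _].
  by rewrite ffunE mD.
under eq_bigr do rewrite mcoeff_lformM mulr_sumr.
rewrite exchange_big /=; apply: eq_bigr => v _.
have vmB : (mdeg (mvar v + val m)%MM < B)%N by rewrite mdegD mdeg1 add1n me.
have [vD|vD] := boolP (msup (mvar v + val m)%MM \in D); last first.
  rewrite (mu_nonface _ vD) ?mulr0; last by rewrite mdegD mdeg1 add1n.
  apply: big1 => m' /andP[mD _]; case: ifP; rewrite ?mulr0 // => vm.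
  rewrite mcoeffX; case: eqP; rewrite ?mulr0 // => E; case/negP: vD.
  by rewrite /= E addmC submK.
rewrite (bigD1 (BMultinom vmB)) /=; last by rewrite vD mdegD mdeg1 add1n me eqxx.
have E2 : (mvar v + val m - mvar v)%MM = val m by rewrite addmC addmK.
rewrite [X in _ + X]big1 => [|m' /andP[_ hm']].
  by rewrite addr0 lem_addr E2 mcoeffX eqxx mulr1 mulrC.
case: ifP; rewrite ?mulr0 // => vm; rewrite mcoeffX; case: eqP; rewrite ?mulr0 // => E.
by case/eqP: hm'; apply: val_inj => /=; rewrite E addmC submK.
Qed.

(** The quotient by the d forms is zero in degree d + 1, as the h-polynomial has degree at most
    d. *)
Lemma functional_above : e = d.+1 -> forall m, mdeg m = e -> mu m = 0.
Proof.
move=> ed m me; have [mD|] := boolP (msup m \in D); last exact: mu_nonface.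
have eB : (e < B)%N by rewrite ed.
have h0 : hilb e = 0%N.
  apply/eqP; rewrite -eqz_nat (hilb_sphere hD f generic) // nth_default //.
  by rewrite ed; apply: size_hilb_poly.
have E : (ideal_space d e == sr_space e)%VS.
  by rewrite eqEdim ideal_space_sub; move/eqP: h0; rewrite /Submission.hilb subn_eq0.
have mB : (mdeg m < B)%N by rewrite me.
have := functional_ideal (w := delta K (BMultinom mB)) eB; rewrite (eqP E).
have mem : BMultinom mB \in face_monomials D B e.
  by rewrite mem_filter mD /= me eqxx mem_enum.
rewrite memv_span ?map_f // => /(_ isT) <-.
rewrite (bigD1_seq (BMultinom mB)) //=; last exact/filter_uniq/enum_uniq.
rewrite ffunE eqxx mulr1 big1 ?addr0 // => m' hm'.
by rewrite ffunE (negPf hm') mulr0.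
Qed.

Let dual_map (c : Y) : Y := [ffun m : mon =>
  if m \in face_monomials D B e then deg (of_coefs c * 'X_[m]) else 0].

Fact dual_map_is_linear : linear dual_map.
Proof.
move=> r c c'; apply/ffunP => m; rewrite !ffunE; case: ifP => _; last first.
  by rewrite scaler0 addr0.
by rewrite linearP /= mulrDl -scalerAl linearP.
Qed.
HB.instance Definition _ := GRing.isLinear.Build K Y Y *:%R dual_map dual_map_is_linear.

(** By duality the pairing embeds degree d - e of the quotient into the dual of degree e. The
    dimensions agree by [hilb_sym], so every functional is reached. *)
Theorem degree_representation : (e <= d)%N ->
  exists2 z : poly, z \is (d - e).-homog & forall m, mdeg m = e -> deg (z * 'X_[m]) = mu m.
Proof.
move=> ed; have eB : (e < B)%N by rewrite ltnS ltnW.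
have deB : (d - e < B)%N by lia.
pose U := (linfun dual_map @: sr_space (d - e))%VS.
have uS : uniq (face_monomials D B e) by apply/filter_uniq/enum_uniq.
have wt0 t : t \in face_monomials D B e -> (1 : K) != 0 by rewrite oner_neq0.
have sU : (U <= sr_space e)%VS.
  apply/subvP => z /memv_imgP[c _ ->] {z}; rewrite lfunE /=; apply/span_deltaP => m.
  by rewrite ffunE; case: ifP; rewrite ?eqxx.
have perp u w : u \in U -> w \in ideal_space d e ->
    \sum_(t <- face_monomials D B e) 1 * (u t * w t) = 0.
  move=> /memv_imgP[c hc ->] hw; have hw' := subvP (ideal_space_sub D a B d e) _ hw.
  have wE : of_coefs w = \sum_(t <- face_monomials D B e) w t *: ('X_[val t] : poly).
    rewrite big_uniq //= [RHS]big_mkcond /=; apply: eq_bigr => m _; case: ifPn => // hm.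
    have -> : w m = 0 by apply: contraNeq hm => /(span_deltaP _ _ hw').
    by rewrite scale0r.
  have hwI : in_ideal D a d (of_coefs w).
    apply/(ideal_spaceP a dD d eB (of_coefs_homog hw')).
    by rewrite (of_coefsK hw').
  have dE : of_coefs c * of_coefs w \is d.-homog.
    by have := dhomogM (of_coefs_homog hc) (of_coefs_homog hw'); rewrite subnK.
  rewrite -[RHS](deg_in_ideal hD K2 data dE (in_idealM dD _ hwI)) wE mulr_sumr linear_sum.
  apply: eq_big_seq => t tS; rewrite mul1r lfunE /= ffunE tS.
  by rewrite -scalerAr linearZ /= mulrC.
have dimU : (hilb e <= \dim U)%N.
  have := limg_ker_dim (linfun dual_map) (sr_space (d - e)); rewrite -/U.
  have : (\dim (sr_space (d - e) :&: lker (linfun dual_map)) <= \dim (ideal_space d (d - e)))%N.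
    apply: dimvS; apply/subvP => c; rewrite memv_cap memv_ker lfunE /= => /andP[hc /eqP c0].
    have hom := of_coefs_homog hc.
    rewrite -(of_coefsK hc); apply/(ideal_spaceP a dD d deB hom).
    apply: (poincare_duality (leq_subr _ _) hom) => m; rewrite subKn // => me.
    have [mD|mD] := boolP (msup m \in D); last first.
      exact: deg_mul_nonface.
    have mB : (mdeg m < B)%N by rewrite me.
    have := congr1 (fun c : Y => c (BMultinom mB)) c0.
    by rewrite !ffunE ifT // mem_filter mD /= me eqxx mem_enum.
  rewrite (hilb_sym ed) /Submission.hilb.
  move: (\dim U) (\dim (ideal_space _ _)) (\dim (_ :&: _)) (\dim (sr_space _)) => *; lia.
have dimE : (\dim U + \dim (ideal_space d e) = size (face_monomials D B e))%N.
  apply/eqP; rewrite eqn_leq (perp_dim wt0 sU (ideal_space_sub D a B d e) perp) /=.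
  have := dimvS (ideal_space_sub D a B d e); move: dimU; rewrite /Submission.hilb dim_sr_space.
  move: (\dim U) (\dim (ideal_space _ _)) (size _) => *; lia.
pose c0 : Y := [ffun m : mon => if m \in face_monomials D B e then mu m else 0].
have : c0 \in U.
  apply: (perp_mem wt0 sU (ideal_space_sub D a B d e) perp dimE).
    by apply/span_deltaP => m; rewrite ffunE; case: ifP; rewrite ?eqxx.
  move=> w hw; rewrite -[RHS](functional_ideal eB hw); apply: eq_big_seq => t tS.
  by rewrite ffunE tS mul1r.
move=> /memv_imgP[c hc cE]; exists (of_coefs c); first exact: of_coefs_homog hc.
move=> m me; have [mD|mD] := boolP (msup m \in D); last first.
  by rewrite mu_nonface // deg_mul_nonface.
have mB : (mdeg m < B)%N by rewrite me.
have := congr1 (fun c : Y => c (BMultinom mB)) cE.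
by rewrite lfunE /= !ffunE ifT // mem_filter mD /= me eqxx mem_enum.
Qed.
End Functional.

End PoincareDuality.

(** * A field with derivations *)

Definition derivation (A : comNzRingType) (D : A -> A) : Prop :=
  (forall x y, D (x + y) = D x + D y) /\
  (forall x y, D (x * y) = D x * y + x * D y).

Section Derivation.
Variables (A : comNzRingType) (D : A -> A).
Hypothesis hD : derivation D.

Lemma derD x y : D (x + y) = D x + D y. Proof. exact: hD.1. Qed.
Lemma derM x y : D (x * y) = D x * y + x * D y. Proof. exact: hD.2. Qed.

Lemma der0 : D 0 = 0.
Proof. by apply: (addrI (D 0)); rewrite -derD !addr0. Qed.

Lemma derN x : D (- x) = - D x.
Proof. by apply: (addrI (D x)); rewrite -derD !subrr der0. Qed.

Lemma der1 : D 1 = 0.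
Proof. by apply: (addrI (D 1)); rewrite addr0 -{3}[1]mulr1 derM mulr1 mul1r. Qed.

Lemma der_sum (I : Type) (r : seq I) (P : pred I) (F : I -> A) :
  D (\sum_(i <- r | P i) F i) = \sum_(i <- r | P i) D (F i).
Proof. exact: (big_morph D derD der0). Qed.

Lemma der_prod0 (I : Type) (r : seq I) (P : pred I) (F : I -> A) :
  (forall i, P i -> D (F i) = 0) -> D (\prod_(i <- r | P i) F i) = 0.
Proof.
move=> h; elim/big_rec: _ => [|i x Pi hx]; first exact: der1.
by rewrite derM h // hx mul0r mulr0 addr0.
Qed.

Lemma der_mul0 x y : D x = 0 -> D (x * y) = x * D y.
Proof. by move=> h; rewrite derM h mul0r add0r. Qed.

Lemma der_det0 n (M : 'M[A]_n) : (forall i j, D (M i j) = 0) -> D (\det M) = 0.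
Proof.
move=> h; rewrite der_sum big1 // => s _; rewrite derM (_ : D _ = 0).
  by rewrite mul0r add0r der_prod0 ?mulr0.
by case: perm.odd_perm; rewrite ?expr1 ?expr0 ?derN der1 ?oppr0.
Qed.

End Derivation.

(** What makes the quotient rule independent of the chosen fraction. *)
Lemma quotient_rule (A : comNzRingType) (p q r s p' q' r' s' : A) :
  p * s = r * q -> p' * s + p * s' = r' * q + r * q' ->
  (p' * q - p * q') * s ^+ 2 = (r' * s - r * s') * q ^+ 2.
Proof.
move=> E1 E2; apply/eqP; rewrite -subr_eq0; apply/eqP.
transitivity (q * s * (p' * s + p * s' - (r' * q + r * q')) -
              (p * s - r * q) * (q' * s + q * s')); first by ring.
by rewrite E1 E2 !subrr mul0r mulr0 subr0.
Qed.

Section FractionSum.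
Variable A : fieldType.
Variables (n d n' d' p q p' q' : A).
Hypotheses (d0 : d != 0) (d0' : d' != 0).

Lemma fraction_sum : n / d + n' / d' = (n * d' + n' * d) / (d * d').
Proof. by field; rewrite ?d0 ?d0'. Qed.

Lemma fraction_prod : n / d * (n' / d') = (n * n') / (d * d').
Proof. by field; rewrite ?d0 ?d0'. Qed.

Lemma fraction_sum_der :
  ((p * d' + n * q' + (p' * d + n' * q)) * (d * d') -
   (n * d' + n' * d) * (q * d' + d * q')) / (d * d') ^+ 2 =
  (p * d - n * q) / d ^+ 2 + (p' * d' - n' * q') / d' ^+ 2.
Proof. by field; rewrite ?d0 ?d0'. Qed.

Lemma fraction_prod_der :
  ((p * n' + n * p') * (d * d') - n * n' * (q * d' + d * q')) / (d * d') ^+ 2 =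
  (p * d - n * q) / d ^+ 2 * (n' / d') + n / d * ((p' * d' - n' * q') / d' ^+ 2).
Proof. by field; rewrite ?d0 ?d0'. Qed.

End FractionSum.

Section FractionDerivation.
Variable R : idomainType.
Local Notation "x %:F" := (@FracField.tofrac R x).
Local Notation K := {fraction R}.

Lemma mul_denom (x : K) : x * (frac (repr x)).2%:F = (frac (repr x)).1%:F.
Proof.
suff E r : (\pi_K%qT r : K) * (frac r).2%:F = (frac r).1%:F by rewrite -{1}[x]reprK E.
have r0 := denom_ratioP r; rewrite !piE; apply/eqmodP.
rewrite /= FracField.equivfE /FracField.mulf.
by rewrite !numden_Ratio ?mulr1 ?mul1r ?mulf_neq0 ?oner_neq0 // mulrC.
Qed.

Lemma fraction_numden (x : K) : exists n d, d != 0 /\ x = n%:F / d%:F.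
Proof.
exists (frac (repr x)).1, (frac (repr x)).2; split; first exact: denom_ratioP.
by rewrite -mul_denom mulfK // tofrac_eq0; apply: denom_ratioP.
Qed.

Lemma derivation_eq0 (E : K -> K) : derivation E -> (forall x, E x%:F = 0) -> E =1 fun=> 0.
Proof.
move=> hE h x; have [n [d [d0 ->]]] := fraction_numden x.
have d0' : d%:F != 0 by rewrite tofrac_eq0.
apply: (mulIf d0'); rewrite mul0r.
have := derM hE (n%:F / d%:F) d%:F.
by rewrite divfK // !h mulr0 addr0.
Qed.

Variable D : R -> R.
Hypothesis hD : derivation D.

Definition fraction_der (x : K) : K :=
  let n := (frac (repr x)).1 in let d := (frac (repr x)).2 in
  ((D n)%:F * d%:F - n%:F * (D d)%:F) / d%:F ^+ 2.

Lemma fraction_derE n d : d != 0 ->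
  fraction_der (n%:F / d%:F) = ((D n)%:F * d%:F - n%:F * (D d)%:F) / d%:F ^+ 2.
Proof.
move=> d0; rewrite /fraction_der; set x := (n%:F / d%:F).
set n' := (frac (repr x)).1; set d' := (frac (repr x)).2.
have d0' : d' != 0 by apply: denom_ratioP.
have E : x * d'%:F = n'%:F := mul_denom x.
have E1 : n * d' = n' * d.
  by apply/eqP; rewrite -tofrac_eq !tofracM -E mulrAC divfK ?tofrac_eq0.
have E2 : D n * d' + n * D d' = D n' * d + n' * D d by rewrite -!(derM hD) E1.
have f0 : d%:F != 0 by rewrite tofrac_eq0.
have f0' : d'%:F != 0 by rewrite tofrac_eq0.
have {}E1 : n%:F * d'%:F = n'%:F * d%:F by rewrite -!tofracM E1.
have {}E2 : (D n)%:F * d'%:F + n%:F * (D d')%:F = (D n')%:F * d%:F + n'%:F * (D d)%:F.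
  by rewrite -!tofracM -!tofracD E2.
apply/eqP; rewrite eqr_div ?expf_neq0 //; apply/eqP.
exact: esym (quotient_rule E1 E2).
Qed.

Lemma fraction_der_tofrac x : fraction_der x%:F = (D x)%:F.
Proof.
have := @fraction_derE x 1 (oner_neq0 _).
by rewrite tofrac1 divr1 expr1n divr1 mulr1 (der1 hD) tofrac0 mulr0 subr0.
Qed.

Lemma fraction_der_derivation : derivation fraction_der.
Proof.
split=> x y; have [n [d [d0 ->]]] := fraction_numden x;
  have [n' [d' [d0' ->]]] := fraction_numden y;
  have f0 : d%:F != 0 by [rewrite tofrac_eq0]; have f0' : d'%:F != 0 by rewrite tofrac_eq0.
- have -> : n%:F / d%:F + n'%:F / d'%:F = (n * d' + n' * d)%:F / (d * d')%:F.
    by rewrite fraction_sum // tofracD !tofracM.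
  rewrite !fraction_derE ?mulf_neq0 // (derD hD) !(derM hD) !(tofracM, tofracD).
  exact: fraction_sum_der.
- have -> : n%:F / d%:F * (n'%:F / d'%:F) = (n * n')%:F / (d * d')%:F.
    by rewrite fraction_prod // !tofracM.
  rewrite !fraction_derE ?mulf_neq0 // !(derM hD) !(tofracM, tofracD).
  exact: fraction_prod_der.
Qed.

End FractionDerivation.

(** The commutator of two derivations is a derivation, hence zero on fractions once it is zero on
    the ring. *)
Lemma fraction_der_comm (R : idomainType) (D1 D2 : R -> R) :
  derivation D1 -> derivation D2 -> (forall x, D1 (D2 x) = D2 (D1 x)) ->
  forall x, fraction_der D1 (fraction_der D2 x) = fraction_der D2 (fraction_der D1 x).
Proof.
move=> h1 h2 C x; have e1 := fraction_der_derivation h1; have e2 := fraction_der_derivation h2.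
apply/eqP; rewrite -subr_eq0; apply/eqP; move: x; apply: derivation_eq0.
  split=> x y; first by rewrite !(derD e1, derD e2) opprD addrACA.
  rewrite !(derM e1, derM e2, derD e1, derD e2).
  move: x y (fraction_der _ _) (fraction_der _ _) (fraction_der _ _) (fraction_der _ _) => *.
  by ring.
by move=> x; rewrite !(fraction_der_tofrac h1, fraction_der_tofrac h2) C subrr.
Qed.

Section GenericForms.
Variables (V : finType) (d : nat).

(** The partial derivatives of F_2(a, p), abstractly. Forms 0, ..., d - 1 serve as parameters and
    form d as the Lefschetz element, whence the bounds k <= d. *)
Record derivation_data (K : fieldType) (a : nat -> V -> K) (p : nat -> K)
    (da : nat -> V -> K -> K) (dp : nat -> K -> K) : Prop := {
  da_der : forall k v, derivation (da k v);
  dp_der : forall k, derivation (dp k);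
  da_dp : forall k v l x, da k v (dp l x) = dp l (da k v x);
  dp_dp : forall k l x, dp k (dp l x) = dp l (dp k x);
  da_a : forall k v l w, (k <= d)%N -> (l <= d)%N ->
    da k v (a l w) = ((k == l) && (v == w))%:R;
  da_p : forall k v l, da k v (p l) = 0;
  dp_a : forall k l w, dp k (a l w) = 0;
  dp_p : forall k l, (k <= d)%N -> (l <= d)%N -> dp k (p l) = (k == l)%:R }.

Definition generic_forms (K : fieldType) (a : nat -> V -> K) : Prop :=
  forall n (e : 'I_n -> V), injective e -> (n <= d.+1)%N ->
    \det (\matrix_(i < n, j < n) a i (e j)) != 0.

Local Notation index := ('I_d.+1 * option V)%type.
Local Notation P := {mpoly 'F_2[#|{: index}|]}.
Local Notation K := {fraction P}.

Let param (k : nat) (o : option V) : P := 'X_(enum_rank (inord k : 'I_d.+1, o)).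
Let deriv (k : nat) (o : option V) : K -> K :=
  fraction_der (mderiv (enum_rank (inord k : 'I_d.+1, o))).

Lemma mderiv_derivation n (R : comNzRingType) (i : 'I_n) :
  derivation (mderiv i : {mpoly R[n]} -> {mpoly R[n]}).
Proof. by split=> x y; [rewrite mderivD | rewrite mderivM]. Qed.

Lemma deriv_param k o l o' : (k <= d)%N -> (l <= d)%N ->
  deriv k o (FracField.tofrac (param l o')) = ((k == l) && (o == o'))%:R.
Proof.
move=> kd ld; rewrite /deriv fraction_der_tofrac; last exact: mderiv_derivation.
rewrite mderivX mnm1E (can_eq enum_rankK) xpair_eqE.
have -> : (inord l == inord k :> 'I_d.+1) = (k == l).
  by rewrite eq_sym -val_eqE /= !inordK.
rewrite [o == o']eq_sym; case: (eqVneq k l) => [->|_] /=; last by rewrite scale0r tofrac0.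
case: (eqVneq o' o) => [->|_] /=; last by rewrite scale0r tofrac0.
rewrite scale1r (_ : _ - _ = 0)%MM ?mpolyX0 ?tofrac1 //.
by apply/mnmP => i; rewrite mnmBE subnn mnm0E.
Qed.

Lemma deriv_param0 k o l o' : (o == o') = false ->
  deriv k o (FracField.tofrac (param l o')) = 0.
Proof.
move=> oo; rewrite /deriv fraction_der_tofrac; last exact: mderiv_derivation.
by rewrite mderivX mnm1E (can_eq enum_rankK) xpair_eqE [X in _ && X]eq_sym oo andbF scale0r tofrac0.
Qed.

(** The indeterminate with index [(k, Some v)] is the coefficient of x_v in form k, and the one with
    index [(k, None)] is the prescribed value of that form. *)
Lemma generic_field_exists : exists (K : fieldType) (f : {rmorphism 'F_2 -> K})
    (a : nat -> V -> K) (p : nat -> K) (da : nat -> V -> K -> K) (dp : nat -> K -> K),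
  derivation_data a p da dp /\ generic_forms a.
Proof.
exists K, (@FracField.tofrac P \o @mpolyC _ _), (fun k v => FracField.tofrac (param k (Some v))),
  (fun k => FracField.tofrac (param k None)), (fun k v => deriv k (Some v)),
  (fun k => deriv k None).
split; last first.
  move=> n e inj nd.
  have -> : (\matrix_(i < n, j < n) FracField.tofrac (param i (Some (e j)))) =
      map_mx (@FracField.tofrac P) (\matrix_(i < n, j < n) param i (Some (e j))).
    by apply/matrixP => i j; rewrite !mxE.
  rewrite det_map_mx tofrac_eq0; apply/eqP => h.
  (* Sending a_(k,v) to 1 exactly when v = e k turns the matrix into the identity. *)
  pose x (z : 'I_#|{: index}|) : 'F_2 := if enum_val z is (k, Some v) then
     [exists j : 'I_n, (j == k :> nat) && (v == e j)]%:R else 0.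
  suff : \det (map_mx (meval x) (\matrix_(i < n, j < n) param i (Some (e j)))) = 1 :> 'F_2.
    by rewrite det_map_mx h rmorph0 => /eqP; rewrite eq_sym oner_eq0.
  rewrite -(@det1 _ n); congr (\det _); apply/matrixP => i j; rewrite !mxE.
  rewrite mevalXU /x enum_rankK inordK; last by have := ltn_ord i; lia.
  congr ((nat_of_bool _)%:R); apply/existsP/idP => [[j' /andP[/eqP e1 /eqP /inj->]]|/eqP->]; last by exists j; rewrite !eqxx.
  by rewrite -val_eqE /= e1.
have der k o : derivation (deriv k o) := fraction_der_derivation (mderiv_derivation _ _).
split=> //.
- by move=> k v l x; apply: fraction_der_comm (mderiv_derivation _ _) (mderiv_derivation _ _) _ _ => y; apply: mderiv_comm.
- by move=> k l x; apply: fraction_der_comm (mderiv_derivation _ _) (mderiv_derivation _ _) _ _ => y; apply: mderiv_comm.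
- by move=> k v l w kd ld; rewrite deriv_param.
- by move=> k v l; rewrite deriv_param0.
- by move=> k l w; rewrite deriv_param0.
- by move=> k l kd ld; rewrite deriv_param // eqxx andbT.
Qed.

End GenericForms.

(** * Generic linear forms *)

Section FaceMatrix.
Variables (V : finType) (d : nat) (K : fieldType).
Hypothesis K2 : forall x : K, x + x = 0.
Variables (a : nat -> V -> K) (p : nat -> K) (da : nat -> V -> K -> K) (dp : nat -> K -> K).
Hypothesis data : derivation_data d a p da dp.
Hypothesis ha : generic_forms d a.
Implicit Types (F : {set V}) (v w : V).

Definition face_mx n (e : 'I_n -> V) : 'M[K]_n := \matrix_(i, j) a i (e j).

Definition enumerates n (e : 'I_n -> V) F := injective e /\ F = [set e i | i : 'I_n].

Definition replace_col n (M : 'M[K]_n) (j0 : 'I_n) : 'M[K]_n :=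
  \matrix_(i, j) if j == j0 then p i else M i j.

Lemma enumeration_exists F n : #|F| = n -> exists e : 'I_n -> V, enumerates e F.
Proof.
move=> <-; exists (@enum_val _ (mem F)); split; first exact: enum_val_inj.
apply/setP => v; apply/idP/imsetP => [vF|[i _ ->]]; last exact: enum_valP.
by exists (enum_rank_in vF v) => //; rewrite enum_rankK_in.
Qed.

Lemma det_replace_col n (M : 'M[K]_n) j0 :
  \det (replace_col M j0) = \sum_(i < n) p i * cofactor M i j0.
Proof.
rewrite (expand_det_col _ j0); apply: eq_bigr => i _; rewrite mxE eqxx; congr (_ * _).
rewrite /cofactor; congr (_ * \det _); apply/matrixP => r s; rewrite !mxE.
by rewrite eq_sym (negPf (neq_lift _ _)).
Qed.

(** Permuting the columns changes only the sign, which is invisible in characteristic 2; so the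
    volume of a face needs no orientation. *)
Lemma det_face_mx n (e e' : 'I_n -> V) F : enumerates e F -> enumerates e' F ->
  \det (face_mx e) = \det (face_mx e').
Proof.
move=> [ie eF] [ie' eF'].
have h i : exists j, e' j == e i.
  have : e i \in F by rewrite eF imset_f.
  by rewrite eF' => /imsetP[j _ ->]; exists j.
pose s i := xchoose (h i); have es i : e' (s i) = e i := eqP (xchooseP (h i)).
have si : injective s by move=> i j /(congr1 e'); rewrite !es; apply: ie.
have -> : face_mx e = col_perm (perm.perm si) (face_mx e').
  by apply/matrixP => i j; rewrite !mxE perm.permE es.
rewrite col_permE det_mulmx det_perm; case: perm.odd_perm; last by rewrite expr0 mulr1.
rewrite expr1 mulrN1; apply/eqP; rewrite eq_sym -subr_eq0 opprK; apply/eqP; exact: K2.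
Qed.

(** [b] inverts the matrix of the first n forms on F. [vol_cramer] is Cramer's rule for the point of
    F; [vol_da] says that the derivative of a determinant along an entry is a cofactor. *)
Record inverse_data F n (b : V -> nat -> K) (vol : K) : Prop := {
  inv_left : forall v w, v \in F -> w \in F -> \sum_(k < n) b v k * a k w = (v == w)%:R;
  inv_right : forall l i, (l < n)%N -> (i < n)%N ->
    \sum_(v in F) a l v * b v i = (l == i)%:R;
  vol0 : vol != 0;
  vol_det : forall e : 'I_n -> V, enumerates e F -> vol = \det (face_mx e);
  vol_cramer : forall (e : 'I_n -> V) j, enumerates e F ->
    vol * \sum_(k < n) b (e j) k * p k = \det (replace_col (face_mx e) j);
  vol_da : forall l w, (l < n)%N -> da l w vol = if w \in F then vol * b w l else 0 }.

Lemma inverse_data_exists F n : #|F| = n -> (n <= d.+1)%N ->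
  exists b vol, inverse_data F n b vol.
Proof.
move=> /enumeration_exists[e eF] nd.
pose M := face_mx e; have M0 : \det M != 0 := ha eF.1 nd.
have uM : M \in unitmx by rewrite unitmxE unitfE.
pose W := invmx M.
have WE i j : W i j = (\det M)^-1 * cofactor M j i by rewrite /W /invmx uM !mxE.
pose b v k := if insub k is Some k' then \sum_(i | e i == v) W i k' else 0.
have bE i (k : 'I_n) : b (e i) k = W i k.
  rewrite /b valK (big_pred1 i) // => j; exact: (inj_eq eF.1).
have inF i : e i \in F by rewrite eF.2 imset_f.
have Fin v : v \in F -> exists i, v = e i by rewrite eF.2 => /imsetP[i _ ->]; exists i.
have left v w : v \in F -> w \in F -> \sum_(k < n) b v k * a k w = (v == w)%:R.
  move=> /Fin[i ->] /Fin[j ->]; rewrite (inj_eq eF.1).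
  have := congr1 (fun A : 'M_n => A i j) (mulVmx uM); rewrite !mxE => <-.
  by apply: eq_bigr => k _; rewrite bE mxE.
exists b, (\det M); split=> //.
- move=> l i ln im; have := congr1 (fun A : 'M_n => A (Ordinal ln) (Ordinal im)) (mulmxV uM).
  rewrite !mxE -val_eqE /= => <-; rewrite eF.2 big_imset /=; last by move=> x y _ _; apply: eF.1.
  by apply: eq_bigr => k _; rewrite -[i]/(nat_of_ord (Ordinal im)) bE mxE.
- by move=> e' eF'; apply: det_face_mx eF eF'.
- move=> e' j eF'; have in' i : e' i \in F by rewrite eF'.2 imset_f.
  have dM := det_face_mx eF eF'; have u' : face_mx e' \in unitmx.
    by rewrite unitmxE unitfE -dM.
  have E : \matrix_(i, k) b (e' i) k = invmx (face_mx e').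
    rewrite -[LHS](mulmxK u') -[RHS]mul1mx; congr (_ *m _); apply/matrixP => i l.
    rewrite !mxE -(inj_eq eF'.1) -(left _ _ (in' i) (in' l)).
    by apply: eq_bigr => k _; rewrite !mxE.
  rewrite det_replace_col mulr_sumr; apply: eq_bigr => k _.
  have -> : b (e' j) k = invmx (face_mx e') j k by rewrite -E mxE.
  by rewrite /invmx u' !mxE -dM mulrA mulVKf // mulrC.
- move=> l w ln; pose l' := Ordinal ln.
  rewrite [X in da l w X](_ : _ = \sum_j a l (e j) * cofactor M l' j); last first.
    by rewrite (expand_det_row _ l'); apply: eq_bigr => j _; rewrite mxE.
  rewrite (der_sum (da_der data l w)).
  have E j : da l w (a l (e j) * cofactor M l' j) = (w == e j)%:R * cofactor M l' j.
    rewrite (derM (da_der data l w)) [X in _ + _ * X](_ : _ = 0) ?mulr0 ?addr0.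
      rewrite (da_a data) ?eqxx //; lia.
    rewrite /cofactor (derM (da_der data l w)) (der_det0 (da_der data l w)) ?mulr0 ?addr0.
      rewrite [X in X * _](_ : _ = 0) ?mul0r //.
      by elim: (_ + _)%N => [|k IH]; rewrite ?expr0 ?(der1 (da_der data l w)) // exprS mulN1r (derN (da_der data l w)) IH oppr0.
    move=> i k; rewrite !mxE (da_a data); try lia.
      by rewrite (inj_eq (@ord_inj _) l' (lift l' i)) (negPf (neq_lift _ _)).
    by have := ltn_ord (lift l' i); lia.
  under eq_bigr do rewrite E; case: ifP => [/Fin[i ->]|wF].
    rewrite (bigD1 i) //= eqxx mul1r big1 ?addr0 => [|j /negPf ji].
      by rewrite -[l]/(nat_of_ord l') bE WE mulVKf.
    by rewrite (inj_eq eF.1) eq_sym ji mul0r.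
  by apply: big1 => j _; case: eqP => [wj|_]; rewrite ?mul0r //; rewrite wj inF in wF.
Qed.

End FaceMatrix.

Section FacetDerivatives.
Variables (V : finType) (D : {set {set V}}) (d : nat).
Hypothesis hD : sphere d D.
Variable K : fieldType.
Hypothesis K2 : forall x : K, x + x = 0.
Variables (a : nat -> V -> K) (p : nat -> K) (da : nat -> V -> K -> K) (dp : nat -> K -> K).
Hypothesis data : derivation_data d a p da dp.
Hypothesis ha : generic_forms d a.
Implicit Types (F : {set V}) (v w : V).
Let da_ k v := da_der data k v.
Let dp_ k := dp_der data k.

Lemma generic_independent F : F \in D -> exists b, independent_on a F b.
Proof.
move=> FD; have [b [vol h]] := inverse_data_exists K2 data ha (erefl #|F|)
  (leqW (sphere_card hD FD)).
by exists b; split; [apply: inv_left h | apply: inv_right h].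
Qed.

Lemma opp_self_char2 (x : K) : - x = x.
Proof. by apply/eqP; rewrite -subr_eq0 -opprD K2 oppr0. Qed.

Section OneFacet.
Variables (F : {set V}) (b : V -> nat -> K) (vol : K).
Hypothesis hF : inverse_data a p da F d b vol.
Let x v := if v \in F then \sum_(k < d) b v k * p k else 0.

Lemma dp_inverse k v l : v \in F -> (l < d)%N -> dp k (b v l) = 0.
Proof.
move=> vF ld.
have E w : w \in F -> \sum_(i < d) dp k (b v i) * a i w = 0.
  move=> wF; have := congr1 (dp k) (inv_left hF vF wF); rewrite (der_sum (dp_ k)).
  have -> : dp k (v == w)%:R = 0 by case: eqP => _; rewrite ?(der1 (dp_ k)) ?(der0 (dp_ k)).
  by under eq_bigr do rewrite (derM (dp_ k)) (dp_a data) mulr0 addr0.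
have : \sum_(w in F) (\sum_(i < d) dp k (b v i) * a i w) * b w l = 0.
  by apply: big1 => w wF; rewrite E ?mul0r.
under eq_bigr do rewrite mulr_suml.
rewrite exchange_big (bigD1 (Ordinal ld)) //= [X in _ + X]big1 ?addr0 => [|i il].
  under eq_bigr do rewrite -mulrA; rewrite -mulr_sumr (inv_right hF) // eqxx mulr1 //.
under eq_bigr do rewrite -mulrA; rewrite -mulr_sumr (inv_right hF) //.
by rewrite (negPf (il : (i : nat) != l)) mulr0.
Qed.

Lemma dp_point k v : v \in F -> (k < d)%N -> dp k (x v) = b v k.
Proof.
move=> vF kd; rewrite /x vF (der_sum (dp_ k)) (bigD1 (Ordinal kd)) //= big1 ?addr0.
  by rewrite (derM (dp_ k)) dp_inverse // mul0r add0r (dp_p data (ltnW kd) (ltnW kd)) eqxx mulr1.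
move=> i ik; rewrite (derM (dp_ k)) dp_inverse // mul0r add0r.
by rewrite (dp_p data (ltnW kd) (ltnW (ltn_ord i))) eq_sym (negPf (ik : (i : nat) != k)) mulr0.
Qed.

Lemma point_form k : (k < d)%N -> \sum_(v in F) a k v * x v = p k.
Proof.
move=> kd; transitivity (\sum_(v in F) \sum_(i < d) a k v * b v i * p i).
  by apply: eq_bigr => v vF; rewrite /x vF mulr_sumr; under eq_bigr do rewrite mulrA.
rewrite exchange_big (bigD1 (Ordinal kd)) //= [X in _ + X]big1 ?addr0 => [|i ik].
  by rewrite -mulr_suml (inv_right hF) // eqxx mul1r.
by rewrite -mulr_suml (inv_right hF) // eq_sym (negPf (ik : (i : nat) != k)) mul0r.
Qed.

(** A coordinate equal to zero would have zero derivatives along all the p_k; but these are the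
    entries [b v k], which cannot all vanish. *)
Lemma point_neq0 v : (x v != 0) = (v \in F).
Proof.
case vF : (v \in F); last by rewrite /x vF eqxx.
apply/eqP => x0; have := inv_left hF vF vF; rewrite eqxx big1; last first.
  by move=> k _; rewrite -dp_point // x0 (der0 (dp_ k)) mul0r.
by move/eqP; rewrite eq_sym oner_eq0.
Qed.

(** Differentiate the equations sum_u a_(k,u) x_u = p_k along a_(l,w) and solve with [b]. Since b v
    l is the derivative of x_v along p_l, this is a transport equation that replaces derivatives
    along a by derivatives along p. *)
Lemma da_point l w v : v \in F -> (l <= d)%N ->
  da l w (x v) = if (l < d)%N then x w * b v l else 0.
Proof.
move=> vF ld.
have E k : (k < d)%N -> \sum_(u in F) a k u * da l w (x u) = ((l == k) && (w \in F))%:R * x w.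
  move=> kd; have := congr1 (da l w) (point_form kd); rewrite (da_p data) (der_sum (da_ l w)).
  under eq_bigr do rewrite (derM (da_ l w)).
  rewrite big_split /= => /eqP; rewrite addrC addr_eq0 opp_self_char2 => /eqP->.
  under eq_bigr do rewrite (da_a data _ _ ld (ltnW kd)).
  case: eqP => _ /=; last by rewrite mul0r big1 // => u _; rewrite mul0r.
  case wF : (w \in F); last first.
    by rewrite mul0r big1 // => u uF; case: eqP => [wu|]; rewrite ?mul0r //; rewrite wu uF in wF.
  rewrite (bigD1 w) //= eqxx big1 ?addr0 // => u /andP[_ uw].
  by rewrite eq_sym (negPf uw) mul0r.
have : \sum_(k < d) b v k * \sum_(u in F) a k u * da l w (x u) = da l w (x v).
  under eq_bigr do rewrite mulr_sumr; rewrite exchange_big /=.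
  rewrite (bigD1 v) //= [X in _ + X]big1 ?addr0 => [|u /andP[uF uv]].
    by under eq_bigr do rewrite mulrA; rewrite -mulr_suml (inv_left hF) // eqxx mul1r.
  by under eq_bigr do rewrite mulrA; rewrite -mulr_suml (inv_left hF) // eq_sym (negPf uv) mul0r.
move=> <-; under eq_bigr do rewrite E //.
case: ifP => ld'.
  rewrite (bigD1 (Ordinal ld')) //= big1 ?addr0 => [|i il].
    rewrite eqxx /=; case wF : (w \in F); first by rewrite mul1r mulrC.
    by rewrite /x wF !mul0r mulr0.
  by rewrite eq_sym (negPf (il : (i : nat) != l)) mul0r mulr0.
rewrite big1 // => i _; case: eqP => [li|_]; last by rewrite mul0r mulr0.
by rewrite li ltn_ord in ld'.
Qed.

Hypothesis cF : #|F| = d.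

Lemma dp_vol k : dp k vol = 0.
Proof.
have [e eF] := enumeration_exists cF; rewrite (vol_det hF eF) (der_det0 (dp_ k)) // => i j.
by rewrite mxE (dp_a data).
Qed.

Lemma da_vol w : da d w vol = 0.
Proof.
have [e eF] := enumeration_exists cF; rewrite (vol_det hF eF) (der_det0 (da_ d w)) // => i j.
by rewrite mxE (da_a data _ _ (leqnn d) (ltnW (ltn_ord i))) gtn_eqF.
Qed.

End OneFacet.

Lemma facet_data_exists : exists pt dual vol, facet_data D d a p pt dual vol /\
  forall F, is_facet D d F -> inverse_data a p da F d (dual F) (vol F) /\
    forall v, pt F v = if v \in F then \sum_(k < d) dual F v k * p k else 0.
Proof.
have h F : exists bv : (V -> nat -> K) * K, is_facet D d F ->
    inverse_data a p da F d bv.1 bv.2.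
  have [hF|_] := boolP (is_facet D d F); last by exists (fun _ _ => 0, 0).
  have [b [vol hb]] := inverse_data_exists K2 data ha (eqP (andP hF).2) (leqnSn d).
  by exists (b, vol).
have [f hf] := fin_all_exists h.
exists (fun F v => if v \in F then \sum_(k < d) (f F).1 v k * p k else 0),
  (fun F => (f F).1), (fun F => (f F).2); split; last by move=> F hF; split=> //; apply: hf.
split.
- by move=> F v hF; apply: point_neq0 (hf F hF) v.
- move=> F k hF kd; rewrite -(point_form (hf F hF) kd) [RHS]big_mkcond /=.
  by apply: eq_bigr => v _; case: ifP; rewrite ?mulr0.
- by move=> F v w hF; apply: (inv_left (hf F hF)).
- by move=> F v _ ->.
- by move=> F hF; apply: (vol0 (hf F hF)).
move=> G v w vG wG hv hw; rewrite !setU11.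
have [e eF] := enumeration_exists (eqP (andP hv).2).
have : v \in v |: G by rewrite setU11.
rewrite {1}eF.2 => /imsetP[j _ vj].
(* Exchange v for w in the enumeration of the facet. Once this column is replaced by p the two
   matrices coincide, and Cramer's rule gives both sides. *)
pose e' i := if i == j then w else e i.
have eG i : i != j -> e i \in G.
  move=> ij; have : e i \in v |: G by rewrite eF.2 imset_f.
  by rewrite in_setU1 vj (inj_eq eF.1) (negPf ij).
have eF' : enumerates e' (w |: G).
  split=> [i i'|].
    rewrite /e'; case: eqP => [->|/eqP ij]; case: eqP => [->|/eqP ij'] //.
    - by move=> E; rewrite E eG in wG.
    - by move=> E; rewrite -E eG in wG.
    exact: eF.1.
  apply/setP => z; rewrite in_setU1; apply/idP/imsetP => [/orP[/eqP->|zG]|[i _ ->]].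
  - by exists j; rewrite // /e' eqxx.
  - have : z \in v |: G by rewrite in_setU1 zG orbT.
    rewrite eF.2 => /imsetP[i _ zi]; exists i => //; rewrite /e'; case: eqP => // ij.
    by rewrite zi ij -vj (negPf vG) in zG.
  - by rewrite /e'; case: (eqVneq i j) => [_|ij]; rewrite ?eqxx // eG ?orbT.
transitivity (\det (replace_col p (face_mx a e) j)).
  by rewrite -(vol_cramer (hf _ hv) j eF) -vj.
have -> : replace_col p (face_mx a e) j = replace_col p (face_mx a e') j.
  by apply/matrixP => i i'; rewrite !mxE /e'; case: eqP.
by rewrite -(vol_cramer (hf _ hw) j eF') /e' eqxx.
Qed.

End FacetDerivatives.

(** * The weak Lefschetz property and the socle *)

From mathcomp Require Import fingroup perm.

Lemma sqr_sum_char2 (A : comNzRingType) (A2 : forall x : A, x + x = 0)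
    (I : Type) (r : seq I) (P : pred I) (F : I -> A) :
  (\sum_(i <- r | P i) F i) ^+ 2 = \sum_(i <- r | P i) F i ^+ 2.
Proof.
apply: (big_morph (fun x => x ^+ 2)); last by rewrite expr0n.
by move=> x y; rewrite sqrrD mulr2n A2 addr0.
Qed.

Lemma der_sqrM (A : comNzRingType) (A2 : forall x : A, x + x = 0) (D : A -> A) c x :
  derivation D -> D (c ^+ 2 * x) = c ^+ 2 * D x.
Proof. by move=> hD; rewrite der_mul0 // expr2 derM // [D c * c]mulrC A2. Qed.

Lemma mnm_seq (V : finType) (m : 'X_{1..#|V|}) :
  exists s : seq V, m = (\sum_(v <- s) mvar v)%MM /\ size s = mdeg m.
Proof.
move: {2}(mdeg m) (erefl (mdeg m)) => n; elim: n m => [|n IH] m mn.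
  exists [::]; rewrite big_nil mn; split=> //; by apply/eqP; rewrite -mdeg_eq0 mn.
have [m0|[v vm]] := set_0Vmem (msup m).
  suff m0' : m = 0%MM by rewrite m0' mdeg0 in mn.
  apply/mnmP => i; have := in_set0 (enum_val i); rewrite -m0 inE enum_valK => /negbFE/eqP->.
  by rewrite mnm0E.
have le : (mvar v <= m)%MM by rewrite mvar_le.
have E : m = (m - mvar v + mvar v)%MM by rewrite submK.
have dE : mdeg (m - mvar v)%MM = n by have := congr1 mdeg E; rewrite mdegD mdeg1; lia.
have [s [es ss]] := IH _ dE.
by exists (v :: s); rewrite big_cons -es /= ss dE mn {1}E addmC.
Qed.

Section WeakLefschetz.
Variables (V : finType) (D : {set {set V}}) (d : nat).
Hypothesis hD : sphere d D.
Variables (K : fieldType) (f : {rmorphism 'F_2 -> K}).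
Variables (a : nat -> V -> K) (p : nat -> K) (da : nat -> V -> K -> K) (dp : nat -> K -> K).
Hypothesis data : derivation_data d a p da dp.
Hypothesis ha : generic_forms d a.
Variables (pt : {set V} -> V -> K) (dual : {set V} -> V -> nat -> K) (vol : {set V} -> K).
Hypothesis fdata : facet_data D d a p pt dual vol.
Hypothesis idata : forall F, is_facet D d F -> inverse_data a p da F d (dual F) (vol F) /\
  forall v, pt F v = if v \in F then \sum_(k < d) dual F v k * p k else 0.
Local Notation poly := {mpoly K[#|V|]}.
Local Notation is_facet := (is_facet D d).
Local Notation deg := (deg D d pt vol).
Local Notation weight := (weight pt vol).
Local Notation ev := (ev pt).
Implicit Types (F : {set V}) (v w : V) (m : 'X_{1..#|V|}) (s : seq nat).
Let K2 := char2_addrr f.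
Let da_ k v := da_der data k v.
Let dp_ k := dp_der data k.

(** The value of the monomial divided by [weight F]. Each term of the degree is the square of the
    weight times this, and a square factor passes through derivations. *)
Definition lifted F m : K := vol F * \prod_(v in F) pt F v * ev F 'X_[m].

Lemma pt_dual F v : is_facet F -> v \in F -> pt F v = \sum_(k < d) dual F v k * p k.
Proof. by move=> /idata[_ ->] ->. Qed.

Lemma da_pt F l w v : is_facet F -> (l <= d)%N ->
  da l w (pt F v) = if (l < d)%N then pt F w * dp l (pt F v) else 0.
Proof.
move=> hF ld; have [hi hp] := idata hF; case vF : (v \in F); last first.
  by rewrite hp vF (der0 (da_ l w)) (der0 (dp_ l)) mulr0 if_same.
have := da_point K2 data hi w vF ld; rewrite -!hp => ->; case: ifP => // ld'.
by have := dp_point data hi vF ld'; rewrite -hp => ->.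
Qed.

Lemma ev_mvar F v : ev F 'X_[mvar v] = pt F v.
Proof. by rewrite /Submission.ev mevalXU enum_rankK. Qed.

Lemma da_monomial F l w m : is_facet F -> (l < d)%N ->
  da l w (\prod_(v in F) pt F v * ev F 'X_[m]) =
  pt F w * dp l (\prod_(v in F) pt F v * ev F 'X_[m]).
Proof.
move=> hF ld.
pose good (x : K) := da l w x = pt F w * dp l x.
have g1 : good 1 by rewrite /good (der1 (da_ l w)) (der1 (dp_ l)) mulr0.
have gM x y : good x -> good y -> good (x * y).
  rewrite /good (derM (da_ l w)) (derM (dp_ l)) => -> ->; move: (pt F w) => c.
  by rewrite mulrDr !mulrA [c * x]mulrC.
have gp v : good (pt F v) by rewrite /good da_pt ?ld // (ltnW ld).
apply: (gM); first by apply: (big_ind good).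
rewrite evX; apply: (big_ind good) => // v _.
by elim: (m _) => [|k IH]; rewrite ?expr0 // exprS; apply: (gM).
Qed.

(** The derivative of [vol F] contributes a factor [dual F w l], which is the derivative of [pt F w]
    along p_l: exactly the term that the product rule needs for the additional factor x_w. *)
Lemma da_lifted F l w m : is_facet F -> (l < d)%N ->
  da l w (lifted F m) = dp l (lifted F (m + mvar w)%MM).
Proof.
move=> hF ld; have [hi hp] := idata hF; have cF := eqP (andP hF).2.
rewrite /lifted mpolyXD evM ev_mvar -!mulrA [_ * (_ * pt F w)]mulrA.
rewrite (derM (da_ l w)) da_monomial // (vol_da hi) //.
move: (\prod_(v in F) pt F v * ev F 'X_[m]) => x; rewrite [dp l (vol F * _)](derM (dp_ l)) (dp_vol data hi cF) mul0r add0r [dp l (x * _)](derM (dp_ l)).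
case wF : (w \in F).
  have -> : dp l (pt F w) = dual F w l by have := dp_point data hi wF ld; rewrite -hp.
  by rewrite mulrDr addrC [pt F w * _]mulrC -mulrA [dual F w l * _]mulrC.
by rewrite hp wF (der0 (dp_ l)) !(mul0r, mulr0, addr0).
Qed.

Definition grad s (x : K) := foldr dp x s.
Definition agrad (I : nat -> V) s (x : K) := foldr (fun k => da k (I k)) x s.

Lemma gradM c s x : (forall k, k \in s -> dp k c = 0) -> grad s (c * x) = c * grad s x.
Proof.
elim: s => //= k s IH h; rewrite IH => [|l ls]; last by rewrite h // inE ls orbT.
by rewrite der_mul0 // h // mem_head.
Qed.

Lemma grad_sqrM c s x : grad s (c ^+ 2 * x) = c ^+ 2 * grad s x.
Proof. by apply: gradM => k _; rewrite expr2 (derM (dp_ k)) [X in X + _]mulrC K2. Qed.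

Lemma grad_sum s (J : finType) (P : pred J) (F : J -> K) :
  grad s (\sum_(i | P i) F i) = \sum_(i | P i) grad s (F i).
Proof. by elim: s => //= k s ->; rewrite (der_sum (dp_ k)). Qed.

Lemma agrad_sqrM I s c x : agrad I s (c ^+ 2 * x) = c ^+ 2 * agrad I s x.
Proof. by elim: s => //= k s ->; rewrite der_sqrM. Qed.

Lemma agrad_sum I s (J : Type) (r : seq J) (P : pred J) (F : J -> K) :
  agrad I s (\sum_(i <- r | P i) F i) = \sum_(i <- r | P i) agrad I s (F i).
Proof. by elim: s => //= k s ->; rewrite (der_sum (da_ k (I k))). Qed.

Lemma grad_dp s k x : grad s (dp k x) = dp k (grad s x).
Proof. by elim: s => //= l s ->; rewrite (dp_dp data). Qed.

Lemma da_grad s k w x : da k w (grad s x) = grad s (da k w x).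
Proof. by elim: s => //= l s <-; rewrite (da_dp data). Qed.

Lemma agrad_lifted I s F m : is_facet F -> all (fun k => (k < d)%N) s ->
  agrad I s (lifted F m) = grad s (lifted F (m + \sum_(k <- s) mvar (I k))%MM).
Proof.
move=> hF; elim: s m => [|k s IH] m /=; first by rewrite big_nil addm0.
move=> /andP[kd sd]; rewrite IH // da_grad da_lifted // grad_dp big_cons.
by rewrite -addmA [(_ + mvar _)%MM]addmC.
Qed.

Lemma grad_monomial (s : 'I_d -> 'I_d) : injective s ->
  grad (iota 0 d) (\prod_i p (s i)) = 1.
Proof.
move=> si; rewrite -(reindex_inj si (P := xpredT) (F := fun i : 'I_d => p i)) /=.
rewrite -(big_mkord xpredT p).
have : (d <= d)%N by []; elim: {1 3 4}d => [|j IH] jd; first by rewrite big_nil.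
rewrite -addn1 iotaD /grad foldr_cat /= addn1 big_nat_recr //= -/(grad _ _).
have -> : dp j (\prod_(0 <= i < j) p i * p j) = \prod_(0 <= i < j) p i.
  rewrite der_mul0 //; first by rewrite (dp_p data (ltnW jd) (ltnW jd)) eqxx mulr1.
  rewrite big_mkord; apply: (der_prod0 (dp_ j)) => i _.
  by rewrite (dp_p data (ltnW jd) (leq_trans (ltnW (ltn_ord i)) (ltnW jd))) gtn_eqF.
by rewrite IH // ltnW.
Qed.

Lemma grad_missing s k x : k \in s -> dp k x = 0 -> grad s x = 0.
Proof.
move=> ks x0; have : dp k (grad (rem k s) x) = 0.
  by rewrite -grad_dp x0; elim: (rem k s) => //= l s' ->; rewrite (der0 (dp_ l)).
suff -> : grad s x = dp k (grad (rem k s) x) by [].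
elim: s ks => //= l s IH; rewrite inE; case: eqVneq => [->//|kl] /= ks.
by rewrite IH // (dp_dp data).
Qed.

(** The coordinates are linear forms in p, so the mixed derivative of their product is the permanent
    of [dual]. In characteristic 2 this is the determinant, the inverse of [vol F]. *)
Lemma grad_points F : is_facet F -> grad (iota 0 d) (vol F * \prod_(v in F) pt F v) = 1.
Proof.
move=> hF; have [hi _] := idata hF; have cF := eqP (andP hF).2.
have [e eF] := enumeration_exists cF.
have eFi i : e i \in F by rewrite eF.2 imset_f.
rewrite gradM => [|k _]; last exact: (dp_vol data hi cF).
pose b i k := dual F (e i) k.
have -> : \prod_(v in F) pt F v = \prod_i \sum_(k < d) b i k * p k.
  transitivity (\prod_(v in [set e i | i : 'I_d]) pt F v); first by rewrite -eF.2.
  rewrite big_imset /=; last by move=> x y _ _; apply: eF.1.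
  by apply: eq_bigr => i _; rewrite pt_dual.
rewrite bigA_distr_bigA /= grad_sum.
have bc i (j : 'I_d) k : dp k (b i j) = 0 by apply: (dp_inverse data hi).
under eq_bigr => s _.
  rewrite big_split /= gradM => [|k _]; last by apply: (der_prod0 (dp_ k)).
  over.
have -> : \sum_(s : {ffun 'I_d -> 'I_d}) \prod_i b i (s i) * grad (iota 0 d) (\prod_i p (s i))
    = \det (\matrix_(i, j < d) b i j).
  rewrite (bigID (fun s : {ffun 'I_d -> 'I_d} => injectiveb s)) /= addrC big1 ?add0r => [|s Us].
    rewrite (reindex (@pval _)) /=; last first.
      pose in_Sn := insubd (1%g : {perm 'I_d}).
      by exists in_Sn => /= s Us; first apply: val_inj; apply: insubdK.
    apply: eq_big => /= [s|s _]; rewrite ?(valP s) //.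
    rewrite grad_monomial; last exact/injectiveP/(valP s).
    rewrite mulr1; under [in RHS]eq_bigr do rewrite mxE.
    rewrite (_ : (-1) ^+ s = 1) ?mul1r; last first.
      by case: odd_perm; rewrite ?expr0 // expr1 (opp_self_char2 K2).
    by apply: eq_bigr => i _; rewrite pvalE.
  (* A map s that is not injective misses some p_k, and the derivative along p_k kills its term. *)
  suff [k ks] : exists k : 'I_d, k \notin codom s.
    rewrite (@grad_missing _ k) ?mulr0 ?mem_iota ?add0n ?ltn_ord //.
    apply: (der_prod0 (dp_ k)) => i _; rewrite (dp_p data (ltnW (ltn_ord k)) (ltnW (ltn_ord (s i)))).
    by case: eqP => // /val_inj ki; rewrite ki codom_f in ks.
  apply/existsP; apply: contraR Us; rewrite negb_exists => /forallP h.
  have /image_injP si : #|image s 'I_d| == #|'I_d|.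
    by rewrite (eq_card (B := 'I_d)) // => k; rewrite !inE -[LHS]negbK h.
  by apply/injectiveP => i j; apply: si.
rewrite mulrC; suff -> : \det (\matrix_(i, j < d) b i j) * vol F = 1 by [].
rewrite (vol_det hi eF) -det_mulmx -[RHS](det1 _ d); congr (\det _).
apply/matrixP => i j; rewrite !mxE -(inj_eq eF.1) -(inv_left hi (eFi i) (eFi j)).
by apply: eq_bigr => k _; rewrite !mxE.
Qed.

Lemma deg_lifted m : deg 'X_[m] = \sum_(F | is_facet F) weight F ^+ 2 * lifted F m.
Proof.
apply: eq_bigr => F hF; rewrite /lifted expr2 -mulrA; congr (_ * _).
rewrite mulrA mulVf ?mul1r // mulf_neq0 ?(vol_neq0 fdata) //.
by apply/prodf_neq0 => v vF; rewrite (pt_neq0 fdata).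
Qed.

(** Weights and values of x^n occur squared and pass through all derivatives; what remains on each
    facet is the derivative of [grad_points], equal to 1. In characteristic 2 the sum of squares
    obtained is the square of a degree. *)
Lemma agrad_deg I m n : (m + \sum_(k <- iota 0 d) mvar (I k) = n + n)%MM ->
  agrad I (iota 0 d) (deg 'X_[m]) = deg 'X_[n] ^+ 2.
Proof.
move=> E; rewrite deg_lifted agrad_sum /Submission.deg sqr_sum_char2 //.
apply: eq_bigr => F hF; rewrite agrad_sqrM agrad_lifted //; last first.
  by apply/allP => k; rewrite mem_iota.
rewrite E exprMn; congr (_ * _); rewrite /lifted mpolyXD evM -expr2 mulrC grad_sqrM.
by rewrite grad_points // mulr1.
Qed.

Lemma sqr_mpoly (q : poly) : q * q = \sum_(m <- msupp q) q@_m ^+ 2 *: 'X_[m + m].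
Proof.
rewrite -expr2 {1}(mpolyE q) sqr_sum_char2 => [|x].
  by apply: eq_bigr => m _; rewrite exprZn expr2 mpolyXD.
by apply/mpolyP => m; rewrite mcoeffD mcoeff0 K2.
Qed.

Lemma deg_sqrM q m : deg (q * q * 'X_[m]) = \sum_(l <- msupp q) q@_l ^+ 2 * deg 'X_[l + l + m].
Proof.
rewrite sqr_mpoly mulr_suml linear_sum; apply: eq_bigr => l _ /=.
by rewrite -scalerAl -mpolyXD linearZ.
Qed.

(** The square of q has no cross terms in characteristic 2, so an iterated derivative of the degree
    of q^2 x^t is the square of the degree of q x^L. This is where anisotropy comes from. *)
Lemma deg_sqr_eq0 I t L q : (t + \sum_(k <- iota 0 d) mvar (I k) = L + L)%MM ->
  deg (q * q * 'X_[t]) = 0 -> deg (q * 'X_[L]) = 0.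
Proof.
move=> E; rewrite deg_sqrM => /(congr1 (agrad I (iota 0 d))).
have -> : agrad I (iota 0 d) 0 = 0 by elim: (iota 0 d) => //= k s ->; rewrite (der0 (da_ k _)).
rewrite agrad_sum => h; apply/eqP; rewrite -sqrf_eq0; apply/eqP; rewrite -[RHS]h.
rewrite {1}(mpolyE q) mulr_suml linear_sum sqr_sum_char2 //; apply: eq_bigr => m _ /=.
rewrite agrad_sqrM (@agrad_deg _ _ (m + L)%MM); last first.
  apply/mnmP => i; have := congr1 (fun l : 'X_{1..#|V|} => l i) E; rewrite !mnmDE.
  by move: (m i) (t i) (L i) (_ i) => *; lia.
by rewrite -scalerAl linearZ /= exprMn -mpolyXD.
Qed.

Lemma da_deg v m : da d v (deg 'X_[m]) = 0.
Proof.
rewrite deg_lifted (der_sum (da_ d v)) big1 // => F hF; rewrite der_sqrM //.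
have [hi hp] := idata hF; have cF := eqP (andP hF).2.
have h0 w : da d v (pt F w) = 0 by rewrite da_pt // ltnn.
rewrite /lifted !(derM (da_ d v)) (da_vol data hi cF) (der_prod0 (da_ d v)) // evX.
rewrite (der_prod0 (da_ d v)) => [|w _]; first by rewrite !(mul0r, mulr0, addr0).
by elim: (m _) => [|k IH]; rewrite ?expr0 ?(der1 (da_ d v)) // exprS (derM (da_ d v)) IH h0 mul0r mulr0 addr0.
Qed.

Lemma da_degM v q m : da d v (deg (q * q * 'X_[m])) = 0.
Proof.
rewrite deg_sqrM (der_sum (da_ d v)) big1 // => l _.
by rewrite der_sqrM // da_deg mulr0.
Qed.

(** By duality, test g against monomials x^L of degree d - i. The square of x^L has 2(d - i) > d
    variables: d of them are spent on derivatives along the parameters, one on a derivative along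
    theta_d, and [M] collects the rest. *)
Lemma weak_lefschetz i g : (i.*2 < d)%N -> g \is i.-homog ->
  in_ideal D a d (lform (a d) * g) -> in_ideal D a d g.
Proof.
move=> id hg hI.
have generic := generic_independent hD K2 data ha.
have id' : (i <= d)%N by move: id; rewrite -addnn; lia.
apply: (poincare_duality hD f generic fdata id' hg) => L dL.
have [s [es ss]] := mnm_seq (L + L)%MM.
rewrite mdegD dL in ss.
have sd : (d < size s)%N by rewrite ss; move: id; rewrite -addnn; lia.
have [v0 _] : exists v : V, True by case: (s) sd => // v; exists v.
pose M := (\sum_(v <- drop d.+1 s) mvar v)%MM.
have hs : (L + L = \sum_(v <- take d s) mvar v + (mvar (nth v0 s d) + M))%MM.
  rewrite es -{1}(cat_take_drop d s) big_cat /=; congr (_ + _)%MM.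
  by rewrite (drop_nth v0) // big_cons.
have dM : mdeg M = (d - i - i.+1)%N.
  have := congr1 mdeg hs; rewrite !mdegD dL mdeg1.
  have -> : mdeg (\sum_(v <- take d s) mvar v)%MM = d.
    rewrite mdeg_sum; under eq_bigr do rewrite mdeg1.
    by rewrite sum1_size size_take sd.
  by move: id; rewrite -addnn; move: (mdeg M) => *; lia.
apply: (@deg_sqr_eq0 (nth v0 s) (mvar (nth v0 s d) + M)%MM).
  rewrite hs addmC; congr (_ + _)%MM.
  by rewrite -(map_nth_iota0 v0 (ltnW sd)) big_map.
have E : deg (lform (a d) * g * (g * 'X_[M])) = 0.
  apply: (deg_in_ideal hD K2 fdata); last first.
    by rewrite [_ * (g * _)]mulrC; apply: (in_idealM (sphere_down_closed hD)).
  have -> : d = ((1 + i) + (i + (d - i - i.+1)))%N by move: id; rewrite -addnn; lia.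
  apply: dhomogM; first by apply: dhomogM => //; apply: lform_homog.
  by apply: dhomogM => //; rewrite -dM dhomogX.
(* Degrees of g^2 times monomials are constant along the coefficients of theta_d, so differentiating
   along one of these leaves only the term of its variable. *)
move/(congr1 (da d (nth v0 s d))): E; rewrite (der0 (da_ d _)).
have -> : lform (a d) * g * (g * 'X_[M]) = \sum_w a d w *: (g * g * 'X_[mvar w + M]).
  rewrite /lform !mulr_suml; apply: eq_bigr => w _.
  by rewrite -!scalerAl mpolyXD; congr (_ *: _); rewrite -!mulrA mulrC -!mulrA [_ * 'X_[mvar w]]mulrC.
rewrite linear_sum (der_sum (da_ d _)) (bigD1 (nth v0 s d)) //= big1 => [|w ws].
  by rewrite addr0 linearZ /= (derM (da_ d _)) (da_a data _ _ (leqnn d) (leqnn d)) !eqxx mul1r da_degM mulr0 addr0.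
by rewrite linearZ /= (derM (da_ d _)) (da_a data _ _ (leqnn d) (leqnn d)) eq_sym (negPf ws) andbF mul0r da_degM mulr0 addr0.
Qed.

End WeakLefschetz.

Lemma in_ideal_pihomog (V : finType) (L : fieldType) (D : {set {set V}}) (a : nat -> V -> L) k p i :
  in_ideal D a k p -> in_ideal D a k (pihomog mdeg i p).
Proof.
move=> [u hu]; exists (fun j => if i is i'.+1 then pihomog mdeg i' (u j) else 0) => m mD.
suff -> : \sum_(j < k) lform (a j) * (if i is i'.+1 then pihomog mdeg i' (u j) else 0) =
    pihomog mdeg i (\sum_(j < k) lform (a j) * u j).
  by rewrite -raddfB /= mcoeff_pihomog; case: ifP => // _; apply: hu.
rewrite raddf_sum /=; apply: eq_bigr => j _; case: (i) => [|i'].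
  by rewrite mulr0 pihomog0_lform.
by rewrite pihomog_lform.
Qed.

Lemma msup_neq0 (V : finType) (m : 'X_{1..#|V|}) : (0 < mdeg m)%N -> exists v, v \in msup m.
Proof.
have [s [-> <-]] := mnm_seq m; case: s => [//|v s] _; exists v.
by rewrite -mvar_le big_cons lem_addr.
Qed.

(** * The socle of the generic quotient *)

Section LevelOverK.
Variables (V : finType) (D : {set {set V}}) (d : nat).
Hypothesis hD : sphere d D.
Variables (K : fieldType) (f : {rmorphism 'F_2 -> K}).
Variables (a : nat -> V -> K) (p : nat -> K) (da : nat -> V -> K -> K) (dp : nat -> K -> K).
Hypothesis data : derivation_data d a p da dp.
Hypothesis ha : generic_forms d a.
Local Notation poly := {mpoly K[#|V|]}.
Implicit Types (F : {set V}) (v w : V) (m : 'X_{1..#|V|}).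

(** Write x_v y = theta_d z_v modulo the parameters. By the Lefschetz property x_w z_v = x_v z_w, so
    the z_v glue to one functional on degree d - j + 1, and the bound on missing faces makes it
    vanish on non-faces. An element w representing it satisfies z_v = x_v w, and then y = theta_d
    w. *)
Lemma level_generic j y : (j.+1.*2 < d)%N ->
  (forall F, missing_face D F -> (#|F| + j <= d)%N) -> y \is j.-homog ->
  (forall v, in_ideal D a d.+1 ('X_[mvar v] * y)) -> in_ideal D a d.+1 y.
Proof.
move=> jd miss hy hv.
have K2 := char2_addrr f; have generic := generic_independent hD K2 data ha.
have dD := sphere_down_closed hD.
have [pt [dual [vol [fdata idata]]]] := facet_data_exists D K2 data ha.
have jd' : (j < d)%N by move: jd; rewrite -addnn; lia.
have hz v : exists z : poly, z \is j.-homog /\ in_ideal D a d ('X_[mvar v] * y - lform (a d) * z).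
  have [z hz] := (in_idealSP D a d _).1 (hv v); exists (pihomog mdeg j z).
  split; first exact: pihomogP.
  have := in_ideal_pihomog j.+1 hz; rewrite raddfB /= pihomog_lform pihomog_dE //.
  by rewrite -add1n; apply: dhomogM => //; rewrite -[1%N](mdeg1 (enum_rank v)) dhomogX.
have [z {}hz] := fin_all_exists hz.
pose deg := deg D d pt vol.
have degI i q : q \is i.-homog -> i = d -> in_ideal D a d q -> deg q = 0.
  by move=> hq id; rewrite id in hq; apply: (deg_in_ideal hD K2 fdata).
have hX v i q : q \is i.-homog -> 'X_[mvar v] * q \is i.+1.-homog.
  by move=> hq; rewrite -add1n; apply: dhomogM => //; rewrite -[1%N](mdeg1 (enum_rank v)) dhomogX.
have hzj v : z v \is j.-homog by case: (hz v).
have hzI v : in_ideal D a d ('X_[mvar v] * y - lform (a d) * z v) by case: (hz v).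
have sym v w : in_ideal D a d ('X_[mvar w] * z v - 'X_[mvar v] * z w).
  apply: (weak_lefschetz hD f data ha fdata idata jd).
    by apply: rpredB; apply: hX.
  have -> : lform (a d) * ('X_[mvar w] * z v - 'X_[mvar v] * z w) =
     'X_[mvar v] * ('X_[mvar w] * y - lform (a d) * z w) -
     'X_[mvar w] * ('X_[mvar v] * y - lform (a d) * z v).
    rewrite !mulrBr ['X_[mvar w] * ('X_[mvar v] * y)]mulrCA opprB [RHS]addrC addrA subrK.
    by rewrite ![lform _ * (_ * _)]mulrCA.
  by apply: (in_idealB dD); apply: (in_idealM dD); apply: hzI.
pose mu m := if [pick v in msup m] is Some v then deg (z v * 'X_[m - mvar v]) else 0.
have muE v m : (mdeg m).-1 = (d - j)%N -> v \in msup m -> mu m = deg (z v * 'X_[m - mvar v]).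
  move=> md vm; rewrite /mu; case: pickP => [w wm|/(_ v)]; last by rewrite vm.
  have [->//|wv] := eqVneq w v.
  have le : (mvar v <= m - mvar w)%MM.
    rewrite mvar_le inE mnmBE mnm1E (inj_eq enum_rank_inj) (negPf wv) subn0.
    by rewrite inE in vm.
  have E1 : (m - mvar w = mvar v + (m - mvar w - mvar v))%MM by rewrite addmC submK.
  have E2 : (m - mvar v = mvar w + (m - mvar w - mvar v))%MM.
    rewrite addmC; apply/mnmP => i; move/mnm_lepP/(_ i): le.
    have : (mvar w <= m)%MM by rewrite mvar_le.
    by move=> /mnm_lepP/(_ i); rewrite mnmDE !mnmBE; move: (m i) (mvar w i) (mvar v i) => *; lia.
  have dm : mdeg (m - mvar w - mvar v)%MM = (d - j - 1)%N.
    have := congr1 mdeg E1; have : (mvar w <= m)%MM by rewrite mvar_le.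
    by move=> /submK/(congr1 mdeg); rewrite !mdegD !mdeg1 => *; lia.
  apply/eqP; rewrite -subr_eq0 /deg -linearB /= -/deg E1 E2; apply/eqP.
  rewrite !mpolyXD !mulrA -mulrBl ![z _ * _]mulrC.
  apply: (degI (j.+1 + (d - j - 1))%N); last 2 first.
  - by lia.
  - by rewrite [_ * 'X_[_]]mulrC; apply: (in_idealM dD).
  apply: dhomogM; last by rewrite -dm dhomogX.
  by apply: rpredB; apply: hX.
have mu_nonface m : mdeg m = (d - j).+1 -> msup m \notin D -> mu m = 0.
  move=> md mD.
  (* Cancel a variable so that the support stays a non-face: a repeated variable, or else one
     outside a minimal non-face, which has at most d - j elements against the d - j + 1 of the
     support. *)
  suff [v vm vD] : exists2 v, v \in msup m & msup (m - mvar v)%MM \notin D.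
    rewrite (muE v) ?md //; apply: (deg_mul_nonface hD fdata) => //.
  have [/existsP[v vm]|sqf] := boolP [exists v : V, (1 < m (enum_rank v))%N].
    exists v; first by rewrite inE -lt0n ltnW.
    suff -> : msup (m - mvar v)%MM = msup m by [].
    apply/setP => w; rewrite !inE mnmBE mnm1E (inj_eq enum_rank_inj).
    by have [<-|_] := eqVneq v w; rewrite ?subn0 // -!lt0n subn_gt0 (ltnW vm).
  have [F /minsetP[FD Fmin] Fm] := minset_exists (P := fun s => s \notin D) mD.
  have cF : (#|F| + j <= d)%N.
    have [FV|/subsetPn[w wF]] := boolP (F \subset vertices D).
      apply: miss; split=> // s /andP[sF Fs]; apply: contraNT Fs => sD.
      by rewrite (Fmin s sD sF).
    (* Here w is not a vertex of D, so the minimal non-face is the single element w and is not a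
       missing face. *)
    rewrite inE => wD; have <- : [set w] = F by apply: Fmin; rewrite ?sub1set.
    by rewrite cards1 add1n.
  have cm : (mdeg m <= #|msup m|)%N.
    rewrite mdegE (reindex (@enum_rank V)) /=; last exact/onW_bij/enum_rank_bij.
    rewrite -[X in (_ <= X)%N]sum1_card [X in (_ <= X)%N]big_mkcond /=; apply: leq_sum => v _.
    rewrite inE; move: sqf; rewrite negb_exists => /forallP/(_ v).
    by case: (m _) => [|[]].
  have [v vm vF] : exists2 v, v \in msup m & v \notin F.
    by apply/subsetPn; apply: contraL (leqnn (d - j).+1) => /subset_leq_card; lia.
  exists v => //; apply: contra FD => h; apply: (dD _ _ h); apply/subsetP => w wF.
  rewrite inE mnmBE mnm1E (inj_eq enum_rank_inj); have := subsetP Fm w wF; rewrite inE.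
  by have [vw|_] := eqVneq v w; rewrite ?subn0 //; rewrite vw wF in vF.
have mu_form k m : (k < d)%N -> (mdeg m).+1 = (d - j).+1 ->
    \sum_v a k v * mu (mvar v + m)%MM = 0.
  move=> kd [md].
  have [v vm] : exists v, v \in msup m.
    by apply: msup_neq0; rewrite md; lia.
  have le : (mvar v <= m)%MM by rewrite mvar_le.
  rewrite -[RHS](degI (1 + (j + (d - j - 1)))%N (lform (a k) * (z v * 'X_[m - mvar v]))).
  - rewrite /lform mulr_suml /deg linear_sum; apply: eq_bigr => w _ /=.
    rewrite (muE v); last 2 first.
    + by rewrite mdegD mdeg1.
    + by move: vm; rewrite !inE mnmDE; lia.
    rewrite -scalerAl linearZ /= mulrCA -mpolyXD; congr (_ * Submission.deg _ _ _ _ (_ * 'X_[_])).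
    by rewrite addmBA.
  - apply: dhomogM; first exact: lform_homog.
    apply: dhomogM => //; have <- : mdeg (m - mvar v)%MM = (d - j - 1)%N.
      by have /submK/(congr1 mdeg) := le; rewrite mdegD mdeg1 md => <-; rewrite addnK.
    by rewrite dhomogX.
  - by lia.
  - by rewrite mulrC; apply: (in_idealM dD); apply: in_ideal_gen.
have [w [hw hXw rep]] : exists w : poly, [/\ lform (a d) * w \is j.-homog,
    forall v, 'X_[mvar v] * w \is j.-homog &
    forall m, mdeg m = (d - j).+1 -> deg (w * 'X_[m]) = mu m].
  (* For j = 0 the functional lives in degree d + 1, where it is zero, and w = 0; otherwise w has
     degree j - 1. *)
  have [j0|j0] := posnP j.
    exists 0; split=> [|v|m md]; [by rewrite mulr0 rpred0..|rewrite mul0r /deg linear0].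
    have ed : (d - j).+1 = d.+1 by rewrite j0 subn0.
    exact: esym (functional_above hD f generic mu_nonface mu_form ed md).
  have ed : ((d - j).+1 <= d)%N by lia.
  have [w hw rep] := degree_representation hD f generic fdata mu_nonface mu_form ed.
  have jE : (d - (d - j).+1).+1 = j by lia.
  exists w; split=> // [|v].
    by have := lform_homogM (a d) hw; rewrite jE.
  by have := hX _ v _ _ hw; rewrite jE.
have zw v : in_ideal D a d (z v - 'X_[mvar v] * w).
  apply: (poincare_duality hD f generic fdata (i := j)); first exact: ltnW.
    by apply: rpredB; [apply: hzj|apply: hXw].
  move=> m md; rewrite mulrBl linearB /= -/deg -mulrA ['X_[mvar v] * _]mulrC -mulrA -mpolyXD.
  rewrite rep ?mdegD ?mdeg1 ?md ?addn1 // (muE v) ?mdegD ?mdeg1 ?md ?addn1 //; last first.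
    by rewrite -mvar_le lem_addl.
  by rewrite addmK subrr.
(* Every test monomial contains some x_v, and x_v (y - theta_d w) = theta_d (z_v - x_v w) modulo the
   parameters. *)
have yw : in_ideal D a d (y - lform (a d) * w).
  apply: (poincare_duality hD f generic fdata (i := j)); first exact: ltnW.
    by apply: rpredB.
  move=> m md.
  have [v vm] : exists v, v \in msup m.
    apply: msup_neq0; rewrite md; lia.
  have le : (mvar v <= m)%MM by rewrite mvar_le.
  have dm : mdeg (m - mvar v)%MM = (d - j - 1)%N.
    by have /submK/(congr1 mdeg) := le; rewrite mdegD mdeg1 md => <-; rewrite addnK.
  apply: (degI (j + (d - j))%N); last 2 first.
  - by lia.
  - rewrite -(submK le) mpolyXD mulrCA; apply: (in_idealM dD); rewrite mulrC.
    have -> : 'X_[mvar v] * (y - lform (a d) * w) =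
        'X_[mvar v] * y - lform (a d) * z v + lform (a d) * (z v - 'X_[mvar v] * w).
      by rewrite !mulrBr addrA subrK mulrCA.
    by apply: in_idealD => //; apply: (in_idealM dD).
  by apply: dhomogM; [apply: rpredB | rewrite -md dhomogX].
apply/in_idealSP; by exists w.
Qed.

End LevelOverK.

(** * Generic rank *)

Lemma quotient_coordinates (L : fieldType) (Y : vectType L) (S U : {vspace Y}) :
  (U <= S)%VS -> exists f : 'Hom(Y, {ffun 'I_(\dim S - \dim U) -> L^o}),
    forall x, x \in S -> (f x == 0) = (x \in U).
Proof.
move=> US; pose C := (S :\: U)%VS.
have dC : \dim C = (\dim S - \dim U)%N.
  by have := dimv_cap_compl S U; rewrite (capv_idPr US) => <-; rewrite addKn.
rewrite -dC.
pose g (x : Y) : {ffun 'I_(\dim C) -> L^o} := [ffun l => coord (vbasis C) l (addv_pi1 S U x)].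
have gl : linear g.
  by move=> c x y; apply/ffunP => l; rewrite !ffunE linearP /= linearP.
pose gL := GRing.isLinear.Build _ _ _ _ g gl.
pose G : {linear Y -> {ffun 'I_(\dim C) -> L^o}} := HB.pack g gL.
exists (linfun G) => x xS; rewrite lfunE /=.
have xSU : x \in (S + U)%VS by rewrite (addv_idPl US).
have E := addv_pi1_pi2 xSU; have p1 : addv_pi1 S U x \in C := memv_pi C U x; have p2 := memv_pi2 S U x.
have -> : (g x == 0) = (addv_pi1 S U x == 0).
  apply/eqP/eqP => [/ffunP h|h].
    rewrite (coord_vbasis (v := addv_pi1 S U x) p1); apply: big1 => l _.
    by have := h l; rewrite !ffunE => ->; rewrite scale0r.
  by apply/ffunP => l; rewrite !ffunE h linear0.
apply/eqP/idP => [h|xU]; first by rewrite -E h add0r.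
have : addv_pi1 S U x \in (U :&: C)%VS.
  rewrite memv_cap p1 andbT (_ : addv_pi1 S U x = x - addv_pi2 S U x); last by rewrite -{2}E addrK.
  exact: rpredB.
have -> : (U :&: C)%VS = 0%VS.
  by apply/eqP; rewrite -subv0 -(capv_diff S U) capvC.
by rewrite memv0 => /eqP.
Qed.

Lemma leq_rank_transpose (L : fieldType) (I J : finType) (G : I -> J -> L) :
  (\dim <<[seq ([ffun j => G i j] : {ffun J -> L^o}) | i : I]>> <=
   \dim <<[seq ([ffun i => G i j] : {ffun I -> L^o}) | j : J]>>)%N.
Proof.
set C := <<[seq ([ffun i => G i j] : {ffun I -> L^o}) | j : J]>>%VS.
pose b := vbasis C.
pose w (t : 'I_(\dim C)) : {ffun J -> L^o} := [ffun j => coord b t [ffun i => G i j]].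
apply: (@leq_trans (\dim <<[seq w t | t : 'I_(\dim C)]>>)); last first.
  by apply: leq_trans (dim_span _) _; rewrite size_map -cardE card_ord.
apply: dimvS; apply/span_subvP => _ /mapP[i _ ->].
have -> : [ffun j => G i j] = \sum_(t < \dim C) b`_t i *: w t.
  apply/ffunP => j; rewrite ffunE sum_ffunE.
  have jC : [ffun i => G i j] \in C by apply/memv_span/map_f; rewrite mem_enum.
  have := congr1 (fun h : {ffun I -> L^o} => h i) (coord_vbasis jC).
  rewrite ffunE sum_ffunE => ->; apply: eq_bigr => t _.
  transitivity (coord b t [ffun i0 => G i0 j] * b`_t i); first exact: ffunE.
  by rewrite mulrC -[coord b t _](ffunE (fun j => coord b t [ffun i => G i j])); apply/esym/ffunE.
by apply: memv_suml => t _; apply/memvZ/memv_span/map_f; rewrite mem_enum.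
Qed.

Lemma rank_transpose (L : fieldType) (I J : finType) (G : I -> J -> L) :
  \dim <<[seq ([ffun j => G i j] : {ffun J -> L^o}) | i : I]>> =
  \dim <<[seq ([ffun i => G i j] : {ffun I -> L^o}) | j : J]>>.
Proof.
apply/eqP; rewrite eqn_leq leq_rank_transpose /=.
exact: (leq_rank_transpose (fun j i => G i j)).
Qed.

Lemma free_subset (L : fieldType) (Y : vectType L) (T : eqType) (f : T -> Y) (r : seq T) :
  exists s, [/\ {subset s <= r}, free (map f s) & size s = \dim <<map f r>>].
Proof.
suff [s [h1 h2 h3]] : exists s, [/\ {subset s <= r}, free (map f s) & <<map f s>>%VS = <<map f r>>%VS].
  by exists s; split=> //; rewrite -h3 (eqP h2) size_map.
elim: r => [|x r [s [h1 h2 h3]]]; first by exists [::]; split=> //; apply: nil_free.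
have [fx|fx] := boolP (f x \in <<map f s>>%VS).
  exists s; split=> //=; first by move=> y /h1 ys; rewrite inE ys orbT.
  by rewrite span_cons h3 addvC; apply/esym/addv_idPl; rewrite -h3 -memvE.
exists (x :: s); split=> /=.
- by move=> y; rewrite !inE => /orP[->//|/h1 ->]; rewrite orbT.
- by rewrite free_cons fx.
- by rewrite !span_cons h3.
Qed.

Section GenericRank.
Variables (n : nat) (I : finType) (T : eqType).
Local Notation P := {mpoly int[n]}.
Variable x : T -> I -> P.

Definition special (L : fieldType) (g : P -> L) (t : T) : {ffun I -> L^o} :=
  [ffun i => g (x t i)].

Lemma minor_of_free (L : fieldType) (r : nat) (y : 'I_r -> {ffun I -> L^o}) :
  free [seq y k | k : 'I_r] -> exists c : 'I_r -> I, \det (\matrix_(k, l) y k (c l)) != 0.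
Proof.
move=> fr; pose A := \matrix_(k < r, l < #|I|) (y k (enum_val l) : L).
have rA : row_free A.
  apply: inj_row_free => v vA.
  have sz : size [seq y k | k : 'I_r] = r by rewrite size_map -cardE card_ord.
  apply/rowP => k; rewrite mxE.
  have /freeP/(_ (fun k' => v 0 (cast_ord sz k'))) h : free (in_tuple [seq y k | k : 'I_r]) := fr.
  have /h h0 : \sum_(k' < size [seq y k | k : 'I_r])
      v 0 (cast_ord sz k') *: (in_tuple [seq y k | k : 'I_r])`_k' = 0.
    apply/ffunP => i; rewrite sum_ffunE ffunE.
    have vAi := congr1 (fun M : 'rV_#|I| => M 0 (enum_rank i)) vA; rewrite !mxE in vAi.
    rewrite -[RHS]vAi (reindex (cast_ord (esym sz))) /=; last first.
      by exists (cast_ord sz) => k' _; rewrite ?cast_ordK ?cast_ordKV.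
    apply: eq_bigr => k' _; rewrite mxE enum_rankK scale_ffunE cast_ordKV; congr (_ * _).
    by rewrite (nth_map k') -?cardE ?card_ord // nth_ord_enum.
  by rewrite -(h0 (cast_ord (esym sz) k)) cast_ordKV.
have fA : row_full A^T by rewrite /row_full mxrank_tr.
exists (fun l => enum_val (fullrankfun fA l)).
have := fullrowsub_unit fA; rewrite unitmxE unitfE -det_tr.
by congr (\det _ != 0); apply/matrixP => k l; rewrite !mxE.
Qed.

(** A nonzero minor of maximal size over K is the image of an integer polynomial q; wherever q stays
    nonzero the same rows remain independent. *)
Lemma generic_rank (K : fieldType) (psi : {rmorphism P -> K}) (r : seq T) :
  exists q, psi q != 0 /\ forall (F : fieldType) (g : {rmorphism P -> F}), g q != 0 ->
    (\dim <<map (special psi) r>> <= \dim <<map (special g) r>>)%N.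
Proof.
have [s [sr fs ss]] := free_subset (special psi) r.
pose e (k : 'I_(size s)) := tnth (in_tuple s) k.
have mapE (L : fieldType) (g : P -> L) : [seq special g (e k) | k : 'I_(size s)] = map (special g) s.
  transitivity (map (special g) (map e (enum 'I_(size s)))); first by rewrite -map_comp.
  by rewrite (map_tnth_enum (in_tuple s)).
have [c hc] : exists c : 'I_(size s) -> I, \det (\matrix_(k, l) special psi (e k) (c l)) != 0.
  by apply: minor_of_free; rewrite mapE.
exists (\det (\matrix_(k, l) x (e k) (c l))); split.
  rewrite -det_map_mx; move: hc; congr (\det _ != 0).
  by apply/matrixP => k l; rewrite !mxE ffunE.
move=> F g; rewrite -det_map_mx => dg; rewrite -ss.
suff fg : free (map (special g) s).
  rewrite -[X in (X <= _)%N](size_map (special g)) -(eqP fg); apply: dimvS.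
  by apply: sub_span => _ /mapP[t ts ->]; apply/map_f/sr.
rewrite -mapE; set X := [seq _ | _ : _].
have sz : size X = size s by rewrite size_map -cardE card_ord.
apply/(@freeP _ _ _ (in_tuple X)) => v hv k.
pose u : 'rV[F]_(size s) := \row_l v (cast_ord (esym sz) l).
have u0 : u *m (\matrix_(k, l) special g (e k) (c l)) = 0.
  apply/rowP => l; rewrite !mxE.
  have := congr1 (fun h : {ffun I -> F^o} => h (c l)) hv; rewrite sum_ffunE ffunE => hvl.
  rewrite -[RHS]hvl [RHS](reindex (cast_ord (esym sz))) /=; last first.
    by exists (cast_ord sz) => k' _; rewrite ?cast_ordK ?cast_ordKV.
  apply: eq_bigr => k' _; rewrite !mxE scale_ffunE; congr (_ * _).
  by rewrite (nth_map k') -?cardE ?card_ord // nth_ord_enum.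
have uM : \matrix_(k, l) special g (e k) (c l) \in unitmx.
  rewrite unitmxE unitfE; move: dg; congr (\det _ != 0).
  by apply/matrixP => k' l; rewrite !mxE ffunE.
have := congr1 (mulmx^~ (invmx (\matrix_(k, l) special g (e k) (c l)))) u0.
rewrite mulmxK // mul0mx => /rowP/(_ (cast_ord sz k)); rewrite !mxE.
by rewrite cast_ordK.
Qed.

End GenericRank.

Lemma base_expansion (b k : nat) (u w : nat -> nat) :
  (forall i, u i < b)%N -> (forall i, w i < b)%N ->
  (\sum_(i < k) u i * b ^ i = \sum_(i < k) w i * b ^ i)%N -> forall i, (i < k)%N -> u i = w i.
Proof.
elim: k u w => // k IH u w hu hw; rewrite !big_ord_recl !expn0 !muln1 => E.
have step f : (\sum_(i < k) f (bump 0 i) * b ^ bump 0 i = b * \sum_(i < k) f i.+1 * b ^ i)%N.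
  by rewrite big_distrr; apply: eq_bigr => i _; rewrite /bump add1n expnS mulnCA.
rewrite !step in E; have b0 : (0 < b)%N by apply: leq_trans (hu 0%N).
have e0 : u 0%N = w 0%N.
  have := congr1 (modn^~ b) E.
  by rewrite /= (addnC (u _)) (addnC (w _)) ![(b * _)%N]mulnC !modnMDl !modn_small.
move: E; rewrite e0 => /addnI/eqP; rewrite eqn_pmul2l // => /eqP E.
by case=> [//|i]; rewrite ltnS; apply: (IH (fun i => u i.+1) (fun i => w i.+1)).
Qed.

(** Kronecker substitution: x_i = t^(b^i), with b above all exponents, sends distinct monomials to
    distinct powers of t, and a nonzero polynomial in t has a non-root among the natural numbers. *)
Lemma nonvanishing_point (R : numDomainType) (n : nat) (q : {mpoly int[n]}) : q != 0 ->
  exists x : 'I_n -> R, mmap intr x q != 0.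
Proof.
move=> q0; pose b := msize q.
have db m : m \in msupp q -> forall i, (m i < b)%N.
  move=> mq i; apply: leq_ltn_trans (msize_mdeg_lt mq).
  by rewrite mdegE (bigD1 i) //= leq_addr.
pose e (m : 'X_{1..n}) := (\sum_(i < n) m i * b ^ i)%N.
have ei m m' : m \in msupp q -> m' \in msupp q -> e m = e m' -> m = m'.
  move=> hm hm' E; apply/mnmP => i.
  pose u (l : 'X_{1..n}) k := if insub k is Some k' then l k' : nat else 0%N.
  have ub l : l \in msupp q -> forall k, (u l k < b)%N.
    move=> hl k; rewrite /u; case: insubP => [k' _ _|_]; first exact: db.
    exact: leq_ltn_trans (db l hl i).
  have := @base_expansion b n (u m) (u m') (ub m hm) (ub m' hm') _ i (ltn_ord i).
  rewrite /u valK; apply; move: E; rewrite /e => E.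
  by under eq_bigr do rewrite valK; under [RHS]eq_bigr do rewrite valK.
pose Q : {poly R} := \sum_(m <- msupp q) (q@_m)%:~R *: 'X^(e m).
have [m0 hm0] : exists m, m \in msupp q.
  by have := mlead_supp q0; exists (mlead q).
have Q0 : Q != 0.
  apply/eqP => h; have := congr1 (fun p : {poly R} => p`_(e m0)) h.
  rewrite coef0 coef_sum (bigD1_seq m0) //= big1_seq => [|m /andP[mm0 mq]].
    rewrite addr0 coefZ coefXn eqxx mulr1 => /eqP; rewrite intr_eq0.
    by rewrite mcoeff_eq0 hm0.
  rewrite coefZ coefXn; case: eqP => [E|_]; last by rewrite mulr0.
  by rewrite (ei m m0 mq hm0 (esym E)) eqxx in mm0.
have [t ht] : exists t : R, Q.[t] != 0.
  pose s : seq R := [seq k%:R | k <- iota 0 (size Q)].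
  have : ~~ all (root Q) s.
    apply/negP => h; have := max_poly_roots Q0 h.
    rewrite map_inj_uniq ?iota_uniq; last by move=> i j /eqP; rewrite eqr_nat => /eqP.
    by rewrite size_map size_iota ltnn => /(_ isT).
  by move=> /allPn[t _ ht]; exists t.
exists (fun i => t ^+ (b ^ i)); move: ht; congr (_ != 0).
rewrite /Q horner_sum /mmap; apply: eq_bigr => m _.
rewrite hornerZ hornerXn /mmap1 /e -[in LHS]prodrXr; congr (_ * _).
by apply: eq_bigr => i _; rewrite mulnC exprM.
Qed.

(** * Pseudo-powers and Macaulay bounds *)

Section Cascade.
Local Open Scope nat_scope.
Implicit Types (i n a b c : nat).

Definition is_top i a n := [/\ i <= n.+1, 'C(n, i) <= a & a < 'C(n.+1, i)].

Definition ctop i a : nat := \max_(n < a + i | 'C(n, i) <= a) n.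

(** Macaulay's pseudo-power, computed along the greedy cascade. *)
Fixpoint upper i a : nat :=
  if i is i'.+1 then 'C((ctop i a).+1, i.+1) + upper i' (a - 'C(ctop i a, i)) else 0.

(** Green's operator: each C(n_k, k) of the cascade becomes C(n_k - 1, k). It will bound the
    monomials of a stable set that avoid one variable. *)
Fixpoint lower i a : nat :=
  if i is i'.+1 then 'C((ctop i a).-1, i) + lower i' (a - 'C(ctop i a, i)) else 0.

Lemma leq_binl i m n : m <= n -> 'C(m, i) <= 'C(n, i).
Proof. by move=> mn; apply: leq_bin2l. Qed.

Lemma bin_lower n i : n.+1 <= 'C(n + i.+1, i.+1).
Proof.
elim: i => [|i IH]; first by rewrite addn1 bin1.
by apply: leq_trans IH _; rewrite [n + i.+2]addnS binS leq_addl.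
Qed.

Lemma ctopP i a : is_top i.+1 a (ctop i.+1 a).
Proof.
have h n : 'C(n, i.+1) <= a -> n < a + i.+1.
  move=> h; rewrite ltnNge; apply/negP => an.
  by have := leq_trans (leq_binl i.+1 an) h; have := bin_lower a i; lia.
have lo n : 'C(n, i.+1) <= a -> n <= ctop i.+1 a.
  by move=> hn; apply: (leq_bigmax_cond (Ordinal (h _ hn))).
split.
- by rewrite ltnS; apply: lo; rewrite bin_small.
- rewrite /ctop; apply: (big_ind (fun n => 'C(n, i.+1) <= a)) => //.
  by move=> x y hx hy; rewrite /maxn; case: ifP.
- by rewrite ltnNge; apply/negP => /lo; rewrite ltnn.
Qed.

Lemma top_uniq i a n m : is_top i.+1 a n -> is_top i.+1 a m -> n = m.
Proof.
move=> [_ h1 h2] [_ h3 h4]; apply/eqP; rewrite eqn_leq; apply/andP; split; rewrite leqNgt.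
  by apply/negP => /(leq_binl i.+1) h; move: (leq_trans h h1); lia.
by apply/negP => /(leq_binl i.+1) h; move: (leq_trans h h3); lia.
Qed.

Lemma ctop_rec i a : exists n r, [/\ i <= n, r < 'C(n, i), a = 'C(n, i.+1) + r,
  upper i.+1 a = 'C(n.+1, i.+2) + upper i r & lower i.+1 a = 'C(n.-1, i.+1) + lower i r].
Proof.
have [h1 h2 h3] := ctopP i a; exists (ctop i.+1 a), (a - 'C(ctop i.+1 a, i.+1)).
by split=> //; rewrite ?subnKC // ltn_subLR // -binS.
Qed.

Lemma cascadeE i n r : i <= n -> r < 'C(n, i) ->
  upper i.+1 ('C(n, i.+1) + r) = 'C(n.+1, i.+2) + upper i r /\
  lower i.+1 ('C(n, i.+1) + r) = 'C(n.-1, i.+1) + lower i r.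
Proof.
move=> ni hr; have E : ctop i.+1 ('C(n, i.+1) + r) = n.
  by apply: (top_uniq (ctopP _ _)); split; rewrite ?leq_addr // binS ltn_add2l.
by rewrite /= E addKn.
Qed.

Lemma upper_bound i n a : a < 'C(n, i) -> upper i a <= 'C(n.+1, i.+1).
Proof.
elim: i n a => [|i IH] n a //.
have [m [r [im hr -> -> _]]] := ctop_rec i a => h.
have mn : m < n.
  by rewrite ltnNge; apply/negP => /(leq_binl i.+1) h'; move: h h'; lia.
apply: (@leq_trans 'C(m.+2, i.+2)); last exact: leq_binl.
by rewrite [X in _ <= X]binS leq_add2l; apply: IH.
Qed.

Lemma lower_bound i n a : a < 'C(n, i) -> lower i a <= 'C(n.-1, i).
Proof.
elim: i n a => [|i IH] n a //.
have [m [r [im hr -> _ ->]]] := ctop_rec i a => h.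
have mn : m < n.
  by rewrite ltnNge; apply/negP => /(leq_binl i.+1) h'; move: h h'; lia.
apply: (@leq_trans 'C(m, i.+1)); last by apply: leq_binl; lia.
case: m im hr {h mn} => [|m] im hr.
  by move: im; rewrite leqn0 => /eqP -> /=.
by rewrite [X in _ <= X]binS /= leq_add2l; have := IH _ _ hr.
Qed.

Lemma gap_bound i n a : a < 'C(n, i.+1) -> a - lower i.+1 a <= 'C(n.-1, i).
Proof.
elim: i n a => [|i IH] n a.
  have [m [r [im hr -> _ ->]]] := ctop_rec 0 a => h.
  by rewrite bin0 /= !bin1; move: hr; rewrite bin0; lia.
have [m [r [im hr -> _ ->]]] := ctop_rec i.+1 a => h.
have mn : m < n.
  by rewrite ltnNge; apply/negP => /(leq_binl i.+2) h'; move: h h'; lia.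
apply: (@leq_trans 'C(m, i.+1)); last by apply: leq_binl; lia.
case: m im hr {h mn} => [|m] // im hr.
have h1 : r - lower i.+1 r <= 'C(m, i) := IH _ _ hr; rewrite [m.+1.-1]/=.
have e1 := binS m i.+1; have e2 := binS m i; lia.
Qed.

Lemma upper_mono i a b : a <= b -> upper i a <= upper i b.
Proof.
elim: i a b => [|i IH] a b //.
have [m [r [im hr -> -> _]]] := ctop_rec i a.
have [n [s [jn hs -> -> _]]] := ctop_rec i b => h.
have mn : m <= n.
  by rewrite leqNgt; apply/negP => /(leq_binl i.+1); rewrite binS; lia.
move: mn; rewrite leq_eqVlt => /orP[/eqP mn|mn].
  by rewrite mn leq_add2l; apply: IH; move: h; rewrite mn leq_add2l.
apply: leq_trans (leq_addr _ _); apply: (@leq_trans 'C(m.+2, i.+2)); last exact: leq_binl.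
by rewrite [X in _ <= X]binS leq_add2l; apply: upper_bound.
Qed.

Lemma upper0 i : upper i 0 = 0.
Proof.
elim: i => // i IH; have [n [r [ni hr e0 -> _]]] := ctop_rec i 0.
have -> : r = 0 by lia.
rewrite IH addn0 bin_small // !ltnS leqNgt; apply/negP => h.
by have := bin_gt0 n i.+1; rewrite h; lia.
Qed.

Lemma upper_bin i n : i < n.+1 -> upper i.+1 'C(n, i.+1) = 'C(n.+1, i.+2).
Proof.
move=> ni; have h : 0 < 'C(n, i) by rewrite bin_gt0.
by have [] := cascadeE (ni : i <= n) h; rewrite addn0 upper0 addn0.
Qed.

(** The extreme value b = C(n, i) is no longer a remainder of the cascade; Pascal's rule then merges
    the sum into the single binomial C(n + 1, i + 1). *)
Lemma upper_add i n b : i <= n -> b <= 'C(n, i) -> (i = 0 -> b = 0) ->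
  upper i.+1 ('C(n, i.+1) + b) = 'C(n.+1, i.+2) + upper i b.
Proof.
move=> ni; rewrite leq_eqVlt => /orP[/eqP ->|hb _]; last by have [] := cascadeE ni hb.
case: i ni => [|i] ni h; first by have := h erefl; rewrite bin0.
rewrite -binS upper_bin; last by lia.
by rewrite upper_bin 1?binS // ltnW.
Qed.

Lemma lower1 a : lower 1 a = a.-1.
Proof.
have [n [r [_ hr ea _ ->]]] := ctop_rec 0 a.
by move: hr; rewrite ea bin0 ltnS leqn0 => /eqP ->; rewrite !bin1 !addn0.
Qed.

(** Pascal's rule in each term of the cascade. It recombines the bound for the multiples of a
    variable with the bound for the monomials avoiding it. *)
Lemma upper_lower i a : a + upper i.+1 (lower i.+1 a) <= upper i.+1 a.
Proof.
elim: i a => [|i IH] a.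
  have [n [r [ni hr -> -> ->]]] := ctop_rec 0 a; move: hr; rewrite bin0 ltnS leqn0 => /eqP ->; rewrite [lower 0 0]/= [upper 0 0]/= !addn0 !bin1.
  case: n ni => [|n] _; first by rewrite upper0.
  rewrite [n.+1.-1]/=; have := @upper_bin 0 n (ltn0Sn n); rewrite bin1 => ->.
  by rewrite [X in _ <= X]binS bin1 addnC.
have [n [r [ni hr -> -> ->]]] := ctop_rec i.+1 a.
case: n ni hr => [|n] // ni hr; rewrite [n.+1.-1]/=.
have hb : lower i.+1 r <= 'C(n, i.+1) := lower_bound hr.
have [ni'|ni'] := ltnP i n.
  rewrite (upper_add ni' hb) // [X in _ <= X + _]binS.
  by have := IH r; move: (upper i.+1 _) (upper _ r) => *; lia.
have ein : n = i by lia.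
rewrite ein binn ltnS leqn0 in hr; rewrite ein bin_small // leqn0 in hb.
by rewrite (eqP hb) (eqP hr) ein [X in X + 0 + _]bin_small // [X in upper _ (X + _)]bin_small // addn0 upper0.
Qed.

(** Made for [stable_avoid]: with c the number of multiples of x, an excess of monomials avoiding x
    makes c small, and the bound through one degree less then contradicts the excess. *)
Lemma lower_gap i a c : c < a - lower i.+1 a -> upper i (lower i c) <= lower i.+1 a.
Proof.
elim: i a c => [|i IH] a c //.
have [n [r [ni hr -> _ ->]]] := ctop_rec i.+1 a.
case: n ni hr => [|n] // ni hr h; rewrite [n.+1.-1]/=.
have {h} hc : c < 'C(n, i.+1) + (r - lower i.+1 r).
  by move: h; rewrite [X in X + r]binS [n.+1.-1]/=; lia.
have [cl|cg] := ltnP c 'C(n, i.+1).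
  apply: leq_trans (leq_addr _ _); apply: leq_trans (upper_mono _ (lower_bound cl)) _.
  case: n cl {ni hr hc} => [|n] // cl.
  have [ni|ni] := leqP i n; first by rewrite upper_bin.
  by rewrite [n.+1.-1]/= bin_small ?upper0 //; lia.
pose c' := c - 'C(n, i.+1); have cE : c = 'C(n, i.+1) + c' by rewrite subnKC.
have hc' : c' < r - lower i.+1 r by move: hc; rewrite {1}cE ltn_add2l.
have hg : r - lower i.+1 r <= 'C(n, i) := gap_bound hr.
have ni' : i <= n by lia.
have hc2 : c' < 'C(n, i) by apply: leq_trans hg.
rewrite cE (cascadeE ni' hc2).2.
have hb := lower_bound hc2.
have [nz|ni2] := posnP (n - i).
  have ein : i = n by lia.
  suff -> : 'C(n.-1, i.+1) + lower i c' = 0 by rewrite upper0.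
  rewrite bin_small; last by lia.
  apply/eqP; rewrite add0n -leqn0; have [n0|n0] := posnP n.
    by have -> : i = 0 by lia.
  by apply: leq_trans hb _; rewrite bin_small //; lia.
rewrite upper_add //; last 2 first.
- by lia.
- by move=> ->.
rewrite (ltn_predK (m := 0)); last by lia.
by rewrite leq_add2l; apply: IH.
Qed.

Fixpoint cascade i a : seq nat :=
  if i is i'.+1 then if a == 0 then [::] else
    ctop i a :: cascade i' (a - 'C(ctop i a, i)) else [::].

Lemma cascade_spec i a : 0 < a -> macaulay_rep i.+1 a (cascade i.+1 a) /\
  upper i.+1 a = \sum_(k < size (cascade i.+1 a)) 'C((nth 0 (cascade i.+1 a) k).+1, (i.+1 - k).+1).
Proof.
elim: i a => [|i IH] a a0; set c := cascade _ _.
  have [h1 h2 h3] := ctopP 0 a.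
  have cE : c = [:: ctop 1 a] by rewrite /c /= gtn_eqF.
  have ea : a = ctop 1 a by move: h2 h3; rewrite !bin1; lia.
  rewrite cE; split; last by rewrite big_ord_recl big_ord0 /= addn0.
  by split=> //=; rewrite ?big_ord_recl ?big_ord0 /= ?bin1 ?subn0; lia.
have [h1 h2 h3] := ctopP i.+1 a.
pose r := a - 'C(ctop i.+2 a, i.+2); pose t := ctop i.+2 a.
have cE : c = t :: cascade i.+1 r by rewrite /c [cascade]lock /= -lock /= gtn_eqF.
have hr : r < 'C(t, i.+1) by rewrite /r ltn_subLR // -binS.
have ti : i.+2 <= t.
  rewrite ltnNge; apply/negP => h; move: h3; rewrite -/t.
  have := @leq_binl i.+2 t.+1 i.+2 h; rewrite binn; lia.
have [r0|r0] := posnP r.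
  have cE1 : c = [:: t] by rewrite cE r0.
  have ea : a = 'C(t, i.+2) by rewrite -[LHS](subnKC h2) -/r r0 addn0.
  have -> : upper i.+2 a = 'C(t.+1, i.+3) by rewrite -[LHS]/('C(t.+1, i.+3) + upper i.+1 r) r0 upper0 addn0.
  by rewrite cE1; split; rewrite ?big_ord_recl ?big_ord0 /= ?addn0 ?subn0 //; split; rewrite ?big_ord_recl ?big_ord0 /= ?addn0 ?subn0 ?andbT //; lia.
have [[s1 s2 s3 s4] s5] := IH r r0.
have ne : cascade i.+1 r = ctop i.+1 r :: behead (cascade i.+1 r) by rewrite /= gtn_eqF.
have tt : ctop i.+1 r < t.
  have [_ h _] := ctopP i r; rewrite ltnNge; apply/negP => /(leq_binl i.+1); lia.
rewrite -[upper i.+2 a]/('C(t.+1, i.+3) + upper i.+1 r) s5 cE.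
move: (cascade i.+1 r) s1 s2 s3 s4 ne => s s1 s2 s3 s4 ne.
split; first split.
- by case/andP: s1 => _ /=.
- by move: s2; rewrite ne /= tt.
- by move: s3; rewrite ne /= subSS.
- rewrite [size (t :: s)]/= big_ord_recl /= subn0 -[LHS](subnKC h2) -/r -/t {1}s4; congr addn.
rewrite [size (t :: s)]/= big_ord_recl /= subn0; congr addn.
Qed.

Lemma pseudo_power_upper i a : pseudo_power i.+1 a (upper i.+1 a).
Proof.
have [->|a0] := posnP a; first by left; rewrite upper0.
by right; have [h e] := cascade_spec i a0; exists (cascade i.+1 a).
Qed.

End Cascade.

Section WeightedSums.
Variables (T : eqType).
Local Open Scope nat_scope.

Lemma leq_sum_subset (s1 s2 : seq T) (w : T -> nat) : uniq s1 -> {subset s1 <= s2} ->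
  \sum_(x <- s1) w x <= \sum_(x <- s2) w x.
Proof.
elim: s1 s2 => [|x s1 IH] s2; first by rewrite big_nil.
move=> /= /andP[xs us] h; have x2 : x \in s2 by apply: h; rewrite mem_head.
rewrite big_cons (perm_big _ (perm_to_rem x2)) big_cons leq_add2l IH // => y ys.
apply: rem_mem; last by apply: h; rewrite inE ys orbT.
by apply: contraNneq xs => <-.
Qed.

End WeightedSums.

(** * Compression and Macaulay's bound for sets of monomials *)

Section Multicomplex.
Variables (n B : nat).
Local Open Scope nat_scope.
Local Notation mon := 'X_{1..n}.
Implicit Types (S T : pred mon) (m : mon) (k j x : 'I_n).

Definition monomials : seq mon := map (@bmnm n B) (enum {: 'X_{1..n < B}}).

Lemma mem_monomials m : (m \in monomials) = (mdeg m < B).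
Proof.
apply/mapP/idP => [[m' _ ->]|mB]; first exact: bmdeg.
by exists (BMultinom mB); rewrite ?mem_enum.
Qed.

Lemma monomials_uniq : uniq monomials.
Proof. by rewrite map_inj_uniq ?enum_uniq //; apply: val_inj. Qed.

Definition wsum (w : mon -> nat) S : nat := \sum_(m <- monomials | S m) w m.
Definition cnt S : nat := wsum (fun=> 1) S.

Lemma cntE S : cnt S = count S monomials.
Proof. by rewrite /cnt /wsum sum1_count. Qed.

Lemma cnt_gt0 S : 0 < cnt S -> exists m, S m.
Proof. by rewrite cntE -has_count => /hasP[m _ Sm]; exists m. Qed.

Lemma cnt_ex S m : mdeg m < B -> S m -> 0 < cnt S.
Proof. by move=> mB Sm; rewrite cntE -has_count; apply/hasP; exists m; rewrite ?mem_monomials. Qed.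

Lemma wsum_lt (w w' : mon -> nat) S m0 : (forall m, S m -> w m <= w' m) ->
  mdeg m0 < B -> S m0 -> w m0 < w' m0 -> wsum w S < wsum w' S.
Proof.
move=> le m0B Sm0 lt; rewrite /wsum big_mkcond [X in _ < X]big_mkcond /=.
rewrite !(bigD1_seq m0) ?mem_monomials ?monomials_uniq //= Sm0 -addSn.
by apply: leq_add => //; apply: leq_sum => m _; case: ifP => // /le.
Qed.

Lemma wsum_inj w S T (f : mon -> mon) :
  (forall m, mdeg m < B -> S m -> mdeg (f m) < B /\ T (f m)) ->
  (forall m m', S m -> S m' -> f m = f m' -> m = m') ->
  wsum (fun m => w (f m)) S <= wsum w T.
Proof.
move=> fT fi; rewrite /wsum -[X in X <= _]big_filter -[X in _ <= X]big_filter -(big_map f xpredT w).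
apply: leq_sum_subset.
  rewrite map_inj_in_uniq ?filter_uniq ?monomials_uniq // => m m'.
  by rewrite !mem_filter => /andP[h _] /andP[h' _]; apply: fi.
move=> z /mapP[m]; rewrite mem_filter mem_monomials => /andP[Sm mB] ->.
by have [h1 h2] := fT m mB Sm; rewrite mem_filter h2 mem_monomials.
Qed.

Lemma cnt_inj S T (f : mon -> mon) :
  (forall m, mdeg m < B -> S m -> mdeg (f m) < B /\ T (f m)) ->
  (forall m m', S m -> S m' -> f m = f m' -> m = m') -> cnt S <= cnt T.
Proof. exact: (@wsum_inj (fun=> 1)). Qed.

Lemma count_sub_in (A : eqType) (P Q : pred A) (s : seq A) :
  (forall q, q \in s -> P q -> Q q) -> count P s <= count Q s.
Proof.
elim: s => //= q s IH h; apply: leq_add.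
  by have := h q (mem_head _ _); case: (P q) => // ->.
by apply: IH => r rs; apply: h; rewrite inE rs orbT.
Qed.

(** If some exponent q0 is missing, keep the exponents below q0 and lower those above by one. The
    minimum covers the case where none is missing. *)
Lemma shadow_count (P Q : pred nat) e :
  (forall q, q <= e -> P q -> Q q) -> (forall q, q <= e -> P q.+1 -> Q q) ->
  minn (count P (iota 0 e.+2)) e.+1 <= count Q (iota 0 e.+1).
Proof.
move=> h1 h2; have [/allP al|/allPn[q0]] := boolP (all P (iota 0 e.+2)).
  apply: leq_trans (geq_minr _ _) _.
  suff /eqP -> : count Q (iota 0 e.+1) == size (iota 0 e.+1) by rewrite size_iota.
  rewrite -all_count.
  apply/allP => q; rewrite mem_iota add0n => /andP[_ qe]; apply: h1 => //.
  by apply: al; rewrite mem_iota; lia.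
rewrite mem_iota add0n => /andP[_ q0e] Pq0; apply: leq_trans (geq_minl _ _) _.
have -> : iota 0 e.+2 = iota 0 q0 ++ q0 :: iota q0.+1 (e.+1 - q0).
  have {1}-> : e.+2 = q0 + (e.+1 - q0).+1 by lia.
  by rewrite iotaD.
have -> : iota 0 e.+1 = iota 0 q0 ++ iota q0 (e.+1 - q0).
  have {1}-> : e.+1 = q0 + (e.+1 - q0) by lia.
  by rewrite iotaD.
rewrite !count_cat /= (negPf Pq0) add0n; apply: leq_add.
  by apply: count_sub_in => q; rewrite mem_iota => qe; apply: h1; lia.
rewrite -[q0.+1]add1n iotaDl count_map; apply: count_sub_in => q /=.
by rewrite mem_iota => qe; apply: h2; lia.
Qed.

Section Compression.
Variables (x j : 'I_n).
Hypothesis xj : x != j.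

Definition setq m q : mon :=
  [multinom (if k == x then m x + m j - q else if k == j then q else m k) | k < n].

Definition fiber S m : seq nat := [seq q <- iota 0 (m x + m j).+1 | S (setq m q)].

(** On each line of monomials with a fixed sum of the exponents of x and j, the set is replaced by
    the initial segment of the same size, which moves exponents from j to x. *)
Definition compress S : pred mon := fun m => m j < size (fiber S m).

Lemma setqE m q k : setq m q k = if k == x then m x + m j - q else if k == j then q else m k.
Proof. by rewrite mnmE. Qed.

Lemma setqx m q : setq m q x = m x + m j - q.
Proof. by rewrite setqE eqxx. Qed.

Lemma setqj m q : setq m q j = q.
Proof. by rewrite setqE eqxx eq_sym (negPf xj). Qed.

Lemma setq_id m : setq m (m j) = m.
Proof. by apply/mnmP => k; rewrite setqE addnK; case: eqP => [->|] //; case: eqP => [->|]. Qed.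

Lemma setqK m q r : q <= m x + m j -> setq (setq m q) r = setq m r.
Proof.
move=> qe; apply/mnmP => k; rewrite !setqE !eqxx [j == x]eq_sym (negPf xj).
by rewrite subnK //; case: eqP => // _; case: eqP.
Qed.

Lemma fiber_setq S m q : q <= m x + m j -> fiber S (setq m q) = fiber S m.
Proof.
move=> qe; rewrite /fiber setqx setqj subnK //; apply: eq_filter => r.
by rewrite setqK.
Qed.

Lemma mdeg_setq m q : q <= m x + m j -> mdeg (setq m q) = mdeg m.
Proof.
move=> qe; have : (setq m q + (U_(x) *+ m x + U_(j) *+ m j) =
  m + (U_(x) *+ (m x + m j - q) + U_(j) *+ q))%MM.
  apply/mnmP => k; rewrite !mnmDE !mulmnE !mnm1E setqE.
  rewrite ![_ == k]eq_sym; case: (eqVneq k x) => [->|kx]; first by rewrite (negPf xj); lia.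
  by case: (eqVneq k j) => [->|kj]; lia.
by move/(congr1 mdeg); rewrite !mdegD !mdegMn !mdeg1 => E; lia.
Qed.

Lemma mem_fiber S m q : (q \in fiber S m) = (q <= m x + m j) && S (setq m q).
Proof. by rewrite mem_filter mem_iota add0n ltnS andbC. Qed.

Lemma fiber_uniq S m : uniq (fiber S m).
Proof. exact/filter_uniq/iota_uniq. Qed.

Lemma index_fiber S m q : q \in fiber S m ->
  index q (fiber S m) = count (fun r => S (setq m r)) (iota 0 q).
Proof.
rewrite mem_fiber => /andP[qe Sq]; rewrite /fiber.
have -> : (m x + m j).+1 = q + (m x + m j - q).+1 by lia.
rewrite iotaD add0n filter_cat index_cat mem_filter mem_iota add0n ltnn !andbF /= Sq /=.
by rewrite eqxx addn0 size_filter.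
Qed.

Lemma index_fiber_leq S m q : q \in fiber S m -> index q (fiber S m) <= q.
Proof. by move=> h; rewrite index_fiber // -[X in _ <= X](size_iota 0) count_size. Qed.

Definition expand S m := setq m (nth 0 (fiber S m) (m j)).

Lemma nth_fiber S m r : r < size (fiber S m) ->
  [/\ nth 0 (fiber S m) r \in fiber S m, nth 0 (fiber S m) r <= m x + m j & r <= nth 0 (fiber S m) r].
Proof.
move=> h; have h1 := mem_nth 0 h; split=> //; first by move: h1; rewrite mem_fiber => /andP[].
by rewrite -{1}(index_uniq 0 h (fiber_uniq S m)) index_fiber_leq.
Qed.

Lemma expand_inj S m m' : compress S m -> compress S m' -> expand S m = expand S m' -> m = m'.
Proof.
move=> h h'; have [q1 q2 q3] := nth_fiber h; have [r1 r2 r3] := nth_fiber h'.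
rewrite /expand => E; have F : fiber S m = fiber S m'.
  by rewrite -(fiber_setq S q2) E fiber_setq.
have : m j = m' j.
  have e := congr1 (fun l : mon => l j) E; rewrite !setqj in e.
  have e1 := index_uniq 0 h (fiber_uniq S m); have e2 := index_uniq 0 h' (fiber_uniq S m').
  by rewrite -{1}e1 e F e2.
move=> ej; rewrite -(setq_id m) -(setqK (m j) q2) E setqK // ej setq_id //.
Qed.

Lemma expand_mem S m : compress S m -> S (expand S m).
Proof. by move=> /nth_fiber[]; rewrite mem_fiber => /andP[]. Qed.

Lemma wsum_compress (w : mon -> nat) S : wsum (fun m => w (expand S m)) (compress S) <= wsum w S.
Proof.
apply: wsum_inj => [m mB h|]; last exact: expand_inj.
by split; [rewrite mdeg_setq //; case: (nth_fiber h) | apply: expand_mem].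
Qed.

Lemma cnt_compress_leq S : cnt (compress S) <= cnt S.
Proof. exact: (@wsum_compress (fun=> 1)). Qed.

Definition contract S m := setq m (index (m j) (fiber S m)).

Lemma contract_mem S m : S m -> compress S (contract S m).
Proof.
move=> Sm; have h : m j \in fiber S m by rewrite mem_fiber leq_addl setq_id.
rewrite /compress /contract setqj fiber_setq ?index_mem //.
exact: leq_trans (index_fiber_leq h) (leq_addl _ _).
Qed.

Lemma contractK S m : S m -> expand S (contract S m) = m.
Proof.
move=> Sm; have h : m j \in fiber S m by rewrite mem_fiber leq_addl setq_id.
have le : index (m j) (fiber S m) <= m x + m j.
  exact: leq_trans (index_fiber_leq h) (leq_addl _ _).
by rewrite /expand /contract setqj fiber_setq // setqK // nth_index // setq_id.
Qed.

Lemma cnt_compress_geq S : cnt S <= cnt (compress S).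
Proof.
apply: (@cnt_inj _ _ (contract S)) => [m mB Sm|m m' h h' E].
  split; last exact: contract_mem.
  rewrite mdeg_setq //; have h : m j \in fiber S m by rewrite mem_fiber leq_addl setq_id.
  exact: leq_trans (index_fiber_leq h) (leq_addl _ _).
by rewrite -(contractK h) E contractK.
Qed.

(** For a variable x or j the two fibres lie on lines of consecutive lengths and compare by
    [shadow_count]; for any other variable they compare point by point. Initial segments are nested
    as soon as their sizes are ordered. *)
Lemma compress_shadow S T : (forall m k, T (m + U_(k))%MM -> S m) ->
  forall m k, compress T (m + U_(k))%MM -> compress S m.
Proof.
move=> TS m k; rewrite /compress.
have [/orP kxj|] := boolP ((k == x) || (k == j)).
  have key : minn (size (fiber T (m + U_(k))%MM)) (m x + m j).+1 <= size (fiber S m).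
    rewrite /fiber !size_filter.
    have -> : ((m + U_(k))%MM x + (m + U_(k))%MM j).+1 = (m x + m j).+2.
      by rewrite !mnmDE !mnm1E; case: kxj => /eqP ->; rewrite eqxx ?(negPf xj) ?[j == x]eq_sym ?(negPf xj); lia.
    have E q : q <= m x + m j ->
        setq (m + U_(k))%MM q = (setq m q + U_(x))%MM /\
        setq (m + U_(k))%MM q.+1 = (setq m q + U_(j))%MM.
      have kk : (k == x) + (k == j) = 1.
        by case: kxj => /eqP ->; rewrite eqxx ?(negPf xj) ?[j == x]eq_sym ?(negPf xj).
      have kl l : l != x -> l != j -> (k == l) = false.
        by move=> lx lj; case: kxj => /eqP ->; rewrite eq_sym; apply: negPf.
      have jx : (j == x) = false by rewrite eq_sym; apply: negPf.
      move=> qe; split; apply/mnmP => l; rewrite mnmDE !setqE !mnmDE !mnm1E ![_ == l]eq_sym.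
        case: (eqVneq l x) => [_|lx] /=; first by lia.
        by case: (eqVneq l j) => [_|lj] /=; rewrite ?addn0 // [l == k]eq_sym kl // addn0.
      case: (eqVneq l x) => [->|lx] /=; first by rewrite (negPf xj); lia.
      by case: (eqVneq l j) => [_|lj] /=; rewrite ?addn1 // [l == k]eq_sym kl // addn0.
    apply: shadow_count => q qe; have [e1 e2] := E q qe.
      by rewrite e1; apply: TS.
    by rewrite e2; apply: TS.
  move=> h; apply: leq_trans key; rewrite leq_min; apply/andP; split; last by lia.
  by apply: leq_ltn_trans h; rewrite mnmDE leq_addr.
rewrite negb_or => /andP[kx kj]; rewrite mnmDE mnm1E (negPf kj) addn0 => h.
apply: leq_trans h _; rewrite /fiber !size_filter !mnmDE !mnm1E (negPf kx) (negPf kj) !addn0.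
apply: sub_count => q; suff -> : setq (m + U_(k))%MM q = (setq m q + U_(k))%MM by apply: TS.
apply/mnmP => l; rewrite mnmDE !setqE !mnmDE !mnm1E (negPf kx) (negPf kj) !addn0.
case: (eqVneq l x) => [->|lx]; first by rewrite (negPf kx) addn0.
by case: (eqVneq l j) => [->|lj]; rewrite ?(negPf kj) ?addn0.
Qed.

End Compression.

Definition homogeneous_in (A : {set 'I_n}) i S := forall m, S m ->
  mdeg m = i /\ forall k, k \notin A -> m k = 0.

Definition shadow_in T S := forall m k, T (m + U_(k))%MM -> S m.

Definition divide x S : pred mon := fun m => S (m + U_(x))%MM.
Definition avoid x S : pred mon := fun m => S m && (m x == 0).

Lemma cnt_split x i A S : homogeneous_in A i S -> i < B ->
  cnt S = cnt (avoid x S) + cnt (divide x S).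
Proof.
move=> hS iB; rewrite /cnt /wsum (bigID (fun m => m x == 0)) /=; congr (_ + _).
have sub m : m x != 0 -> (m - U_(x) + U_(x))%MM = m.
  by move=> mx; apply: submK; apply/mnm_lepP => k; rewrite mnm1E; case: eqP => // <-; rewrite lt0n.
apply/eqP; rewrite eqn_leq; apply/andP; split.
  apply: (@cnt_inj _ _ (fun m => m - U_(x))%MM) => [m mB /andP[Sm mx]|m m' /andP[_ h] /andP[_ h'] E].
    rewrite /divide sub //; split=> //.
    by have := congr1 mdeg (sub m mx); rewrite mdegD mdeg1 => E; lia.
  by rewrite -(sub m h) E sub.
apply: (@cnt_inj _ _ (fun m => m + U_(x))%MM) => [m mB Sm|m m' _ _ /addIm //].
have Sm' : S (m + U_(x))%MM := Sm.
rewrite Sm' mnmDE mnm1E eqxx addn1; split=> //.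
by have [-> _] := hS _ Sm'.
Qed.

Definition macaulay_bound A := forall i S T, i.+2 < B ->
  homogeneous_in A i.+1 S -> homogeneous_in A i.+2 T -> shadow_in T S ->
  cnt T <= upper i.+1 (cnt S).

Definition stable x S := forall m j, S m -> j != x -> 0 < m j ->
  S (m - U_(j) + U_(x))%MM.

Lemma stable_divide x S : stable x S -> stable x (divide x S).
Proof.
move=> st m j Sm jx mj; have := st _ j Sm jx; rewrite mnmDE mnm1E eq_sym (negPf jx) addn0 => /(_ mj).
rewrite /divide; congr S; apply/mnmP => k; rewrite !(mnmDE, mnmBE, mnm1E).
by case: (eqVneq j k) => [<-|jk] /=; lia.
Qed.

Lemma homogeneous_divide x A i S : homogeneous_in A i.+1 S -> homogeneous_in A i (divide x S).
Proof.
move=> hS m Sm; have [dm mA] := hS _ Sm; split.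
  by move: dm; rewrite mdegD mdeg1 addn1 => -[].
by move=> k kA; have := mA k kA; rewrite mnmDE; lia.
Qed.

Lemma homogeneous_avoid x A i S : homogeneous_in A i S -> homogeneous_in (A :\ x) i (avoid x S).
Proof.
move=> hS m /andP[Sm mx]; have [dm mA] := hS _ Sm; split=> // k.
by rewrite in_setD1 negb_and negbK => /orP[/eqP ->|/mA //]; apply/eqP.
Qed.

Lemma avoid_shadow x S T : shadow_in T S -> shadow_in (avoid x T) (avoid x S).
Proof.
move=> TS m k /andP[Tm]; rewrite /avoid (TS _ _ Tm) mnmDE addn_eq0.
by case/andP.
Qed.

Lemma stable_shadow x S : stable x S -> shadow_in (avoid x S) (divide x S).
Proof.
move=> st m k /andP[Sm]; rewrite mnmDE mnm1E addn_eq0 eqb0 => /andP[_ kx].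
have := st _ k Sm kx; rewrite mnmDE mnm1E eqxx addn1 => /(_ isT).
by rewrite addmK.
Qed.

(** Green's bound, by induction on the degree. By stability the divisors of the monomials avoiding x
    lie in [divide x S], so Macaulay's bound in one variable fewer and the induction hypothesis
    bound them; by [lower_gap] this excludes an excess. *)
Lemma stable_avoid x A i S : macaulay_bound (A :\ x) -> i.+1 < B ->
  homogeneous_in A i.+1 S -> stable x S -> cnt (avoid x S) <= lower i.+1 (cnt S).
Proof.
move=> IH; elim: i S => [|i IHi] S iB hS st.
  have hd := homogeneous_divide (x := x) hS.
  have [s0|s0] := posnP (cnt (avoid x S)); first by rewrite s0.
  suff : 0 < cnt (divide x S) by rewrite lower1 (cnt_split x hS iB); lia.
  have [m /andP[Sm mx]] := cnt_gt0 s0; apply: (@cnt_ex _ 0%MM); first by rewrite mdeg0; lia.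
  have [dm _] := hS _ Sm.
  have [j mj] : exists j, 0 < m j.
    apply/existsP; apply: contraT; rewrite negb_exists => /forallP h; move: dm; rewrite mdegE.
    by rewrite big1 // => k _; have := h k; rewrite -eqn0Ngt => /eqP.
  have jx : j != x by apply: contraTneq mj => ->; rewrite (eqP mx).
  have := st _ j Sm jx mj; rewrite /divide; congr S; congr (_ + _)%MM.
  apply/eqP; rewrite -mdeg_eq0; have : (U_(j) <= m)%MM.
    by apply/mnm_lepP => k; rewrite mnm1E; case: eqP => // <-.
  by move=> /submK/(congr1 mdeg); rewrite mdegD mdeg1 dm; lia.
rewrite leqNgt; apply/negP => h.
have hd := homogeneous_divide (x := x) hS; have sd := stable_divide st.
have b1 := IHi _ (ltnW iB) hd sd.
have b2 : cnt (avoid x S) <= upper i.+1 (cnt (avoid x (divide x S))).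
  apply: IH => //; try exact: homogeneous_avoid.
  move=> m k Sk; apply/andP; split; first exact: stable_shadow st m k Sk.
  by case/andP: Sk => _; rewrite mnmDE addn_eq0 => /andP[].
have b3 := leq_trans b2 (upper_mono i.+1 b1).
have E := cnt_split x hS iB.
have := @lower_gap i.+1 (cnt S) (cnt (divide x S)).
by move: h b3 E; move: (cnt S) (cnt (avoid x S)) (cnt _) => *; lia.
Qed.

Lemma mdeg_pair x j m : x != j -> m x + m j <= mdeg m.
Proof.
move=> xj; rewrite mdegE (bigD1 x) //= leq_add2l (bigD1 j) ?leq_addr //.
by rewrite eq_sym.
Qed.

Lemma homogeneous_compress x j (A : {set 'I_n}) i S : x != j -> x \in A -> j \in A ->
  homogeneous_in A i S -> homogeneous_in A i (compress x j S).
Proof.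
move=> xj xA jA hS m hm; have [q1 q2 _] := nth_fiber xj hm.
have [dm mA] := hS _ (expand_mem xj hm); rewrite mdeg_setq // in dm; split=> // k kA.
have := mA k kA; rewrite setqE; case: eqP => [kx|_]; first by rewrite kx xA in kA.
by case: eqP => [kj|_ //]; rewrite kj jA in kA.
Qed.

Lemma compress_decreases x j (A : {set 'I_n}) i S m : x != j -> i < B -> homogeneous_in A i S -> S m ->
  0 < m j -> ~~ S (m - U_(j) + U_(x))%MM ->
  wsum (fun l => mdeg l - l x) (compress x j S) < wsum (fun l => mdeg l - l x) S.
Proof.
move=> xj iB hS Sm mj Sn.
apply: leq_trans (wsum_compress xj (fun l => mdeg l - l x) S).
have hf : m j \in fiber x j S m by rewrite mem_fiber // leq_addl setq_id.
have idx : index (m j) (fiber x j S m) < m j.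
  rewrite index_fiber // -[X in _ < X](size_iota 0) ltn_neqAle count_size andbT -all_count.
  apply/allPn; exists (m j).-1; first by rewrite mem_iota; lia.
  apply: contra Sn; congr S; apply/mnmP => k; rewrite setqE !(mnmDE, mnmBE, mnm1E).
  rewrite ![_ == k]eq_sym; case: (eqVneq k x) => [->|kx]; first by rewrite (negPf xj); lia.
  by case: (eqVneq k j) => [->|kj]; lia.
apply: (@wsum_lt _ _ _ (contract x j S m)).
- move=> l hl; have [q1 q2 q3] := nth_fiber xj hl.
  by rewrite /expand mdeg_setq // setqx; apply: leq_sub2l; lia.
- rewrite mdeg_setq //; first by have [-> _] := hS _ Sm.
  exact: leq_trans (ltnW idx) (leq_addl _ _).
- exact: contract_mem.
rewrite contractK // /contract setqx (mdeg_setq xj); last first.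
  exact: leq_trans (ltnW idx) (leq_addl _ _).
by move: (mdeg_pair m xj) idx mj; move: (index _ _) => *; lia.
Qed.

(** Outer induction on the number of variables, inner on the total exponent of S outside x, which a
    nontrivial compression towards x lowers. Once S is stable, T splits into the multiples of x, at
    most as many as S has elements, and the monomials avoiding x, controlled by Green's bound;
    [upper_lower] adds the two. *)
Lemma macaulay_bound_all A : macaulay_bound A.
Proof.
move: {2}#|A| (erefl #|A|) => N; elim: N A => [|N IHN] A cA i S T iB hS hT TS.
  rewrite [cnt T]cntE (eq_count (a2 := pred0)) ?count_pred0 // => m; apply/negP => Tm.
  have [dm mA] := hT _ Tm; move: dm; rewrite mdegE big1 // => k _; apply: mA.
  by rewrite (cards0_eq cA) inE.
have [x xA] : exists x, x \in A by apply/set0Pn; rewrite -card_gt0 cA.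
have {}IHN : macaulay_bound (A :\ x) by apply: IHN; move: cA; rewrite (cardsD1 x) xA => -[].
move: {2}(wsum _ S).+1 (ltnSn (wsum (fun l => mdeg l - l x) S)) => M.
elim: M S T hS hT TS => // M IHM S T hS hT TS; rewrite ltnS => SM.
pose bad m := [exists j, [&& S m, j != x, 0 < m j & ~~ S (m - U_(j) + U_(x))%MM]].
have [/hasP[m _ /existsP[j /and4P[Sm jx mj Sn]]]|nb] := boolP (has bad monomials).
  have xj : x != j by rewrite eq_sym.
  have jA : j \in A by apply: contraTT mj => jA; have [_ ->] := hS _ Sm; rewrite ?jA.
  apply: leq_trans (cnt_compress_geq xj T) _.
  apply: leq_trans (upper_mono _ (cnt_compress_leq xj S)).
  apply: IHM; [exact: homogeneous_compress..|exact: compress_shadow|].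
  apply: leq_trans SM; exact: compress_decreases xj (ltnW iB) hS Sm mj Sn.
have st : stable x S.
  move=> m j Sm jx mj; apply: contraNT nb => Sn; apply/hasP; exists m.
    by rewrite mem_monomials; have [-> _] := hS _ Sm; apply: ltnW.
  by apply/existsP; exists j; rewrite Sm jx mj.
rewrite (cnt_split x hT) //.
have b1 : cnt (divide x T) <= cnt S.
  by apply: (@cnt_inj _ _ id) => // m mB /TS.
have b2 : cnt (avoid x T) <= upper i.+1 (cnt (avoid x S)).
  by apply: IHN => //; [exact: homogeneous_avoid..|exact: avoid_shadow].
have b3 := upper_mono i.+1 (stable_avoid IHN (ltnW iB) hS st).
have b4 := upper_lower i (cnt S).
by rewrite addnC; apply: leq_trans b4; apply: leq_add => //; apply: leq_trans b3.
Qed.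

End Multicomplex.

(** * Standard monomials of graded modules *)

Section StandardElements.
Variables (L : fieldType) (Y : vectType L) (T : eqType) (f : T -> Y) (key : T -> nat).

(** The greedy basis: an element is kept when its vector is not spanned by those of smaller key,
    like the standard monomials of an initial ideal. *)
Definition standard (r : seq T) (x : T) : bool :=
  f x \notin <<[seq f y | y <- r & (key y < key x)%N]>>%VS.

Lemma count_standard (r : seq T) : uniq r -> {in r &, injective key} ->
  count (standard r) r = \dim <<map f r>>.
Proof.
move=> ur kr.
suff h t : count (standard r) [seq x <- r | (key x < t)%N] =
    \dim <<[seq f x | x <- r & (key x < t)%N]>>.
  have := h (\max_(x <- r) (key x)).+1.
  have -> : [seq x <- r | (key x < (\max_(x <- r) key x).+1)%N] = r; last by [].
  by apply/all_filterP/allP => x xr; rewrite ltnS; apply: leq_bigmax_seq.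
elim: t => [|t IH]; first by rewrite (eq_filter (a2 := pred0)) // filter_pred0 span_nil dimv0.
have [/hasP[x xr /eqP kx]|/hasPn nt] := boolP (has (fun x => key x == t) r); last first.
  have E : [seq x <- r | (key x < t.+1)%N] = [seq x <- r | (key x < t)%N].
    by apply: eq_in_filter => x /nt kx; rewrite ltnS leq_eqVlt (negPf kx).
  by rewrite E.
set s := [seq y <- r | (key y < t)%N] in IH *.
have pe : perm_eq [seq y <- r | (key y < t.+1)%N] (x :: s).
  apply: uniq_perm; rewrite /= ?filter_uniq ?andbT ?mem_filter ?kx ?ltnn //.
  move=> y; rewrite inE !mem_filter ltnS leq_eqVlt andb_orl; congr (_ || _).
  apply/andP/eqP => [[/eqP ky yr]|->]; first by apply: kr => //; rewrite ky kx.
  by rewrite kx eqxx.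
rewrite (seq.permP pe) /= IH.
have -> : <<map f [seq y <- r | (key y < t.+1)%N]>>%VS = <<f x :: map f s>>%VS.
  by apply: eq_span; apply: perm_mem; rewrite (perm_map f pe).
rewrite /standard kx -/s span_cons; case: (boolP (f x \in _)) => fx /=.
  by rewrite addvC; congr (\dim _); apply/esym/addv_idPl; rewrite -memvE.
rewrite add1n; have := dimv_disjoint_sum (U := <[f x]>) (V := <<map f s>>).
rewrite dim_vline => ->; last first.
  apply/eqP; rewrite -subv0; apply/subvP => z /memv_capP[/vlineP[c ->] cf].
  have [->|c0] := eqVneq c 0; first by rewrite scale0r mem0v.
  by have := memvZ c^-1 cf; rewrite scalerA mulVf // scale1r (negPf fx).
by case: eqP => [x0|_]; [rewrite x0 mem0v in fx | rewrite add1n].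
Qed.

End StandardElements.

Section MacaulayModule.
Variables (L : fieldType) (n c k B : nat).
Hypothesis kB : (k.+3 < B)%N.
Local Notation mon := 'X_{1..n}.
Local Notation gen := ('I_c * mon)%type.
Variables (Y Y' : vectType L) (e : gen -> Y) (e' : gen -> Y').

Definition gens i : seq gen :=
  [seq (l, m) | l <- enum 'I_c, m <- [seq m <- monomials n B | mdeg m == i]].

(** Linear dependences in degree k + 1 persist after multiplication by a variable. In this form the
    module structure covers quotients and duals alike. *)
Hypothesis e_mul : forall (r : seq gen) (l : 'I_c) (m : mon) (v : 'I_n),
  {subset r <= gens k.+1} -> mdeg m = k.+1 ->
  e (l, m) \in <<map e r>>%VS ->
  e' (l, m + U_(v))%MM \in <<[seq e' (x.1, x.2 + U_(v))%MM | x <- r]>>%VS.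

(** Base-[B] digits encode a monomial order by numbers, with the component as leading digit.
    Multiplication by a variable adds a constant to the key, so the order is compatible with it. *)
Let enc (m : mon) : nat := (\sum_(i < n) m i * B ^ i)%N.
Let key (x : gen) : nat := (x.1 * B ^ n.+1 + enc x.2)%N.

Lemma mem_gens i x : (x \in gens i) = (mdeg x.2 == i) && (mdeg x.2 < B)%N.
Proof.
apply/allpairsP/idP => [[[l m] /= [_]]|h].
  by rewrite mem_filter mem_monomials => h ->.
by exists x; rewrite /= mem_enum mem_filter mem_monomials h; case: x {h}.
Qed.

Lemma gens_uniq i : uniq (gens i).
Proof.
apply: allpairs_uniq; rewrite ?enum_uniq ?filter_uniq ?monomials_uniq //.
by move=> [? ?] [? ?].
Qed.

Let mB (m : mon) j : (mdeg m < B)%N -> (m j < B)%N.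
Proof. by apply: leq_ltn_trans; rewrite mdegE (bigD1 j) //= leq_addr. Qed.

Let enc_lt m : (mdeg m < B)%N -> (enc m < B ^ n.+1)%N.
Proof.
move=> hm; rewrite /enc; have B0 : (0 < B)%N by apply: leq_trans kB.
apply: leq_ltn_trans (_ : (\sum_(i < n) B.-1 * B ^ i < _)%N).
  by apply: leq_sum => i _; rewrite leq_mul2r; apply/orP; right; have := mB i hm; lia.
have h j : ((\sum_(i < j) B.-1 * B ^ i).+1 = B ^ j)%N.
  elim: j => [|j IH]; first by rewrite big_ord0.
  rewrite big_ord_recr /= -addSn IH expnS -[X in (_ = X * _)%N](prednK B0).
  by rewrite [RHS]mulSn.
by rewrite h leq_pexp2l.
Qed.

Let enc_inj m m' : (mdeg m < B)%N -> (mdeg m' < B)%N -> enc m = enc m' -> m = m'.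
Proof.
move=> hm hm' E; apply/mnmP => i.
pose u (l : mon) j := if insub j is Some j' then l j' : nat else 0%N.
have ub l : (mdeg l < B)%N -> forall j, (u l j < B)%N.
  move=> hl j; rewrite /u; case: insubP => [j' _ _|_]; first exact: mB.
  by apply: leq_trans kB.
have := @base_expansion B n (u m) (u m') (ub m hm) (ub m' hm') _ i (ltn_ord i).
rewrite /u valK; apply; move: E; rewrite /enc => E.
by under eq_bigr do rewrite valK; under [RHS]eq_bigr do rewrite valK.
Qed.

Let key_inj i : {in gens i &, injective key}.
Proof.
move=> [l m] [l' m']; rewrite !mem_gens /= => /andP[_ hm] /andP[_ hm'] E.
have B0 : (0 < B ^ n.+1)%N by rewrite expn_gt0; apply/orP; left; apply: leq_trans kB.
have e1 := congr1 (divn^~ (B ^ n.+1)%N) E; rewrite /key /= !divnMDl // !divn_small ?enc_lt // !addn0 in e1.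
have el : l = l' by apply: val_inj.
by move: E; rewrite /key /= el => /addnI/(enc_inj hm hm') ->.
Qed.

Let keyD l m v : key (l, m + U_(v))%MM = (key (l, m) + B ^ v)%N.
Proof.
rewrite /key /= -addnA; congr addn; rewrite /enc.
under eq_bigr do rewrite mnmDE mnm1E mulnDl.
rewrite big_split /=; congr addn; rewrite (bigD1 v) //= eqxx mul1n big1 ?addn0 // => i iv.
by rewrite eq_sym (negPf iv).
Qed.

Local Notation var := ('I_c * 'I_n)%type.
(** Each free generator gets its own copy of the variables: monomials of the free module become
    ordinary monomials, and divisors stay in the same component. This is injective in positive
    degrees, where the bound starts. *)
Definition embed (x : gen) : 'X_{1..#|{: var}|} :=
  [multinom (if (enum_val i).1 == x.1 then x.2 (enum_val i).2 else 0%N) | i < #|{: var}|].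

Lemma embedE x l v : embed x (enum_rank (l, v)) = if l == x.1 then x.2 v else 0%N.
Proof. by rewrite mnmE enum_rankK. Qed.

Lemma mdeg_embed x : mdeg (embed x) = mdeg x.2.
Proof.
rewrite !mdegE (reindex (@enum_rank _)) /=; last exact/onW_bij/enum_rank_bij.
rewrite (eq_bigr (fun z : var => if z.1 == x.1 then x.2 z.2 else 0%N)) => [|[l v] _]; last exact: embedE.
rewrite -(pair_bigA _ (fun l v => if l == x.1 then x.2 v else 0%N)) /= (bigD1 x.1) //= eqxx.
by rewrite [X in (_ + X)%N]big1 ?addn0 // => l /negPf lx; rewrite big1 // => v _; rewrite lx.
Qed.

Lemma embed_inj x y : (0 < mdeg x.2)%N -> embed x = embed y -> x = y.
Proof.
move=> x0 E; have h l v := congr1 (fun m : 'X_{1..#|{: var}|} => m (enum_rank (l, v))) E.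
have exy : x.1 = y.1.
  apply/eqP; apply: contraTT x0 => xy; rewrite -eqn0Ngt mdeg_eq0; apply/eqP/mnmP => v.
  by have := h x.1 v; rewrite /= !embedE eqxx (negPf xy) mnm0E.
case: x y exy h {x0 E} => [l m] [l' m'] /= -> h; congr pair; apply/mnmP => v.
by have := h l' v; rewrite /= !embedE /= eqxx.
Qed.

Definition std_pred (Z : vectType L) (h : gen -> Z) i : pred 'X_{1..#|{: var}|} :=
  fun M => has (fun x => (M == embed x) && standard h key (gens i) x) (gens i).

Lemma cnt_std (Z : vectType L) (h : gen -> Z) i : (0 < i < B)%N ->
  cnt B (std_pred h i) = \dim <<map h (gens i)>>.
Proof.
move=> /andP[i0 iB].
rewrite -(count_standard h (gens_uniq i) (@key_inj i)) cntE -!size_filter.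
rewrite -(size_map embed); apply/eqP; rewrite eqn_leq; apply/andP; split.
  apply: uniq_leq_size; first by rewrite filter_uniq // monomials_uniq.
  move=> M; rewrite mem_filter => /andP[/hasP[x xi /andP[/eqP -> sx]] _].
  by apply: map_f; rewrite mem_filter sx.
apply: uniq_leq_size.
  rewrite map_inj_in_uniq ?filter_uniq ?gens_uniq // => x y.
  rewrite !mem_filter !mem_gens => /andP[_ /andP[/eqP dx _]] _; apply: embed_inj.
  by rewrite dx.
move=> z /mapP[x]; rewrite mem_filter => /andP[sx xi] ->.
rewrite mem_filter mem_monomials mdeg_embed; move: (xi); rewrite mem_gens => /andP[_ ->].
by rewrite andbT; apply/hasP; exists x; rewrite ?eqxx.
Qed.

(** Divisors of standard elements are standard: if (l, m) depends on generators with smaller keys,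
    so does (l, m x_v), by [e_mul] and the additivity of keys. The bound for sets of monomials then
    applies. *)
Lemma macaulay_module :
  (\dim <<map e' (gens k.+2)>> <= upper k.+1 (\dim <<map e (gens k.+1)>>))%N.
Proof.
rewrite -!cnt_std; try by lia.
have hom (Z : vectType L) (h : gen -> Z) i : homogeneous_in setT i (std_pred h i).
  move=> M /hasP[x]; rewrite mem_gens => /andP[/eqP dx _] /andP[/eqP -> _].
  by rewrite mdeg_embed; split=> // j; rewrite inE.
apply: (macaulay_bound_all (A := setT)); try exact: hom; first by lia.
move=> M j /hasP[[l m] xg /andP[/eqP E sx]].
have [[l' v] ej] : exists z, j = enum_rank z by exists (enum_val j); rewrite enum_valK.
have := congr1 (fun m : 'X_{1..#|{: var}|} => m j) E.
rewrite /= {3}ej embedE mnmDE mnm1E eqxx addn1 /=; case: eqP => // el mv.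
have le : (U_(v) <= m)%MM.
  by apply/mnm_lepP => i; rewrite mnm1E; case: eqP => // <-; rewrite -mv.
have dm : mdeg m = k.+2 by move: xg; rewrite mem_gens => /andP[/eqP].
have dm' : mdeg (m - U_(v))%MM = k.+1.
  by have := congr1 mdeg (submK le); rewrite mdegD mdeg1 dm addn1 => -[].
apply/hasP; exists (l, m - U_(v))%MM; first by rewrite mem_gens /= dm' eqxx /=; lia.
apply/andP; split.
  apply/eqP; apply: (@addIm _ U_(j)%MM); rewrite E; apply/mnmP => i.
  rewrite mnmDE -[i]enum_valK; case: (enum_val i) => l1 v1.
  rewrite !embedE /= mnmBE !mnm1E ej (inj_eq enum_rank_inj) xpair_eqE el eq_sym.
  case: eqP => //= _; by have /mnm_lepP/(_ v1) := le; rewrite mnm1E => h; rewrite subnK.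
apply: contra sx => h.
have rk : {subset [seq y <- gens k.+1 | (key y < key (l, (m - U_(v))%MM))%N] <= gens k.+1}.
  by move=> x; rewrite mem_filter => /andP[].
have := e_mul v rk dm' h; rewrite submK // => /(subvP (sub_span _)) -> //.
move=> z /mapP[[l1 m1]]; rewrite mem_filter mem_gens /= => /andP[lt /andP[/eqP d1 _]] ->.
apply: (map_f e'); rewrite mem_filter mem_gens /= mdegD mdeg1 d1 addn1 eqxx /=.
rewrite keyD -(submK le) keyD ltn_add2r lt /=; lia.
Qed.

End MacaulayModule.

(** * Passage to real linear forms *)

Section Generically.
Variables (n : nat) (K : fieldType) (psi : {rmorphism {mpoly int[n]} -> K}).

Definition generically (Q : forall F : fieldType, {rmorphism {mpoly int[n]} -> F} -> Prop) : Prop :=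
  exists q, psi q != 0 /\ forall (F : fieldType) (g : {rmorphism {mpoly int[n]} -> F}),
    g q != 0 -> Q F g.

Lemma generically_and Q Q' : generically Q -> generically Q' ->
  generically (fun F g => Q F g /\ Q' F g).
Proof.
move=> [q [q0 h]] [q' [q0' h']]; exists (q * q'); split; first by rewrite rmorphM mulf_neq0.
move=> F g; rewrite rmorphM mulf_eq0 negb_or => /andP[gq gq'].
by split; [apply: h | apply: h'].
Qed.

Lemma generically_all m Q : (forall i : nat, (i < m)%N -> generically (Q i)) ->
  generically (fun F g => forall i : nat, (i < m)%N -> Q i F g).
Proof.
elim: m => [|m IH] h.
  by exists 1; split=> //; rewrite rmorph1 oner_neq0.
have [q [q0 hq]] := generically_and (IH (fun i im => h i (leqW im))) (h m (ltnSn m)).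
exists q; split=> // F g gq i; have [h1 h2] := hq F g gq.
by rewrite ltnS leq_eqVlt => /orP[/eqP ->|/h1].
Qed.

End Generically.

(** * Socle conditions as rank conditions *)

Section MultiplicationByVariables.
Variables (V : finType) (L : fieldType) (D : {set {set V}}) (B : nat).
Local Notation mon := 'X_{1..#|V| < B}.
Local Notation Y := {ffun mon -> L^o}.
Local Notation Z := {ffun V * mon -> L^o}.
Local Notation coefs := (coefs D B).

Definition mul_vars (c : Y) : Z := [ffun z => coefs ('X_[mvar z.1] * of_coefs c) z.2].

Fact mul_vars_is_linear : linear mul_vars.
Proof.
move=> t x y; apply/ffunP => z; rewrite [RHS]ffunE scale_ffunE !ffunE.
rewrite linearP /= mulrDr -scalerAr mcoeffD mcoeffZ.
by case: ifP => // _; rewrite scaler0 addr0.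
Qed.
HB.instance Definition _ := GRing.isLinear.Build L Y Z *:%R mul_vars mul_vars_is_linear.

Lemma linfun_mul_varsE c : linfun mul_vars c = mul_vars c.
Proof. exact: lfunE. Qed.

Definition insert v (c : Y) : Z := [ffun z => if z.1 == v then c z.2 else 0].

Fact insert_is_linear v : linear (insert v).
Proof.
move=> t x y; apply/ffunP => z; rewrite [RHS]ffunE scale_ffunE !ffunE.
by case: ifP => // _; rewrite scaler0 addr0.
Qed.
HB.instance Definition _ v := GRing.isLinear.Build L Y Z *:%R (insert v) (insert_is_linear v).

Lemma linfun_insertE v c : linfun (insert v) c = insert v c.
Proof. exact: lfunE. Qed.

End MultiplicationByVariables.

Section MultiplicationMap.
Variables (V : finType) (L : fieldType) (D : {set {set V}}) (a : nat -> V -> L) (B k i : nat).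
Hypothesis dD : down_closed D.
Hypothesis iB : (i.+1 < B)%N.
Local Notation poly := {mpoly L[#|V|]}.
Local Notation mon := 'X_{1..#|V| < B}.
Local Notation Y := {ffun mon -> L^o}.
Local Notation Z := {ffun V * mon -> L^o}.
Local Notation coefs := (coefs D B).
Local Notation sr_space := (sr_space L D B).
Local Notation ideal_space := (ideal_space D a B k).
Local Notation mul_vars := (mul_vars D (B := B)).

Definition power_space : {vspace Z} := (\sum_v linfun (insert v) @: ideal_space i.+1)%VS.

Lemma power_spaceP z : z \in power_space -> forall v, [ffun mu => z (v, mu)] \in ideal_space i.+1.
Proof.
move=> /memv_sumP[u hu ->] v.
have -> : [ffun mu => (\sum_w u w) (v, mu)] = \sum_w [ffun mu => u w (v, mu)] :> Y.
  by apply/ffunP => mu; rewrite ffunE !sum_ffunE; apply: eq_bigr => w _; rewrite ffunE.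
apply: memv_suml => w _; have /memv_imgP[c hc ->] := hu w isT; rewrite lfunE /=.
have [->|wv] := eqVneq w v.
  by rewrite (_ : [ffun mu => _] = c) //; apply/ffunP => mu; rewrite !ffunE eqxx.
rewrite (_ : [ffun mu => _] = 0) ?mem0v //; apply/ffunP => mu.
by rewrite !ffunE eq_sym (negPf wv).
Qed.

Lemma dim_power_space : \dim power_space = (#|V| * \dim (ideal_space i.+1))%N.
Proof.
have dir : directv (\sum_v linfun (insert v) @: ideal_space i.+1)%VS.
  apply/directv_sum_independent => u hu u0 v _.
  have /memv_imgP[c hc uv] := hu v isT; rewrite uv lfunE /=.
  apply/ffunP => z; rewrite !ffunE; case: eqP => // zv.
  have := congr1 (fun h : Z => h (v, z.2)) u0; rewrite sum_ffunE (bigD1 v) //= big1 => [|w wv].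
    by rewrite addr0 uv lfunE !ffunE eqxx.
  by have /memv_imgP[c' _ ->] := hu w isT; rewrite lfunE !ffunE /= eq_sym (negPf wv).
rewrite /power_space (directvP dir) /= -sum_nat_const; apply: eq_bigr => v _.
rewrite limg_dim_eq //; apply/eqP; rewrite -subv0; apply/subvP => c.
rewrite memv_cap memv_ker lfunE memv0 => /andP[_ /eqP h]; apply/eqP/ffunP => mu.
by have := congr1 (fun z : Z => z (v, mu)) h; rewrite !ffunE eqxx.
Qed.

Lemma mul_vars_in c : c \in sr_space i ->
  mul_vars c \in power_space <-> forall v, in_ideal D a k ('X_[mvar v] * of_coefs c).
Proof.
move=> cS; have ch := of_coefs_homog cS.
have vh v : 'X_[mvar v] * of_coefs c \is i.+1.-homog.
  by rewrite -add1n; apply: dhomogM => //; rewrite -[1%N](mdeg1 (enum_rank v)) dhomogX.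
split=> [/power_spaceP h v|h].
  apply/(ideal_spaceP a dD k iB (vh v)).
  rewrite (_ : coefs _ = [ffun mu => mul_vars c (v, mu)]) //.
  by apply/ffunP => mu; rewrite [RHS]ffunE [RHS]ffunE.
have -> : mul_vars c = \sum_v insert v (coefs ('X_[mvar v] * of_coefs c)).
  apply/ffunP => z; rewrite sum_ffunE (bigD1 z.1) //= big1 ?addr0 => [|v vz].
    by rewrite !ffunE eqxx.
  by rewrite !ffunE eq_sym (negPf vz).
apply: memv_sumr => v _; rewrite -lfunE; apply: memv_img.
exact: (ideal_spaceP a dD k iB (vh v)).2.
Qed.

Lemma dim_mul_vars : (\dim (power_space + linfun mul_vars @: sr_space i) +
    \dim (sr_space i :&: linfun mul_vars @^-1: power_space) =
  #|V| * \dim (ideal_space i.+1) + \dim (sr_space i))%N.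
Proof. by rewrite dim_add_img dim_power_space. Qed.

(** The preimage of [power_space] is the space of degree i elements that all variables send into the
    ideal. The condition is put in terms of dimensions because only ranks can be compared between
    specialisations. *)
Lemma mul_vars_preim :
  (forall y, y \is i.-homog -> (forall v, in_ideal D a k ('X_[mvar v] * y)) -> in_ideal D a k y) <->
  (\dim (sr_space i :&: linfun mul_vars @^-1: power_space) <= \dim (ideal_space i))%N.
Proof.
have iB' : (i < B)%N by apply: ltnW.
have sub : (ideal_space i <= sr_space i :&: linfun mul_vars @^-1: power_space)%VS.
  apply/subvP => c cI; have cS := subvP (ideal_space_sub D a B k i) _ cI.
  rewrite memv_cap cS -memv_preim lfunE /=; apply/(mul_vars_in cS) => v.
  apply: (in_idealM dD); apply/(ideal_spaceP a dD k iB' (of_coefs_homog cS)).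
  by rewrite (of_coefsK cS).
split=> [h|h y hy hv].
  apply: dimvS; apply/subvP => c; rewrite memv_cap -memv_preim lfunE /= => /andP[cS].
  move/(mul_vars_in cS) => hc; rewrite -(of_coefsK cS).
  by apply/(ideal_spaceP a dD k iB' (of_coefs_homog cS)); apply: h => //; apply: of_coefs_homog cS.
have E : (ideal_space i == sr_space i :&: linfun mul_vars @^-1: power_space)%VS.
  by rewrite eqEdim sub.
apply/(ideal_spaceP a dD k iB' hy); rewrite (eqP E).
have yS := coefs_sr_space D B hy.
rewrite memv_cap yS -memv_preim lfunE /=; apply/(mul_vars_in yS) => v.
have -> : of_coefs (coefs y) = y + (of_coefs (coefs y) - y) by rewrite addrC subrK.
rewrite mulrDr; apply: in_idealD => //; apply: (in_idealM dD); apply: in_ideal_sr.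
exact: of_coefs_coefs iB' hy.
Qed.

End MultiplicationMap.

Section Transfer.
Variables (V : finType) (D : {set {set V}}) (d B : nat).
Hypothesis dD : down_closed D.
Local Notation N := #|{: 'I_d.+1 * V}|.
Local Notation P := {mpoly int[N]}.
Local Notation mon := 'X_{1..#|V| < B}.
Local Notation gen := (nat * 'X_{1..#|V|})%type.

Definition coefvar j v : P := 'X_(enum_rank (inord j : 'I_d.+1, v)).

Definition gen_coef (t : gen) (mu : mon) : P :=
  if msup mu \in D then \sum_v (if (mvar v + t.2)%MM == mu then coefvar t.1 v else 0) else 0.

Definition gen_list k i : seq gen :=
  [seq (j, val m) | j <- iota 0 k, m <- [seq m : mon <- enum {: mon} | (mdeg m).+1 == i]].

(** Integral generators of [power_space] plus the image of [mul_vars]: [inl m] holds all the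
    products x_v m at once, [inr (v, t)] puts a generator of the ideal in component v. *)
Definition mul_coef (t : 'X_{1..#|V|} + V * gen) (z : V * mon) : P :=
  match t with
  | inl m => if (msup z.2 \in D) && ((mvar z.1 + m)%MM == z.2) then 1 else 0
  | inr (v, t) => if z.1 == v then gen_coef t z.2 else 0
  end.

Definition mul_list k i : seq ('X_{1..#|V|} + V * gen) :=
  map inl (map (@bmnm _ B) (face_monomials D B i)) ++
  [seq inr (v, t) | v <- enum V, t <- gen_list k i.+1].

Section Specialization.
Variables (L : fieldType) (g : {rmorphism P -> L}) (b : nat -> V -> L) (k i : nat).
Hypothesis hb : forall j v, (j < k)%N -> g (coefvar j v) = b j v.

Lemma ideal_space_special : ideal_space D b B k i = <<map (special gen_coef g) (gen_list k i)>>%VS.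
Proof.
suff -> : map (special gen_coef g) (gen_list k i) = ideal_gens D b B k i by [].
rewrite /ideal_gens /gen_list map_allpairs; apply/eq_in_allpairs => j m.
rewrite mem_iota add0n => /andP[_ jk] _; apply/ffunP => mu; rewrite !ffunE /gen_coef /=.
case: ifP => _; last by rewrite rmorph0.
rewrite rmorph_sum /lform mulr_suml linear_sum /=; apply: eq_bigr => v _ /=.
rewrite -scalerAl mcoeffZ -mpolyXD mcoeffX; case: eqP => _; last by rewrite rmorph0 mulr0.
by rewrite mulr1 hb.
Qed.

Lemma special_insert v t :
  special mul_coef g (inr (v, t)) = insert v (special gen_coef g t).
Proof. by apply/ffunP => z; rewrite !ffunE /=; case: ifP => // _; rewrite rmorph0. Qed.

End Specialization.

Lemma mul_space_special (L : fieldType) (g : {rmorphism P -> L}) (b : nat -> V -> L) k i :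
  (forall j v, (j < k)%N -> g (coefvar j v) = b j v) ->
  (power_space D b B k i + linfun (mul_vars D (B := B)) @: sr_space L D B i)%VS =
  <<map (special mul_coef g) (mul_list k i)>>%VS.
Proof.
move=> hb; rewrite /mul_list map_cat span_cat addvC; congr (_ + _)%VS.
  rewrite /sr_space limg_span -!map_comp; congr (<<_>>%VS); apply: eq_map => m /=.
  have e : of_coefs (delta L m) = 'X_[m] :> {mpoly L[#|V|]}.
    rewrite /of_coefs (bigD1 m) //= big1 => [|m' /negPf mm]; rewrite !ffunE ?mm ?scale0r //.
    by rewrite eqxx scale1r addr0.
  rewrite linfun_mul_varsE; apply/ffunP => z; rewrite !ffunE e -mpolyXD mcoeffX /=.
  case: ifP => _ /=; last by rewrite rmorph0.
  by case: eqP => _; rewrite ?rmorph1 ?rmorph0.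
apply/eqP; rewrite eqEsubv; apply/andP; split.
  apply/subv_sumP => v _; rewrite (ideal_space_special i.+1 hb) limg_span.
  apply/span_subvP => z /mapP[c /mapP[t tl ->] ->]; rewrite linfun_insertE -special_insert.
  by apply/memv_span/map_f/allpairsP; exists (v, t); rewrite mem_enum.
apply/span_subvP => z /mapP[x /allpairsP[[v t] /= [_ tl ->]] ->].
rewrite special_insert; apply: (subvP (sumv_sup v isT (subvv _))); rewrite -linfun_insertE; apply: memv_img.
by rewrite (ideal_space_special i.+1 hb); apply/memv_span/map_f.
Qed.

(** Where the chosen minors do not vanish, the real ideals are at least as large as those over K.
    The converse follows by induction on k from [hilb_step] over the reals and its exact form over
    K. With all dimensions equal, a rank of multiplication at least that over K leaves no room for a
    socle below degree s. *)
Lemma real_forms (R : numFieldType) (K : fieldType) (a : nat -> V -> K)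
    (psi : {rmorphism P -> K}) (s : nat) :
  (forall j v, (j <= d)%N -> psi (coefvar j v) = a j v) -> (s < B)%N ->
  (forall k i, (k <= d)%N -> (i < s)%N ->
    hilb D a B k i.+1 = (hilb D a B k.+1 i.+1 + hilb D a B k i)%N) ->
  (forall i y, (i < s)%N -> y \is i.-homog ->
    (forall v, in_ideal D a d.+1 ('X_[mvar v] * y)) -> in_ideal D a d.+1 y) ->
  exists b : nat -> V -> R,
    (forall i, (i <= s)%N -> hilb D b B d.+1 i = hilb D a B d.+1 i) /\
    (forall i y, (i < s)%N -> y \is i.-homog ->
      (forall v, in_ideal D b d.+1 ('X_[mvar v] * y)) -> in_ideal D b d.+1 y).
Proof.
move=> hpsi sB hK hL.
have G1 : generically psi (fun F g => forall k, (k < d.+2)%N -> forall i, (i < s.+1)%N ->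
    (\dim <<map (special gen_coef psi) (gen_list k i)>> <=
     \dim <<map (special gen_coef g) (gen_list k i)>>)%N).
  apply: generically_all => k _; apply: generically_all => i _.
  exact: generic_rank.
have G2 : generically psi (fun F g => forall i, (i < s)%N ->
    (\dim <<map (special mul_coef psi) (mul_list d.+1 i)>> <=
     \dim <<map (special mul_coef g) (mul_list d.+1 i)>>)%N).
  by apply: generically_all => i _; apply: generic_rank.
have [q [q0 hq]] := generically_and G1 G2.
have q0' : q != 0 by apply: contraNneq q0 => ->; rewrite rmorph0.
have [x hx] := nonvanishing_point R q0'.
pose g : {rmorphism P -> R} := mmap intr x.
have [h1 h2] := hq R g hx.
pose b j v := g (coefvar j v); exists b.
have hb j v : g (coefvar j v) = b j v by [].
have le k i : (k <= d.+1)%N -> (i <= s)%N ->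
    (\dim (ideal_space D a B k i) <= \dim (ideal_space D b B k i))%N.
  move=> kd is_; rewrite (@ideal_space_special _ psi a k i) => [|j v jk]; last first.
    by apply: hpsi; lia.
  by rewrite (@ideal_space_special _ g b k i) //; apply: h1.
have sr i : \dim (sr_space K D B i) = \dim (sr_space R D B i) by rewrite !dim_sr_space.
have hle k i : (k <= d.+1)%N -> (i <= s)%N -> (hilb D b B k i <= hilb D a B k i)%N.
  by move=> kd is_; rewrite /hilb sr leq_sub2l // le.
have heq k i : (k <= d.+1)%N -> (i <= s)%N -> hilb D b B k i = hilb D a B k i.
  elim: k i => [|k IH] i kd is_; first by rewrite !hilb0.
  case: i is_ => [|i] is_; first by rewrite hilb_deg0 [RHS]hilb_deg0 !hilb0.
  have e1 := hK k i kd is_; have e2 := hilb_step b dD k (leq_ltn_trans is_ sB : (i.+1 < B)%N).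
  have := hle k.+1 i.+1 kd is_.
  rewrite (IH i.+1 (ltnW kd) is_) (IH i (ltnW kd) (ltnW is_)) in e2; lia.
split=> [i is_|i y is_]; first exact: heq.
have iB : (i.+1 < B)%N := leq_ltn_trans is_ sB.
move: y; apply/(mul_vars_preim b d.+1 dD iB).
have hLi := (mul_vars_preim a d.+1 dD iB).1 (fun y => hL i y is_).
have dimJ j : (j <= s)%N -> \dim (ideal_space D b B d.+1 j) = \dim (ideal_space D a B d.+1 j).
  move=> js; have := heq d.+1 j (leqnn _) js; rewrite /hilb sr.
  have := dimvS (ideal_space_sub D a B d.+1 j); have := dimvS (ideal_space_sub D b B d.+1 j).
  by rewrite sr; move: (\dim _) (\dim _) (\dim _) => *; lia.
have eK := dim_mul_vars D a B d.+1 i; have eR := dim_mul_vars D b B d.+1 i.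
rewrite (@mul_space_special _ psi a) in eK => [|j v jd]; last exact: hpsi.
rewrite (@mul_space_special _ g b) // in eR.
have := h2 i is_; rewrite dimJ // in eR; rewrite dimJ ?(ltnW is_) //; rewrite sr in eK.
move: hLi eK eR; move: (\dim _) (\dim _) (\dim _) (\dim _) (\dim _) (\dim _) (\dim _) => *.
lia.
Qed.

End Transfer.

(** * Consequences for the Hilbert function *)

Section HilbertGeneric.
Variables (V : finType) (D : {set {set V}}) (d : nat).
Hypothesis hD : sphere d D.
Variables (K : fieldType) (f : {rmorphism 'F_2 -> K}).
Variables (a : nat -> V -> K) (p : nat -> K) (da : nat -> V -> K -> K) (dp : nat -> K -> K).
Hypothesis data : derivation_data d a p da dp.
Hypothesis ha : generic_forms d a.
Local Notation poly := {mpoly K[#|V|]}.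
Local Notation B := d.+2.
Local Notation mon := 'X_{1..#|V| < B}.
Local Notation Y := {ffun mon -> K^o}.
Local Notation coefs := (coefs D B).
Local Notation sr_space := (sr_space K D B).
Local Notation ideal_space := (ideal_space D a B d.+1).
Local Notation hilb := (hilb D a B d.+1).
Local Notation in_ideal := (in_ideal D a d.+1).

Let dD : down_closed D := sphere_down_closed hD.
Let K2 := char2_addrr f.
Let generic := generic_independent hD K2 data ha.

Lemma hilb_last i : (i.*2 < d)%N ->
  Submission.hilb D a B d i.+1 = (hilb i.+1 + Submission.hilb D a B d i)%N.
Proof.
move=> id; apply: (hilb_regular dD); first by move: id; rewrite -addnn; lia.
move=> y hy; have [pt [dual [vol [fdata idata]]]] := facet_data_exists D K2 data ha.
exact: (weak_lefschetz hD f data ha fdata idata id hy).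
Qed.

(** After d forms the Hilbert function is h; injectivity of theta_d below the middle turns it into
    first differences. *)
Lemma hilb_gnum i : (i.*2 <= d)%N -> (hilb i)%:Z = gnum d D i.
Proof.
case: i => [|i] id.
  rewrite hilb_deg0 hilb0 /face_monomials size_filter.
  have bm0 : (mdeg (0%MM : 'X_{1..#|V|}) < B)%N by rewrite mdeg0.
  rewrite (eq_count (a2 := pred1 (BMultinom bm0))).
    by rewrite count_uniq_mem ?enum_uniq // mem_enum.
  move=> m; rewrite /= -val_eqE /= mdeg_eq0 andbC; case: eqP => //= ->.
  by rewrite msup0; case: hD => -[].
have id' : (i.*2 < d)%N by move: id; rewrite doubleS; lia.
have id2 : (i < d)%N by move: id'; rewrite -addnn; lia.
have := hilb_last id'; rewrite /gnum !(hnum_hilb_poly hD) //; last by rewrite ltnW.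
have <- : (Submission.hilb D a B d i.+1)%:Z = (hilb_poly D d)`_i.+1.
  by apply: (hilb_sphere hD f generic); rewrite ltnS ltnW.
have <- : (Submission.hilb D a B d i)%:Z = (hilb_poly D d)`_i.
  by apply: (hilb_sphere hD f generic); rewrite ltnS ltnW // ltnW.
by move=> ->; rewrite PoszD addrK.
Qed.

Lemma coefs_ideal i q : (i <= d)%N -> q \is i.-homog -> coefs q \in ideal_space i <-> in_ideal q.
Proof. by move=> id hq; apply: (ideal_spaceP a dD) => //; rewrite ltnS ltnW. Qed.

Lemma coords_exist i : exists w : 'Hom(Y, {ffun 'I_(hilb i) -> K^o}),
  forall c, c \in sr_space i -> (w c == 0) = (c \in ideal_space i).
Proof. exact/quotient_coordinates/ideal_space_sub. Qed.

Lemma dim_img_sr (Z : vectType K) (h : 'Hom(Y, Z)) i :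
  (forall c, c \in sr_space i -> h c = 0 -> c \in ideal_space i) ->
  (forall c, c \in ideal_space i -> h c = 0) -> \dim (h @: sr_space i) = hilb i.
Proof.
move=> h1 h2; have := dim_add_img h (sr_space i) 0; rewrite add0v dimv0 add0n.
have -> : (sr_space i :&: h @^-1: 0)%VS = ideal_space i.
  apply/vspaceP => c; rewrite memv_cap -memv_preim memv0.
  apply/andP/idP => [[cS /eqP/(h1 c cS)]//|cI]; split; last by rewrite h2.
  exact: (subvP (ideal_space_sub _ _ _ _ _) _ cI).
by move=> E; rewrite /Submission.hilb -E addnK.
Qed.

Lemma homogX i m (q : poly) : q \is i.-homog -> 'X_[m] * q \is (mdeg m + i).-homog.
Proof. by move=> hq; apply: dhomogM => //; rewrite dhomogX. Qed.

Section Level.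
Variable s : nat.
Hypothesis sd : (s.*2 < d)%N.
Hypothesis miss : forall F, missing_face D F -> (#|F| + s <= d.+1)%N.

Let sd' i : (i <= s)%N -> (i <= d)%N.
Proof. by move: sd; rewrite -addnn; lia. Qed.

Lemma level_step j y : (j < s)%N -> y \is j.-homog ->
  (forall v, in_ideal ('X_[mvar v] * y)) -> in_ideal y.
Proof.
move=> js; apply: (level_generic hD f data ha).
  by apply: leq_ltn_trans sd; rewrite leq_double.
by move=> F /miss; lia.
Qed.

Lemma level_iter i j y : (i + j <= s)%N -> y \is i.-homog ->
  (forall m, mdeg m = j -> in_ideal ('X_[m] * y)) -> in_ideal y.
Proof.
elim: j i y => [|j IH] i y ijs hy h.
  by have := h 0%MM mdeg0; rewrite mpolyX0 mul1r.
apply: (level_step (j := i)) => // [|v]; first by lia.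
apply: (IH i.+1); first by rewrite addSnnS.
  by have := homogX (mvar v) hy; rewrite mdeg1 add1n.
move=> m mj; rewrite mulrA -mpolyXD; apply: h.
by rewrite mdegD mdeg1 mj addn1.
Qed.

(** If degree i vanished, every monomial of degree i would kill 1, and [level_iter] would put 1 into
    the ideal. *)
Lemma hilb_pos i : (i <= s)%N -> (0 < hilb i)%N.
Proof.
move=> is_; rewrite lt0n; apply/eqP => h0.
have all_in q : q \is i.-homog -> in_ideal q.
  move=> hq; apply/(coefs_ideal (sd' is_) hq).
  have : (ideal_space i == sr_space i)%VS.
    by rewrite eqEdim ideal_space_sub -subn_eq0; apply/eqP.
  by move/eqP => ->; apply: coefs_sr_space.
have h1 : (1 : poly) \is 0.-homog by exact: dhomog1.
have /(coefs_ideal (leq0n d) h1) h : in_ideal 1.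
  apply: (@level_iter 0 i) => // m mi; rewrite mulr1; apply: all_in.
  by rewrite -mi dhomogX.
have := @hilb_gnum 0 isT; rewrite /= => -[].
rewrite /Submission.hilb => e; have : (\dim (sr_space 0) <= \dim (ideal_space 0))%N; last by lia.
apply: dimvS; apply/subvP => c hc; have ph := of_coefs_homog hc.
rewrite -(of_coefsK hc); move: (of_coefs c) ph => q ph.
have -> : q = q@_0 *: 1.
  apply/mpolyP => m; rewrite mcoeffZ mcoeff1; case: (eqVneq m 0%MM) => [->|m0]; first by rewrite mulr1.
  by rewrite mulr0; apply: (dhomog_nemf_coeff ph); rewrite /= mdeg_eq0.
by rewrite linearZ; apply: memvZ.
Qed.

Lemma hilb_mul i j : (i + j <= s)%N -> (hilb i <= hilb j * hilb (i + j))%N.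
Proof.
move=> ijs; have [w hw] := coords_exist (i + j).
(* A basis of this complement of the ideal lifts a basis of degree j of the quotient. *)
pose C := (sr_space j :\: ideal_space j)%VS.
have dC : \dim C = hilb j.
  by have := dimv_cap_compl (sr_space j) (ideal_space j); rewrite (capv_idPr (ideal_space_sub _ _ _ _ _)) /Submission.hilb => <-; rewrite addKn.
pose b (t : 'I_(\dim C)) : poly := of_coefs (vbasis C)`_t.
pose th (c : Y) : {ffun 'I_(\dim C) * 'I_(hilb (i + j)) -> K^o} :=
  [ffun z => w (coefs (b z.1 * of_coefs c)) z.2].
have thl : linear th.
  move=> t x y; apply/ffunP => z; rewrite [RHS]ffunE scale_ffunE !ffunE.
  by rewrite !linearP /= mulrDr -scalerAr !linearP /= ffunE scale_ffunE.
pose thL : {linear Y -> _} := HB.pack th (GRing.isLinear.Build _ _ _ _ th thl).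
have CS (t : 'I_(\dim C)) : (vbasis C)`_t \in sr_space j -> b t \is j.-homog by move=> h; apply: of_coefs_homog h.
have bC (t : 'I_(\dim C)) : (vbasis C)`_t \in sr_space j.
  have : (vbasis C)`_t \in C by apply: vbasis_mem; apply: mem_nth; rewrite size_tuple.
  exact: (subvP (diffvSl _ _)).
have bh t : b t \is j.-homog := CS t (bC t).
have key c : c \in sr_space i -> th c = 0 -> c \in ideal_space i.
  move=> cS c0; have ch := of_coefs_homog cS; rewrite -(of_coefsK cS).
  have i_d : (i <= d)%N by apply: sd'; lia.
  have j_d : (j <= d)%N by apply: sd'; lia.
  apply/(coefs_ideal i_d ch); apply: (level_iter ijs ch) => m mj.
  have bI t : in_ideal (b t * of_coefs c).
    have hh : b t * of_coefs c \is (i + j).-homog by rewrite addnC; apply: dhomogM.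
    apply/(coefs_ideal (sd' ijs) hh); rewrite -hw; last exact: coefs_sr_space.
    apply/eqP/ffunP => l; have := congr1 (fun h : {ffun _ -> K^o} => h (t, l)) c0.
    by rewrite !ffunE.
  have mS : coefs 'X_[m] \in sr_space j by apply: coefs_sr_space; rewrite -mj dhomogX.
  have : coefs 'X_[m] \in (C + ideal_space j)%VS.
    by rewrite /C addv_diff (addv_idPl (ideal_space_sub _ _ _ _ _)).
  case/memv_addP=> x xC [z zI e].
  have zS : z \in sr_space j := subvP (ideal_space_sub _ _ _ _ _) _ zI.
  pose q : poly := 'X_[m] - (\sum_t coord (vbasis C) t x *: b t).
  have qI : in_ideal q.
    have hq : q \is j.-homog.
      apply: rpredB; first by rewrite -mj dhomogX.
      by apply: rpred_sum => t _; apply: rpredZ.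
    apply/(coefs_ideal j_d hq); rewrite linearB /= e linear_sum /=.
    have -> : \sum_(t < \dim C) coefs (coord (vbasis C) t x *: b t) = x.
      transitivity (\sum_(t < \dim C) coord (vbasis C) t x *: (vbasis C)`_t); last by rewrite -(coord_vbasis xC).
      apply: eq_bigr => t _; by rewrite linearZ /= (of_coefsK (bC t)).
    by rewrite [x + z]addrC addrK.
  have -> : 'X_[m] * of_coefs c = of_coefs c * q + \sum_t coord (vbasis C) t x *: (b t * of_coefs c).
    rewrite /q mulrBr [of_coefs c * _]mulrC mulr_sumr.
    rewrite -addrA [X in _ + X](_ : _ = 0) ?addr0 //.
    rewrite addrC; apply/eqP; rewrite subr_eq0; apply/eqP; rewrite ?mulr_sumr; apply: eq_bigr => t _.
    by rewrite -scalerAr mulrC.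
  apply: in_idealD; first exact: (in_idealM dD).
  by apply: in_ideal_sum => t _; apply: (in_idealZ dD).
have : (\dim (linfun thL @: sr_space i) <= hilb j * hilb (i + j))%N.
  apply: leq_trans (dimvS (subvf _)) _.
  by rewrite dimvf /dim /= muln1 card_prod !card_ord dC.
have := dim_add_img (linfun thL) (sr_space i) 0; rewrite add0v dimv0 add0n => E le.
have : (\dim (sr_space i :&: linfun thL @^-1: 0) <= \dim (ideal_space i))%N.
  apply: dimvS; apply/subvP => c; rewrite memv_cap -memv_preim memv0 lfunE /= => /andP[cS /eqP].
  exact: key.
rewrite /Submission.hilb in le *; move: E le; move: (\dim _) (\dim _) (\dim _) (\dim _) => *; lia.
Qed.

(** [macaulay_module] is applied to the dual of the quotient N, whose generators are dual to N_s:
    for m of degree k, [(l, m)] is the functional on N_(s-k) taking mu to coordinate l of m mu in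
    N_s. The number of generators does not enter the bound, which compares positive degrees; this is
    why the reversed sequence may start with 1. *)
Lemma hilb_macaulay_dual k : (k.+2 <= s)%N ->
  (hilb (s - k.+2) <= upper k.+1 (hilb (s - k.+1)))%N.
Proof.
move=> ks; have [w hw] := coords_exist s.
pose c := hilb s.
have kB : (k.+3 < B)%N by move: sd; rewrite -addnn; lia.
pose e i (x : 'I_c * 'X_{1..#|V|}) : Y :=
  [ffun mu : mon => if mdeg mu == (s - i)%N then w (coefs ('X_[x.2] * 'X_[mu])) x.1 else 0].
have dims i : (i <= s)%N -> (i < B)%N -> \dim <<map (e i) (gens #|V| c B i)>> = hilb (s - i).
  move=> is_ iB.
  pose G (x : 'I_c * mon) (mu : mon) : K :=
    if (mdeg x.2 == i) && (mdeg mu == (s - i)%N) then w (coefs ('X_[x.2] * 'X_[mu])) x.1 else 0.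
  have -> : <<map (e i) (gens #|V| c B i)>>%VS = <<[seq ([ffun mu => G x mu] : Y) | x : 'I_c * mon]>>%VS.
    apply/eqP; rewrite eqEsubv; apply/andP; split; apply/span_subvP => z.
      case/mapP=> [[l m]]; rewrite mem_gens /= => /andP[/eqP mi mB] ->.
      apply: memv_span; apply/mapP; exists (l, BMultinom mB); first by rewrite mem_enum.
      by apply/ffunP => mu; rewrite !ffunE /G /= mi eqxx.
    case/mapP=> [[l m]] _ ->; have [mi|mi] := eqVneq (mdeg m) i.
      apply: memv_span; apply/mapP; exists (l, val m); first by rewrite mem_gens /= mi eqxx iB.
      by apply/ffunP => mu; rewrite !ffunE /G /= mi eqxx.
    rewrite (_ : [ffun mu => _] = 0) ?mem0v //.
    by apply/ffunP => mu; rewrite !ffunE /G /= (negPf mi).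
  (* The transposed matrix describes multiplication by the monomials of degree i from degree s - i
     into degree s, which is injective by [level_iter]. *)
  rewrite rank_transpose.
  pose th (q : Y) : {ffun 'I_c * mon -> K^o} :=
    [ffun x : 'I_c * mon => if mdeg x.2 == i then w (coefs ('X_[x.2] * of_coefs q)) x.1 else 0].
  have thl : linear th.
    move=> t x y; apply/ffunP => z; rewrite [RHS]ffunE scale_ffunE !ffunE.
    case: ifP => _; last by rewrite scaler0 addr0.
    by rewrite !linearP /= mulrDr -scalerAr !linearP /= ffunE scale_ffunE.
  pose thL : {linear Y -> _} := HB.pack th (GRing.isLinear.Build _ _ _ _ th thl).
  rewrite -(@dim_img_sr _ (linfun thL)).
  - congr (\dim _); apply/eqP; rewrite eqEsubv; apply/andP; split.
      apply/span_subvP => z /mapP[mu _ ->].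
      have [mus|mus] := eqVneq (mdeg mu) (s - i)%N; last first.
        rewrite (_ : [ffun x => _] = 0) ?mem0v //.
        by apply/ffunP => x; rewrite !ffunE /G (negPf mus) andbF.
      have -> : [ffun x => G x mu] = linfun thL (coefs 'X_[mu]).
        have hmu : ('X_[mu] : poly) \is (s - i).-homog by rewrite -mus dhomogX.
        apply/ffunP => x; rewrite lfunE /= !ffunE /G mus eqxx andbT; case: eqP => // xi.
        have sB : (s < B)%N by move: sd; rewrite -addnn; lia.
        have hX : coefs ('X_[x.2] * (of_coefs (coefs 'X_[mu]) - 'X_[mu]) : poly) = 0.
          have hs : 'X_[x.2] * (of_coefs (coefs 'X_[mu]) - 'X_[mu] : poly) \is s.-homog.
            rewrite (_ : s = mdeg x.2 + (s - i))%N; last by rewrite xi; lia.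
            apply: homogX; apply: rpredB => //; apply: (of_coefs_homog (D := D)).
            exact: coefs_sr_space.
          apply/(sr_ideal_coefs D sB hs).
          have hd : sr_ideal D (of_coefs (coefs 'X_[mu]) - 'X_[mu] : poly) by apply: of_coefs_coefs hmu; lia.
          exact: (submoduleZ _ (sr_ideal_submodule K dD) hd).
        by move: hX; rewrite mulrBr linearB /= => /eqP; rewrite subr_eq0 => /eqP ->.
      by apply: memv_img; apply: coefs_sr_space; rewrite -mus dhomogX.
    apply/subvP => _ /memv_imgP[q qS ->]; rewrite lfunE /=.
    have qh := of_coefs_homog qS.
    have -> : th q = \sum_(mu : mon) (of_coefs q)@_mu *: ([ffun x => G x mu] : {ffun 'I_c * mon -> K^o}).
      apply/ffunP => x; rewrite sum_ffunE ffunE; case: eqP => [xi|/eqP xi]; last first.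
        by rewrite big1 // => mu _; rewrite scale_ffunE ffunE /G (negPf xi) scaler0.
      rewrite {1}(@coefs_mvar_expansion _ _ B (of_coefs q)); last first.
        move=> m mB; apply: (dhomog_nemf_coeff qh) => /=.
        by apply: contraTneq mB => ->; rewrite -ltnNge; move: sd; rewrite -addnn; lia.
      rewrite mulr_sumr !linear_sum sum_ffunE; apply: eq_bigr => mu _.
      rewrite -scalerAr !linearZ /= !scale_ffunE [in RHS]ffunE /G xi eqxx /=; case: eqP => // /eqP mus.
      by rewrite (dhomog_nemf_coeff qh) // !scale0r.
    by apply: memv_suml => mu _; apply/memvZ/memv_span/map_f; rewrite mem_enum.
  - move=> q qS; rewrite lfunE /= => q0; have qh := of_coefs_homog qS; rewrite -(of_coefsK qS).
    have si_d : (s - i <= d)%N by apply: sd'; lia.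
    apply/(coefs_ideal si_d qh); apply: (level_iter (j := i) _ qh); first by rewrite subnK.
    move=> m mi; have hh : 'X_[m] * of_coefs q \is s.-homog.
      by have := homogX m qh; rewrite mi subnKC.
    apply/(coefs_ideal (sd' (leqnn s)) hh); rewrite -hw; last exact: coefs_sr_space.
    apply/eqP/ffunP => l; have mB : (mdeg m < B)%N by rewrite mi.
    have := congr1 (fun h : {ffun _ -> K^o} => h (l, BMultinom mB)) q0.
    by rewrite !ffunE /= mi eqxx.
  move=> q qI; rewrite lfunE /=; have qS := subvP (ideal_space_sub _ _ _ _ _) _ qI.
  have qh := of_coefs_homog qS; apply/ffunP => x; rewrite !ffunE; case: eqP => // xi.
  have si_d : (s - i <= d)%N by apply: sd'; lia.
  have /(coefs_ideal si_d qh) qII : coefs (of_coefs q) \in ideal_space (s - i) by rewrite (of_coefsK qS).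
  have hh : 'X_[x.2] * of_coefs q \is s.-homog by have := homogX x.2 qh; rewrite xi subnKC.
  suff /eqP -> : w (coefs ('X_[x.2] * of_coefs q)) == 0 by rewrite ffunE.
  rewrite hw ?coefs_sr_space //; apply/(coefs_ideal (sd' (leqnn s)) hh).
  exact: (in_idealM dD).
rewrite -(dims k.+2) -?(dims k.+1); try by lia.
apply: macaulay_module => // r l m v rk mk.
have -> : map (e k.+1) r = in_tuple (map (e k.+1) r) by [].
move/coord_span => E.
have -> : e k.+2 (l, m + U_(v))%MM = \sum_(t < size (map (e k.+1) r))
    coord (in_tuple (map (e k.+1) r)) t (e k.+1 (l, m)) *:
    e k.+2 (let x := nth (l, m) r t in (x.1, x.2 + U_(v))%MM).
  apply/ffunP => mu; rewrite sum_ffunE ffunE; case: eqP => [mus|/eqP mus]; last first.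
    by rewrite big1 // => t _; rewrite scale_ffunE ffunE (negPf mus) scaler0.
  have mB : (mdeg (U_(v) + mu)%MM < B)%N by rewrite mdegD mdeg1 mus; move: sd; rewrite -addnn; lia.
  have ms : mdeg (U_(v) + mu)%MM = (s - k.+1)%N by rewrite mdegD mdeg1 mus; lia.
  have := congr1 (fun h : Y => h (BMultinom mB)) E; rewrite sum_ffunE ffunE /= ms eqxx.
  rewrite mpolyXD mulrA -mpolyXD => ->; apply: eq_bigr => t _.
  have tr : (t < size r)%N by rewrite -(size_map (e k.+1)).
  rewrite !scale_ffunE (nth_map (l, m)) // !ffunE /= ms mus !eqxx.
  by rewrite mpolyXD mulrA -mpolyXD.
apply: memv_suml => t _; apply/memvZ/memv_span.
have tr : (t < size r)%N by rewrite -(size_map (e k.+1)).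
by apply/mapP; exists (nth (l, m) r t); rewrite ?mem_nth.
Qed.

End Level.

Lemma hilb_macaulay k : (k.+2 <= d)%N -> (hilb k.+2 <= upper k.+1 (hilb k.+1))%N.
Proof.
move=> kd; have kB : (k.+3 < B)%N by lia.
have h i : exists w : 'Hom(Y, {ffun 'I_(hilb i) -> K^o}),
  forall c, c \in sr_space i -> (w c == 0) = (c \in ideal_space i) by apply: coords_exist.
have [w1 h1] := h k.+1; have [w2 h2] := h k.+2.
have dims i (w : 'Hom(Y, {ffun 'I_(hilb i) -> K^o})) : (i <= d)%N ->
    (forall c, c \in sr_space i -> (w c == 0) = (c \in ideal_space i)) ->
    \dim <<[seq w (coefs 'X_[x.2]) | x <- gens #|V| 1 B i]>> = hilb i.
  move=> id hw; rewrite -[RHS](@dim_img_sr _ w).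
  - congr (\dim _); apply/eqP; rewrite eqEsubv; apply/andP; split.
      apply/span_subvP => z /mapP[x]; rewrite mem_gens => /andP[/eqP xi _] ->.
      by apply: memv_img; apply: coefs_sr_space; rewrite -xi dhomogX.
    apply/subvP => _ /memv_imgP[q qS ->]; rewrite -(of_coefsK qS); have qh := of_coefs_homog qS.
    rewrite (mpolyE (of_coefs q)) !linear_sum big_seq; apply: memv_suml => m hm.
    rewrite !linearZ /=; apply/memvZ/memv_span/mapP; exists (ord0, m) => //.
    by rewrite mem_gens /= (dhomog_mf qh hm) eqxx /= ltnS ltnW.
  - by move=> c cS /eqP; rewrite hw.
  - move=> c cI; apply/eqP; rewrite hw //; exact: (subvP (ideal_space_sub _ _ _ _ _) _ cI).
rewrite -(dims _ w1) //; last by lia.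
rewrite -(dims _ w2) //.
apply: (@macaulay_module _ _ _ _ B kB _ _ (fun x => w1 (coefs 'X_[x.2])) (fun x => w2 (coefs 'X_[x.2]))) => //.
move=> r l m v rk mk /=.
have rX m' : mdeg m' = k.+1 -> ('X_[m'] : poly) \is k.+1.-homog by move=> <-; rewrite dhomogX.
set X := map _ r; have -> : X = in_tuple X by [].
move/coord_span => E.
pose al t := coord (in_tuple X) t (w1 (coefs 'X_[m])).
have eX : size X = size r by rewrite size_map.
have tr (t : 'I_(size X)) : (t < size r)%N by rewrite -eX.
have rdeg (t : 'I_(size X)) : mdeg (nth (l, m) r t).2 = k.+1.
  by have := rk _ (mem_nth (l, m) (tr t)); rewrite mem_gens => /andP[/eqP].
pose q : poly := 'X_[m] - \sum_t al t *: 'X_[(nth (l, m) r t).2].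
have qh : q \is k.+1.-homog.
  apply: rpredB; first by rewrite -mk dhomogX.
  by apply: rpred_sum => t _; apply: rpredZ; apply: rX.
have k1d : (k.+1 <= d)%N by lia.
have qI : in_ideal q.
  have wq : w1 (coefs q) =
      w1 (coefs 'X_[m]) - \sum_t al t *: w1 (coefs 'X_[(nth (l, m) r t).2]).
    rewrite /q linearB /= linearB /= linear_sum /= linear_sum /=; congr (_ - _).
    by apply: eq_bigr => t _; rewrite linearZ /= linearZ.
  apply/(coefs_ideal k1d qh); rewrite -h1 ?coefs_sr_space // wq {1}E subr_eq0.
  by apply/eqP/eq_bigr => t _; congr (_ *: _); rewrite (nth_map (l, m)).
have vqh : 'X_[U_(v)] * q \is k.+2.-homog by have := homogX U_(v)%MM qh; rewrite mdeg1 add1n.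
have : coefs ('X_[U_(v)] * q) \in ideal_space k.+2.
  by apply/(coefs_ideal kd vqh); apply: (in_idealM dD).
rewrite -h2 ?coefs_sr_space // mulrBr !linearB /= subr_eq0 => /eqP.
rewrite -mpolyXD [(U_(v) + m)%MM]addmC => ->; rewrite mulr_sumr !linear_sum.
apply: memv_suml => t _; rewrite -scalerAr !linearZ /= -mpolyXD addmC.
apply/memvZ/memv_span/mapP; exists (nth (l, m) r t) => //.
by rewrite mem_nth.
Qed.

End HilbertGeneric.

(** * Level rings *)

(** A linear model [W] of the polynomial ring modulo the kernel of [pi], which is a proper ideal by
    [qm_ideal] and [qm_one]. *)
Record quotient_map (L : fieldType) n (Y : vectType L) (pi : {linear {mpoly L[n]} -> Y})
    (W : {vspace Y}) : Prop := {
  qm_in : forall p, pi p \in W;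
  qm_onto : forall w, w \in W -> exists p, pi p = w;
  qm_ideal : forall p q, pi q = 0 -> pi (p * q) = 0;
  qm_one : pi 1 != 0 }.

Section QuotientAlgebra.
Variables (L : fieldType) (n : nat) (Y : vectType L) (pi : {linear {mpoly L[n]} -> Y}).
Variables (W : {vspace Y}) (H : quotient_map pi W).
Local Notation A := {mpoly L[n]}.

(** The let-binding makes the type depend on [H], so that the ring structure, whose axioms rest on
    [H], can be attached to it. *)
Definition quotient_algebra : Type := let _ := H in subvs_of W.
HB.instance Definition _ := Vector.copy quotient_algebra (subvs_of W).
Implicit Types x y z : quotient_algebra.

Definition qval (x : quotient_algebra) : Y := vsval (x : subvs_of W).
Definition qproj (p : A) : quotient_algebra := vsproj W (pi p).

Lemma qvalK p : qval (qproj p) = pi p.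
Proof. by rewrite /qval /qproj vsprojK // (qm_in H). Qed.

Lemma qval_inj : injective qval.
Proof. exact: (@subvs_inj _ _ W). Qed.

Lemma qproj_eq p q : qproj p = qproj q <-> pi (p - q) = 0.
Proof.
rewrite linearB; split=> [/(congr1 qval)|/eqP]; first by rewrite !qvalK => ->; rewrite subrr.
by rewrite subr_eq0 => /eqP h; apply: qval_inj; rewrite !qvalK.
Qed.

Fact qrepr_subproof x : exists p, pi p == qval x.
Proof. by have [p hp] := qm_onto H (subvsP (x : subvs_of W)); exists p; rewrite hp. Qed.

Definition qrepr x : A := xchoose (qrepr_subproof x).

Lemma qreprK x : qproj (qrepr x) = x.
Proof. by apply: qval_inj; rewrite qvalK; apply/eqP/(xchooseP (qrepr_subproof x)). Qed.

Lemma qprojP x : exists p, x = qproj p.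
Proof. by exists (qrepr x); rewrite qreprK. Qed.

Fact qproj_is_linear : linear qproj.
Proof. by move=> c p q; rewrite /qproj !linearP. Qed.
HB.instance Definition _ := GRing.isLinear.Build L A quotient_algebra *:%R qproj qproj_is_linear.

Definition qmul x y : quotient_algebra := qproj (qrepr x * qrepr y).

Lemma qmulE p q : qmul (qproj p) (qproj q) = qproj (p * q).
Proof.
have hp : pi (qrepr (qproj p) - p) = 0 by apply/qproj_eq; rewrite qreprK.
have hq : pi (qrepr (qproj q) - q) = 0 by apply/qproj_eq; rewrite qreprK.
apply/qproj_eq; set p' := qrepr _ in hp *; set q' := qrepr _ in hq *.
have -> : p' * q' - p * q = p' * (q' - q) + q * (p' - p).
  by rewrite !mulrBr [q * p']mulrC [q * p]mulrC addrA subrK.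
by rewrite linearD /= !(qm_ideal H) // addr0.
Qed.

Fact qmulA : associative qmul.
Proof.
move=> x y z; have [p ->] := qprojP x; have [q ->] := qprojP y; have [r ->] := qprojP z.
by rewrite !qmulE mulrA.
Qed.
Fact qmulC : commutative qmul.
Proof.
by move=> x y; have [p ->] := qprojP x; have [q ->] := qprojP y; rewrite !qmulE mulrC.
Qed.
Fact qmul1 : left_id (qproj 1) qmul.
Proof. by move=> x; have [p ->] := qprojP x; rewrite qmulE mul1r. Qed.
Fact qmulDl : left_distributive qmul +%R.
Proof.
move=> x y z; have [p ->] := qprojP x; have [q ->] := qprojP y; have [r ->] := qprojP z.
by rewrite -linearD /= !qmulE mulrDl linearD.
Qed.
Fact qone_neq0 : qproj 1 != 0.
Proof.
apply: contraNneq (qm_one H) => h; rewrite -[1](subr0 1); apply/eqP/qproj_eq.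
by rewrite h linear0.
Qed.

HB.instance Definition _ :=
  GRing.Zmodule_isComNzRing.Build quotient_algebra qmulA qmulC qmul1 qmulDl qone_neq0.

Fact qscaleAl (c : L) x y : c *: (x * y) = (c *: x) * y.
Proof.
have [p ->] := qprojP x; have [q ->] := qprojP y.
change (c *: qmul (qproj p) (qproj q) = qmul (c *: qproj p) (qproj q)).
have -> : c *: qproj p = qproj (c *: p) by rewrite linearZ.
by rewrite !qmulE -scalerAl [RHS]linearZ.
Qed.
HB.instance Definition _ := GRing.Lmodule_isLalgebra.Build L quotient_algebra qscaleAl.

Fact qscaleAr (c : L) x y : c *: (x * y) = x * (c *: y).
Proof. by rewrite ![x * _]mulrC scalerAl. Qed.
HB.instance Definition _ := GRing.Lalgebra_isAlgebra.Build L quotient_algebra qscaleAr.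
HB.instance Definition _ := Algebra_isFalgebra.Build L quotient_algebra.

Fact qproj_is_monoid_morphism : GRing.monoid_morphism qproj.
Proof. by split=> // p q; rewrite -[LHS]qmulE. Qed.
HB.instance Definition _ :=
  GRing.isMonoidMorphism.Build A quotient_algebra qproj qproj_is_monoid_morphism.

Fact qval_is_linear : linear qval.
Proof. by move=> c x y; rewrite /qval linearP. Qed.
HB.instance Definition _ := GRing.isLinear.Build L quotient_algebra Y *:%R qval qval_is_linear.

Lemma quotient_algebra_exists : exists (N : falgType L) (phi : {lrmorphism A -> N})
    (iota : 'Hom(N, Y)),
  [/\ lker iota == 0%VS, forall p, iota (phi p) = pi p & forall y : N, exists p, phi p = y].
Proof.
exists quotient_algebra, qproj, (linfun qval); split.
- by apply/lker0P => x y; rewrite !lfunE; apply: qval_inj.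
- by move=> p; rewrite lfunE /= qvalK.
- by move=> y; have [p ->] := qprojP y; exists p.
Qed.

End QuotientAlgebra.

(** * The graded quotient truncated at the socle degree *)

Section LevelRing.
Variables (R : realType) (V : finType) (D : {set {set V}}) (B k s : nat) (a : nat -> V -> R).
Hypothesis dD : down_closed D.
Hypothesis sB : (s < B)%N.
Hypothesis top_neq0 : (0 < hilb D a B k s)%N.
Hypothesis one_out : hilb D a B k 0 = 1%N.
Hypothesis level_step : forall i y, (i < s)%N -> y \is i.-homog ->
  (forall v, in_ideal D a k ('X_[mvar v] * y)) -> in_ideal D a k y.
Local Notation poly := {mpoly R[#|V|]}.
Local Notation Y := {ffun 'X_{1..#|V| < B} -> R^o}.
Local Notation Z := {ffun 'I_s.+1 -> Y}.
Local Notation coefs := (coefs D B).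
Local Notation ideal_space := (ideal_space D a B k).
Local Notation sr_space := (sr_space R D B).

Let iB (i : 'I_s.+1) : (i < B)%N.
Proof. by apply: leq_trans sB; apply: ltn_ord. Qed.

(** A linear normal form modulo the ideal, which models the quotient inside Y itself. *)
Definition modulo i (c : Y) : Y := c - projv (ideal_space i) c.

Let modulo_eq0 i c : (modulo i c == 0) = (c \in ideal_space i).
Proof.
rewrite /modulo subr_eq0; apply/eqP/idP => [->|h]; first exact: memv_proj.
by rewrite projv_id.
Qed.

Definition component (i : 'I_s.+1) (c : Y) : Z := [ffun j : 'I_s.+1 => if j == i then modulo i c else 0].

Fact component_is_linear i : linear (component i).
Proof.
move=> t x y; apply/ffunP => j; rewrite [RHS]ffunE scale_ffunE !ffunE.
case: ifP => _; last by rewrite scaler0 addr0.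
by rewrite /modulo linearP /= scalerBr opprD addrACA.
Qed.
HB.instance Definition _ i := GRing.isLinear.Build R Y Z *:%R (component i) (component_is_linear i).

(** Degrees above s are dropped: the ring is the quotient truncated at s, so that degree s lies in
    the socle from the start. *)
Definition graded_class (p : poly) : Z := [ffun i : 'I_s.+1 => modulo i (coefs (pihomog mdeg i p))].

Fact graded_class_is_linear : linear graded_class.
Proof.
move=> t x y; apply/ffunP => j; rewrite [RHS]ffunE scale_ffunE !ffunE /modulo.
have -> : pihomog mdeg j (t *: x + y) = t *: pihomog mdeg j x + pihomog mdeg j y.
  by rewrite raddfD /= linearZ.
by rewrite (coefs_is_linear D B) linearP /= scalerBr opprD addrACA.
Qed.
HB.instance Definition _ := GRing.isLinear.Build R poly Z *:%R graded_class graded_class_is_linear.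

Let pi_eq0 p : graded_class p = 0 <-> forall i, (i <= s)%N -> in_ideal D a k (pihomog mdeg i p).
Proof.
split=> [/ffunP h i is_|h].
  pose i' := Ordinal (is_ : (i < s.+1)%N); have := h i'; rewrite !ffunE => /eqP.
  rewrite modulo_eq0 => hc; have hp : pihomog mdeg i p \is i.-homog := pihomogP mdeg i p.
  exact: (ideal_spaceP a dD k (iB i') hp).1 hc.
apply/ffunP => i; rewrite !ffunE; apply/eqP; rewrite modulo_eq0.
have hp : pihomog mdeg i p \is i.-homog := pihomogP mdeg i p.
by apply: (ideal_spaceP a dD k (iB i) hp).2; apply: h; rewrite -ltnS.
Qed.

Let pi_component (i : 'I_s.+1) p : p \is i.-homog -> graded_class p = component i (coefs p).
Proof.
move=> hp; apply/ffunP => j; rewrite !ffunE; case: eqP => [->|/eqP ji].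
  by rewrite pihomog_dE.
suff -> : pihomog mdeg j p = 0 by rewrite linear0 /modulo linear0 subr0.
apply/mpolyP => m; rewrite mcoeff_pihomog mcoeff0; case: eqP => // mj.
by apply: (dhomog_nemf_coeff hp); rewrite /= mj.
Qed.

Definition class_space := (\sum_(i < s.+1) linfun (component i) @: sr_space i)%VS.

Let pi_sum p : graded_class p = \sum_(i < s.+1) component i (coefs (pihomog mdeg i p)).
Proof.
apply/ffunP => j; rewrite sum_ffunE ffunE (bigD1 j) //= big1 => [|i ij].
  by rewrite addr0 ffunE eqxx.
by rewrite ffunE eq_sym (negPf ij).
Qed.

Lemma pi_quotient_map : quotient_map graded_class class_space.
Proof.
split.
- move=> p /=; rewrite pi_sum; apply: memv_sumr => i _; rewrite -lfunE.
  by apply: memv_img; apply: coefs_sr_space; apply: pihomogP.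
- move=> w /memv_sumP[u hu ->].
  have h (i : 'I_s.+1) : exists p, p \is i.-homog /\ graded_class p = u i.
    have /memv_imgP[c hc ->] := hu i isT.
    exists (of_coefs c); have ph := of_coefs_homog hc; split=> //.
    by rewrite (pi_component ph) lfunE /= (of_coefsK hc).
  have [p hp] := fin_all_exists h; exists (\sum_i p i).
  by rewrite linear_sum /=; apply: eq_bigr => i _; case: (hp i).
- move=> p q /= /pi_eq0 h; apply/pi_eq0 => i is_.
  rewrite (mpolyE p) mulr_suml raddf_sum /=; apply: in_ideal_sum => m _.
  rewrite -scalerAl linearZ /=; apply: (in_idealZ dD).
  have -> : pihomog mdeg i ('X_[m] * q) =
      if (mdeg m <= i)%N then 'X_[m] * pihomog mdeg (i - mdeg m) q else 0.
    apply/mpolyP => l; rewrite mcoeff_pihomog mcoeffXM; case: (leqP (mdeg m) i) => mi.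
      rewrite mcoeffXM mcoeff_pihomog; case: (boolP (m <= l)%MM) => [ml|]; last by case: ifP.
      have := congr1 mdeg (submK ml); rewrite mdegD => E.
      by rewrite -E -[in RHS](eqn_add2r (mdeg m)) subnK.
    rewrite mcoeff0; case: eqP => // li; case: ifP => // ml.
    by have := congr1 mdeg (submK ml); rewrite mdegD li => E; move: mi; rewrite -E ltnNge leq_addl.
  case: ifP => _; last exact: in_ideal0.
  by apply: (in_idealM dD); apply: h; apply: leq_trans is_; apply: leq_subr.
rewrite /=; apply/eqP => /pi_eq0/(_ 0%N (leq0n s)).
have h1 : (1 : poly) \is 0.-homog by exact: dhomog1.
rewrite pihomog_dE // => /(ideal_spaceP a dD k (iB ord0) h1) h.
have : (\dim (sr_space 0) <= \dim (ideal_space 0))%N.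
  apply: dimvS; apply/subvP => c hc; have ph := of_coefs_homog hc.
  rewrite -(of_coefsK hc); move: (of_coefs c) ph => p ph.
  have -> : p = p@_0 *: 1.
    apply/mpolyP => m; rewrite mcoeffZ mcoeff1; case: (eqVneq m 0%MM) => [->|m0]; first by rewrite mulr1.
    by rewrite mulr0; apply: (dhomog_nemf_coeff ph); rewrite /= mdeg_eq0.
  by rewrite linearZ; apply: memvZ.
by move: one_out; rewrite /hilb; move: (\dim _) (\dim _) => *; lia.
Qed.

Lemma level_sequence_hilb :
  level_sequence R [seq (hilb D a B k i)%:Z | i <- iota 0 s.+1].
Proof.
have [N [phi [iota_ [/lker0P ker0 iotaE phi_onto]]]] := quotient_algebra_exists pi_quotient_map.
have {}iotaE p : iota_ (phi p) = graded_class p := iotaE p.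
pose G (i : 'I_s.+1) := (linfun (component i) @: sr_space i)%VS.
pose Ngr i := if insub i is Some i' then (iota_ @^-1: G i')%VS else 0%VS.
have NgrE (i : 'I_s.+1) : Ngr i = (iota_ @^-1: G i)%VS by rewrite /Ngr valK.
have Ngr_above i : (s < i)%N -> Ngr i = 0%VS.
  by move=> si; rewrite /Ngr insubF // ltnS leqNgt si.
have phi_eq0 p : phi p = 0 <-> graded_class p = 0.
  by rewrite -iotaE; split=> [->|h]; [rewrite linear0 | apply: ker0; rewrite linear0].
have NgrP i y : y \in Ngr i <-> exists2 p, p \is i.-homog & phi p = y.
  have [is_|si] := leqP i s; last first.
    rewrite (Ngr_above _ si) memv0; split=> [/eqP ->|[p hp <-]].
      by exists 0; rewrite ?rpred0 // linear0.
    apply/eqP/phi_eq0/pi_eq0 => j js.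
    suff -> : pihomog mdeg j p = 0 by apply: in_ideal0.
    apply/mpolyP => m; rewrite mcoeff_pihomog mcoeff0; case: eqP => // mj.
    by apply: (dhomog_nemf_coeff hp); rewrite /= mj; apply/eqP; lia.
  rewrite -[i]/(nat_of_ord (Ordinal (is_ : (i < s.+1)%N))); move: (Ordinal _) => {is_} i'.
  rewrite NgrE -memv_preim; split=> [/memv_imgP[c hc ec]|[p hp <-]].
    exists (of_coefs c); first exact: of_coefs_homog hc.
    by apply: ker0; rewrite iotaE (pi_component (of_coefs_homog hc)) (of_coefsK hc) ec lfunE.
  rewrite iotaE (pi_component hp) -lfunE; apply: memv_img; exact: coefs_sr_space.
have GE (i : 'I_s.+1) : (iota_ @: Ngr i)%VS = G i.
  rewrite NgrE lpreimK //; apply/subvP => _ /memv_imgP[c hc ->]; rewrite lfunE /=.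
  rewrite -(of_coefsK hc) -(pi_component (of_coefs_homog hc)) -iotaE.
  exact/memv_img/memvf.
have dimG (i : 'I_s.+1) : \dim (Ngr i) = hilb D a B k i.
  have <- : \dim (G i) = \dim (Ngr i).
    rewrite -GE limg_dim_eq //; apply/eqP; rewrite -subv0; apply/subvP => y.
    by rewrite memv_cap memv_ker memv0 => /andP[_ /eqP h]; apply/eqP/ker0; rewrite linear0.
  have := dim_add_img (linfun (component i)) (sr_space i) 0.
  rewrite add0v dimv0 add0n -/(G i) => E.
  have e2 : (sr_space i :&: linfun (component i) @^-1: 0)%VS = ideal_space i.
    apply/vspaceP => c; rewrite memv_cap -memv_preim memv0 lfunE /=.
    have -> : (component i c == 0) = (c \in ideal_space i).
      rewrite -modulo_eq0; apply/eqP/eqP => [/ffunP/(_ i)|h]; first by rewrite !ffunE eqxx.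
      by apply/ffunP => j; rewrite !ffunE; case: ifP.
    apply/andP/idP => [[]//|h]; split=> //; exact: (subvP (ideal_space_sub D a B k i) _ h).
  by rewrite e2 in E; rewrite /hilb -E addnK.
have component_sum (q : 'I_s.+1 -> poly) (i : 'I_s.+1) : (forall j, q j \is (nat_of_ord j).-homog) ->
    pihomog mdeg i (\sum_j q j) = q i.
  move=> hq; apply/mpolyP => m; rewrite mcoeff_pihomog raddf_sum /=.
  case: eqP => [mi|/eqP mi]; last by rewrite (dhomog_nemf_coeff (hq i)).
  rewrite (bigD1 i) //= big1 ?addr0 // => j ji; apply: (dhomog_nemf_coeff (hq j)).
  by rewrite /= mi eq_sym.
have phi_homog_sum p : phi p = \sum_(i < s.+1) phi (pihomog mdeg i p).
  have E : phi (p - \sum_(i < s.+1) pihomog mdeg i p) = phi p - \sum_(i < s.+1) phi (pihomog mdeg i p).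
    by rewrite rmorphB rmorph_sum.
  apply/eqP; rewrite -subr_eq0 -E; apply/eqP/phi_eq0/pi_eq0 => i is_.
  have [i' ei] : exists i' : 'I_s.+1, i = i' by exists (Ordinal (is_ : (i < s.+1)%N)).
  have -> : pihomog mdeg i (p - \sum_(i < s.+1) pihomog mdeg i p) = 0; last exact: in_ideal0.
  have e2 := component_sum (fun j => pihomog mdeg j p) i' (fun j => pihomogP mdeg j p).
  by rewrite pihomogB ei e2 subrr.
exists #|V|, N, phi, Ngr, s; split; last first.
- rewrite /= one_out; congr (_ :: _); apply/eq_in_map => i; rewrite mem_iota => /andP[_ is_].
  have is' : (i < s.+1)%N by lia.
  by rewrite -(dimG (Ordinal is')).
- move=> y; split=> [soc|/NgrP[p hp <-] i]; last first.
    rewrite -rmorphM; apply/phi_eq0/pi_eq0 => j js.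
    suff -> : pihomog mdeg j ('X_i * p) = 0 by apply: in_ideal0.
    apply: (pihomog_ne0 (d := s.+1)); first by apply/eqP; lia.
    by rewrite -add1n; apply: dhomogM => //; rewrite dhomogX /= mdeg1.
  (* The component of a socle element in a degree i < s is killed by the variables in degree i + 1,
     which is not truncated, so it vanishes by [level_step]. *)
  have [p ep] := phi_onto y; rewrite -ep in soc *; rewrite phi_homog_sum.
  rewrite big_ord_recr /= big1 => [|i _].
    by rewrite add0r; apply/NgrP; exists (pihomog mdeg s p) => //; apply: pihomogP.
  apply/phi_eq0/pi_eq0 => j js; have [->|ji] := eqVneq j i; last first.
    rewrite (pihomog_ne0 (d := i)) ?pihomogP //; first exact: in_ideal0.
    by rewrite eq_sym.
  rewrite pihomog_id; apply: level_step => //; first exact: pihomogP.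
  move=> v; have := soc (enum_rank v); rewrite -rmorphM => /phi_eq0/pi_eq0/(_ i.+1 (ltn_ord i)).
  suff -> : pihomog mdeg i.+1 ('X_(enum_rank v) * p) = 'X_[mvar v] * pihomog mdeg i p by [].
  apply/mpolyP => m; rewrite mcoeff_pihomog !mcoeffXM mcoeff_pihomog; case: (boolP (mvar v <= m)%MM) => [vm|]; last by case: ifP.
  have := congr1 mdeg (submK vm); rewrite mdegD mdeg1 => E.
  by rewrite -E addn1 eqSS.
split.
- exact: phi_onto.
- exact: NgrP.
- split.
    apply/directv_sum_independent => u hu u0 i _.
    have h (j : 'I_s.+1) : exists p, p \is j.-homog /\ phi p = u j.
      by have /NgrP[p] := hu j isT; exists p.
    have [p hp] := fin_all_exists h.
    have : phi (\sum_j p j) = 0 by rewrite linear_sum -[RHS]u0; apply: eq_bigr => j _; case: (hp j).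
    move=> /phi_eq0/pi_eq0/(_ i); rewrite -ltnS ltn_ord (component_sum p i (fun j => (hp j).1)) => /(_ isT) hI.
    have [ph <-] := hp i; apply/phi_eq0/pi_eq0 => j js.
    have [ji|ji] := eqVneq j i; first by rewrite ji pihomog_dE.
    by rewrite (pihomog_ne0 (d := i)) //; [apply: in_ideal0 | rewrite eq_sym].
  apply/vspaceP => y; rewrite memvf; have [p <-] := phi_onto y; rewrite phi_homog_sum.
  apply: memv_sumr => i _; apply/NgrP; exists (pihomog mdeg i p) => //; exact: pihomogP.
- by rewrite -dimv_eq0 -[s]/(nat_of_ord (@ord_max s)) dimG -lt0n.
- exact: Ngr_above.
Qed.

End LevelRing.

Lemma M_sequence_upper (h : nat -> nat) n :
  (forall k, (k.+2 <= n)%N -> (h k.+2 <= upper k.+1 (h k.+1))%N) ->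
  M_sequence (1 :: [seq (h i)%:Z | i <- iota 1 n]).
Proof.
move=> hh; split=> //; first by apply/allP => x; rewrite inE => /orP[/eqP ->//|/mapP[i _ ->]].
case=> // i _; rewrite /= size_map size_iota !ltnS => ii.
exists (upper i.+1 (h i.+1)).
  by rewrite (nth_map 0%N) ?size_iota 1?ltnW // nth_iota 1?ltnW // add1n absz_nat; apply: pseudo_power_upper.
by rewrite (nth_map 0%N) ?size_iota // nth_iota // add1n lez_nat; apply: hh.
Qed.

(** Maximality of u forces d > 0, since for d = 0 there are no missing faces and u + 1 would do as
    well, and u >= 0, since a missing face has at most d + 1 vertices. Then [utilde] is a minimum of
    natural numbers. *)
Lemma largest_u_bounds (V : finType) (D : {set {set V}}) d u : sphere d D -> largest_u d D u ->
  ((utilde d u).*2 < d)%N /\ forall F, missing_face D F -> (#|F| + utilde d u <= d.+1)%N.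
Proof.
move=> hD [[_ hF] hmax].
have face_pos F : missing_face D F -> exists v, v \in F.
  move=> [_ FD _]; apply/set0Pn; apply: contraNneq FD => ->.
  by case: hD => -[].
have d0 : (0 < d)%N.
  rewrite lt0n; apply/eqP => d0; have := hmax (u + 1).
  suff h : inS (d%:Z - (u + 1)) d D by move=> /(_ h); lia.
  split=> // F mF; have [v vF] := face_pos F mF; case: mF => /subsetP/(_ v vF).
  by rewrite inE => /(sphere_card hD); rewrite cards1 d0.
have u0 : 0 <= u.
  apply: hmax; split=> // F mF; have [v vF] := face_pos F mF; case: mF => _ _ /(_ (F :\ v)).
  rewrite properD1 // => /(_ isT)/(sphere_card hD); rewrite [#|F|](cardsD1 v) vF; lia.
case: u u0 hF {hmax} => // u _ hF.
have e : utilde d u = minn u (d.-1 %/ 2).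
  rewrite /utilde; have -> : (d%:Z - 1) = d.-1%:Z by lia.
  rewrite divz_nat; case: (leP u%:Z _) => h; rewrite absz_nat; lia.
rewrite e; split; first by rewrite -addnn; lia.
move=> F /hF; lia.
Qed.

Theorem corollary6p5 (R : realType) (V : finType) (D : {set {set V}})
    (d : nat) (u : int) (hD : sphere d D) (hu : largest_u d D u) :
  let g := gnum d D in
  let ut := utilde d u in
  [/\ level_sequence R [seq g i | i <- iota 0 ut.+1],
      forall i j : nat, (1 <= i)%N -> (1 <= j)%N -> (i + j <= ut)%N ->
        g i <= g j * g (i + j)%N,
      M_sequence (1 :: [seq g i | i <- iota 1 d./2]) &
      (1 <= ut)%N ->
        M_sequence (1 :: rcons (rev [seq g i | i <- iota 1 ut.-1]) 1)].
Proof.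
move=> g ut; have [ud miss] := largest_u_bounds hD hu.
have [K [f [a [p [da [dp [data ha]]]]]]] := generic_field_exists V d.
have dD := sphere_down_closed hD.
have K2 := char2_addrr f; have generic := generic_independent hD K2 data ha.
(* All d + 1 forms are divided out, and the cut-off d + 2 keeps the degrees up to d + 1. *)
pose h i := hilb D a d.+2 d.+1 i.
have hg i : (i.*2 <= d)%N -> (h i)%:Z = g i := @hilb_gnum _ _ _ hD _ f _ _ _ _ data ha i.
have hgu i : (i <= ut)%N -> (h i)%:Z = g i.
  by move=> iu; apply: hg; apply: leq_trans (ltnW ud); rewrite leq_double.
have h0 : h 0%N = 1%N by have := hg 0%N isT; case.
pose psi : {rmorphism {mpoly int[#|{: 'I_d.+1 * V}|]} -> K} :=
  mmap intr (fun i : 'I_#|{: 'I_d.+1 * V}| => a (enum_val i).1 (enum_val i).2).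
have hpsi j v : (j <= d)%N -> psi (coefvar d j v) = a j v.
  by move=> jd; rewrite /psi /coefvar /= mmapX mmap1U enum_rankK /= inordK.
have uB : (ut < d.+2)%N by move: ud; rewrite -addnn /ut; lia.
have step k i : (k <= d)%N -> (i < ut)%N ->
    hilb D a d.+2 k i.+1 = (hilb D a d.+2 k.+1 i.+1 + hilb D a d.+2 k i)%N.
  move=> kd iu; move: kd; rewrite leq_eqVlt => /orP[/eqP ->|kd].
    by apply: (hilb_last hD f data ha); apply: leq_ltn_trans ud; rewrite leq_double ltnW.
  apply: hilb_regular => //; first by apply: leq_ltn_trans uB.
  by move=> y _; apply: (lform_regular hD f generic kd).
have level i y := level_step hD f data ha ud miss (j := i) (y := y).
split.
- have [b [eb lb]] := real_forms dD R hpsi uB step level.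
  have := level_sequence_hilb dD uB _ _ lb; rewrite (eb _ (leqnn _)) (eb 0%N (leq0n _)).
  move=> /(_ (hilb_pos hD f data ha ud miss (leqnn _)) h0).
  suff -> : [seq (hilb D b d.+2 d.+1 i)%:Z | i <- iota 0 ut.+1] = [seq g i | i <- iota 0 ut.+1] by [].
  by apply/eq_in_map => i; rewrite mem_iota => /andP[_ iu]; rewrite eb ?hgu.
- move=> i j _ _ iju; rewrite -!hgu //; try by lia.
  by rewrite -PoszM lez_nat; apply: (hilb_mul hD f data ha ud miss).
- suff -> : [seq g i | i <- iota 1 d./2] = [seq (h i)%:Z | i <- iota 1 d./2].
    apply: M_sequence_upper => k kd; apply: (hilb_macaulay hD a).
    by have := odd_double_half d; lia.
  apply/eq_in_map => i; rewrite mem_iota => /andP[_ id]; rewrite hg //.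
  by have := odd_double_half d; lia.
move=> u1.
(* The reversed sequence consists of dimensions of the dual, and its last entry is h 0 = 1. *)
suff -> : rcons (rev [seq g i | i <- iota 1 ut.-1]) 1 = [seq (h (ut - i)%N)%:Z | i <- iota 1 ut].
  apply: M_sequence_upper => k ku; exact: (hilb_macaulay_dual hD f data ha ud miss).
have sz : size (rcons (rev [seq g i | i <- iota 1 ut.-1]) 1) = ut.
  by rewrite size_rcons size_rev size_map size_iota prednK.
apply: (@eq_from_nth _ 0); first by rewrite sz size_map size_iota.
rewrite sz => i iu; rewrite (nth_map 0%N) ?size_iota // nth_iota // nth_rcons size_rev size_map size_iota.
case: ltnP => iu'.
  rewrite nth_rev ?size_map ?size_iota // (nth_map 0%N) ?size_iota; last by lia.
  rewrite nth_iota; last by lia.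
  by rewrite -hgu; [congr (h _)%:Z; lia | lia].
have -> : i = ut.-1 by lia.
by rewrite eqxx add1n prednK // subnn h0.
Qed.
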